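(* Let $n\ge1$ be an integer, $p_F:=1+\frac2n$, $p_m:=1+\frac1{n+1}$, and let $1<p\le p_F$. Let $u_0:\mathbb{R}^n\to\mathbb{R}$ satisfy $$u_0\in L^1(\mathbb{R}^n)\cap L^\infty(\mathbb{R}^n),\qquad |x|u_0\in L^1(\mathbb{R}^n),\qquad \int_{\mathbb{R}^n}u_0(x)\,dx=0,\qquad \int_{\mathbb{R}^n}x\,u_0(x)\,dx\neq0 .$$ For $\varepsilon>0$ let $T_\varepsilon\in(0,\infty]$ be the maximal existence time of the bounded mild solution of $u_t-\Delta u=|u|^p$, $u(0,x)=\varepsilon u_0(x)$ on $\mathbb{R}^n$. For $1<p<p_F$ and $0<\varepsilon<1$ define $$\mathcal L_p(\varepsilon):=\begin{cases}\varepsilon^{-\frac{2(p-1)}{2-(n+1)(p-1)}},&1<p<p_m,\\[1mm] \varepsilon^{-\frac2{n+1}}\left(\log\frac1\varepsilon\right)^{-\frac2{n+2}},&p=p_m,\\[1mm] \varepsilon^{-\frac{2p(p-1)}{2-n(p-1)}},&p_m<p<p_F.\end{cases}$$ Then there exist constants $\varepsilon_0,c,C>0$, depending only on $n,p$ and $u_0$, such that the following hold for all $0<\varepsilon<\varepsilon_0$. (i) If $1<p<p_F$, then $c\,\mathcal L_p(\varepsilon)\le T_\varepsilon\le C\,\mathcal L_p(\varepsilon)$. (ii) If $p=p_F=1+2/n$, then $\exp\left(c\,\varepsilon^{-p(p-1)}\right)\le T_\varepsilon\le \exp\left(C\,\varepsilon^{-p(p-1)}\right)$. In particular, $T_\varepsilon<\infty$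 for every sufficiently small $\varepsilon>0$ when $1<p\le p_F$.
   Context: $G(t,x)=(4\pi t)^{-n/2}e^{-|x|^2/(4t)}$ is the heat kernel on $\mathbb{R}^n$, $e^{t\Delta}f=G(t,\cdot)*f$ for $t>0$, and $e^{0\Delta}f=f$. A bounded mild solution on $[0,T)$ of $u_t-\Delta u=|u|^p$, $u(0)=\varepsilon u_0$, is a real-valued measurable function $u$ on $[0,T)\times\mathbb{R}^n$, bounded on $[0,T']\times\mathbb{R}^n$ for every $T'<T$, satisfying $u(t)=\varepsilon e^{t\Delta}u_0+\int_0^t e^{(t-s)\Delta}|u(s)|^p\,ds$ for $0\le t<T$. For bounded $u_0$ such a solution exists locally, is unique, and satisfies the $L^\infty$ blow-up alternative; $T_\varepsilon$ is the supremum of the $T$ for which it exists. *)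

(* Defs.v *)
From HB Require Import structures.
From mathcomp Require Import all_boot all_order all_algebra.
From mathcomp Require Import all_classical all_reals all_analysis.
Set Implicit Arguments.
Unset Strict Implicit.
Unset Printing Implicit Defensive.
Import Order.TTheory GRing.Theory Num.Theory.
Import numFieldNormedType.Exports.
Local Open Scope classical_set_scope.
Local Open Scope ring_scope.

(* The library equips tuples with the product sigma-algebra, which on R^n is
   the Borel sigma-algebra. *)
Notation Rn R n := (n.-tuple (measurableTypeR R)).

Section lebesgue_cons.
Context (R : realType) (n : nat).
Variable m : {sigma_finite_measure set (Rn R n) -> \bar R}.

Definition cons_pair (z : measurableTypeR R * Rn R n) : Rn R n.+1 :=
  [tuple of z.1 :: z.2].

Definition uncons_pair (x : Rn R n.+1) : measurableTypeR R * Rn R n :=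
  (thead x, [tuple of behead x]).

Lemma cons_pairK : cancel cons_pair uncons_pair.
Proof.
by move=> [a x]; congr (_, _); exact/val_inj.
Qed.

Lemma measurable_cons_pair : measurable_fun setT cons_pair.
Proof. exact: measurable_cons. Qed.

Lemma measurable_uncons_pair : measurable_fun setT uncons_pair.
Proof.
apply/measurable_fun_pairP; split; first exact: measurable_tnth.
exact: measurable_behead.
Qed.

(* The product of the Lebesgue measure of R with m, carried to R^(n+1). *)
Definition lebesgue_cons : set (Rn R n.+1) -> \bar R :=
  pushforward (lebesgue_measure \x m)%E cons_pair.

HB.instance Definition _ := Measure.copy lebesgue_cons
  (measure_function_pushforward__canonical__measure_function_Measure
     (lebesgue_measure \x m)%E measurable_cons_pair).

Lemma lebesgue_consE (A : set (measurableTypeR R)) (B : set (Rn R n)) :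
  measurable A -> measurable B ->
  lebesgue_cons (uncons_pair @^-1` (A `*` B)) = (lebesgue_measure A * m B)%E.
Proof.
move=> mA mB; rewrite -product_measure1E// /lebesgue_cons /pushforward.
rewrite -comp_preimage (_ : uncons_pair \o cons_pair = idfun)//.
by apply/funext => z; exact: cons_pairK.
Qed.

Let lebesgue_cons_sigma_finite : sigma_finite setT lebesgue_cons.
Proof.
have /sigma_finiteP[F [TF ndF Foo]] := sigma_finiteT (@lebesgue_measure R).
have /sigma_finiteP[G [TG ndG Goo]] := sigma_finiteT m.
exists (fun k => uncons_pair @^-1` (F k `*` G k)).
  apply/esym; rewrite -subTset => x _.
  have [i _ Fi] : (\bigcup_k F k) (uncons_pair x).1 by rewrite -TF.
  have [j _ Gj] : (\bigcup_k G k) (uncons_pair x).2 by rewrite -TG.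
  exists (maxn i j) => //; split.
    by move: Fi; exact/subsetPset/ndF/leq_maxl.
  by move: Gj; exact/subsetPset/ndG/leq_maxr.
move=> k; have [mF Fk] := Foo k; have [mG Gk] := Goo k; split.
  rewrite -[X in measurable X]setTI.
  by apply: measurable_uncons_pair => //; exact: measurableX.
by rewrite lebesgue_consE// lte_mul_pinfty// ge0_fin_numE.
Qed.

HB.instance Definition _ :=
  @Measure_isSigmaFinite.Build _ _ _ lebesgue_cons lebesgue_cons_sigma_finite.

End lebesgue_cons.

Fixpoint lebesgue_Rn (R : realType) (n : nat) :
    {sigma_finite_measure set (Rn R n) -> \bar R} :=
  match n with
  | 0 => @dirac _ (Rn R 0) [tuple] R
  | k.+1 => lebesgue_cons (lebesgue_Rn R k)
  end.

Section heat.
Context (R : realType) (n : nat).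
Implicit Types (x y : Rn R n) (f g : Rn R n -> R).

Local Notation mu := (lebesgue_Rn R n).

Definition coordinate (i : 'I_n) x : R := tnth x i.

Definition sub_Rn x y : Rn R n :=
  [tuple (coordinate i x - coordinate i y : measurableTypeR R) | i < n].

Definition enorm x : R := Num.sqrt (\sum_(i < n) coordinate i x ^+ 2).

Definition heat_kernel (t : R) x : R :=
  (4 * pi * t) `^ (- (n%:R / 2)) * expR (- (enorm x ^+ 2 / (4 * t))).

Definition convolution f g x : R := \int[mu]_y (f (sub_Rn x y) * g y).

Definition heat_semigroup (t : R) f : Rn R n -> R :=
  if 0 < t then convolution (heat_kernel t) f else f.

(* The Duhamel identity is an equality in L^oo(R^n) for each t; in particular
   u 0 need only agree with eps * u0 almost everywhere. *)
Record bounded_mild_solution (p eps : R) (u0 : Rn R n -> R) (T : \bar R)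
    (u : R -> Rn R n -> R) : Prop := BoundedMildSolution {
  mild_measurable :
    measurable_fun
      [set z : measurableTypeR R * Rn R n | 0 <= z.1 /\ (z.1%:E < T)%E]
      (fun z => u z.1 z.2);
  mild_bounded : forall T' : R, (T'%:E < T)%E ->
    exists M : R, forall t x, 0 <= t <= T' -> `|u t x| <= M;
  mild_duhamel : forall t : R, 0 <= t -> (t%:E < T)%E ->
    {ae mu, forall x, u t x = eps * heat_semigroup t u0 x +
      \int[lebesgue_measure]_(s in `[0, t])
        heat_semigroup (t - s) (fun y => `|u s y| `^ p) x}
}.

Definition lifespan (p eps : R) (u0 : Rn R n -> R) : \bar R :=
  ereal_sup [set T | (0 < T)%E /\ exists u, bounded_mild_solution p eps u0 T u].

Definition p_F : R := 1 + 2 / n%:R.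

Definition p_m : R := 1 + 1 / n.+1%:R.

(* Only meaningful for 1 < p < p_F and 0 < eps < 1. *)
Definition lifespan_rate (p eps : R) : R :=
  if p < p_m then
    eps `^ (- (2 * (p - 1) / (2 - n.+1%:R * (p - 1))))
  else if p == p_m then
    eps `^ (- (2 / n.+1%:R)) * ln (1 / eps) `^ (- (2 / n.+2%:R))
  else
    eps `^ (- (2 * p * (p - 1) / (2 - n%:R * (p - 1)))).

End heat.
Arguments p_F : clear implicits.
Arguments p_m : clear implicits.
Arguments lifespan_rate {R} n p eps.

(* Main.v *)
Require Import Defs.
From HB Require Import structures.
From mathcomp Require Import all_boot all_order all_algebra.
From mathcomp Require Import all_classical all_reals all_analysis.
From mathcomp Require Import measurable_realfun ring lra.
Set Implicit Arguments.
Unset Strict Implicit.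
Unset Printing Implicit Defensive.
Import Order.TTheory GRing.Theory Num.Theory.
Import numFieldNormedType.Exports.
Local Open Scope classical_set_scope.
Local Open Scope ring_scope.

(** Put [q = p - 1], [a = n * q / 2] and [b = p / 2 + a]. The mean of [u0] vanishes and its first
    moment does not, so the linear flow of [eps * u0] has size [eps * t^(-1/2)] relative to a heat
    kernel of time [t]: it decays by half a power of time faster than the flow of data of nonzero
    mean. The source [|u|^p] is then of size [eps^p * t^(-p/2 - n p/2)] on a ball of volume
    [t^(n/2)], and it creates mass at the rate [eps^p * t^(-b)]. This mass is positive, so the
    zero mean is soon forgotten; and a mass [m] spread over the scale [t^(1/2)] grows at the
    rate [m^p * t^(-a)], so that it blows up once [m^q] times the integral of [t^(-a)] is of order
    one. The lifespan is thus, up to constants, the solution [T] of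

    [(eps^p * \int_0^T (1 + s)^(-b) ds)^q * \int_0^T (1 + s)^(-a) ds = 1].

    The rates follow by computing the integrals. The first one grows like a power, like a
    logarithm, or stays bounded according to the position of [p] with respect to [p_m], where
    [b = 1]; the second one grows like a power when [p < p_F] and like a logarithm when [p = p_F],
    where [a = 1].

    That the lifespan is at least of this order is [lifespan_ge]. There is a profile [Theta]
    (the lemmas on [heat_barrier]) which the heat flow preserves up to a constant, which decays
    like [t^(-n/2)], and which dominates [(1 + t)^(1/2)] times the linear flow; only the last
    property uses that the mean vanishes, through a Lipschitz bound for the heat kernel. As long
    as the condition above holds with a small constant on the right, a combination of
    [(1 + t)^(-1/2) * Theta] and [Theta] is a supersolution, and Picard iteration below it
    ([exists_mild_solution]) gives a solution.

    That the lifespan is at most of this order is [mild_solution_bound]. The solution is tested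
    against heat kernels of time [t] centred at [t^(1/2) * xi], where [xi] points in a direction
    in which the first moment does not vanish; there the linear flow is bounded below
    ([linear_lower_bound]). Kernels of this family at two different times compare well
    ([heat_kernel_moving_center]), so that with Jensen's inequality the mass created by the source
    satisfies an integral inequality ([source_inequality]), and the solutions of that inequality
    blow up ([blow_up_bound]). *)

(** * Gaussian integrals and the Chapman-Kolmogorov identity *)

Section product_integral.
Context (R : realType).
Local Notation lam := (@lebesgue_measure R).

Lemma ge0_integral_lebesgue_RnS n (F : Rn R n.+1 -> \bar R) :
  measurable_fun [set: Rn R n.+1] F -> (forall x, 0 <= F x)%E ->
  (\int[lebesgue_Rn R n.+1]_x F x =
   \int[lam]_a \int[lebesgue_Rn R n]_x F (cons_pair (a, x)))%E.
Proof.
move=> mF F0.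
rewrite -(fubini_tonelli1 (m1 := lam) (m2 := lebesgue_Rn R n)
  (fun z => F (cons_pair z))) //; last first.
  by apply: measurableT_comp => //; exact: measurable_cons_pair.
by rewrite [LHS]ge0_integral_pushforward ?preimage_setT//; exact: measurable_cons_pair.
Qed.

(** Tonelli, one coordinate at a time: a Gaussian is a product over the coordinates, so
    this reduces every integral of Gaussians over the space to integrals over the
    line. *)
Lemma integral_prod_Rn n (f : 'I_n -> R -> R) :
  (forall i, measurable_fun setT (f i)) -> (forall i a, 0 <= f i a) ->
  (\int[lebesgue_Rn R n]_x (\prod_(i < n) f i (tnth x i))%:E =
   \prod_(i < n) \int[lam]_a (f i a)%:E)%E.
Proof.
elim: n f => [|n IH] f mf f0.
  under eq_integral do rewrite big_ord0.
  rewrite big_ord0 /= integral_dirac//=.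
  by rewrite diracT mul1e.
have mtn (i : 'I_n.+1) : measurable_fun setT (fun x : Rn R n.+1 => f i (tnth x i)).
  apply: (@measurableT_comp _ _ _ _ _ _ (f i)) => //; exact: measurable_tnth.
rewrite ge0_integral_lebesgue_RnS; last 2 first.
  by apply/measurable_EFinP; apply: measurable_prod => i _; exact: mtn.
  by move=> x; rewrite lee_fin prodr_ge0.
have mtn' (i : 'I_n) : measurable_fun setT
    (fun x : Rn R n => f (lift ord0 i) (tnth x i)).
  by apply: (@measurableT_comp _ _ _ _ _ _ (f _)) => //; exact: measurable_tnth.
rewrite big_ord_recl -(IH (fun i => f (lift ord0 i)))//.
rewrite -ge0_integralZr//; last 2 first.
- by move=> a _; rewrite lee_fin.
- by apply: integral_ge0 => x _; rewrite lee_fin prodr_ge0.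
- apply: eq_integral => a _.
  rewrite -ge0_integralZl//.
  + apply: eq_integral => x _.
    rewrite -EFinM big_ord_recl/=; congr (_ * _)%:E.
    by apply: eq_bigr => i _; rewrite tnthS.
  + by apply/measurable_EFinP; apply: measurable_prod => i _; exact: mtn'.
  + by move=> x _; rewrite lee_fin prodr_ge0.
  + by rewrite lee_fin.
- by apply/measurable_EFinP; exact: (mf ord0).
Qed.

End product_integral.

Section kernel.
Context (R : realType).
Local Notation lam := (@lebesgue_measure R).
Implicit Types (t s r a b : R).

(** The heat kernel of the line. *)
Definition gauss1 t a : R := (4 * pi * t) `^ (- (1 / 2)) * expR (- (a ^+ 2 / (4 * t))).

Lemma gauss1_ge0 t a : 0 <= gauss1 t a.
Proof. by rewrite mulr_ge0// ?powR_ge0// expR_ge0. Qed.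

Lemma measurable_gauss1 t : measurable_fun setT (gauss1 t).
Proof.
apply: measurable_funM => //; apply: measurableT_comp => //.
apply: measurableT_comp => //; apply: measurable_funM => //.
Qed.

(** The one-dimensional kernel is the normal density of variance [2 * t]. *)
Lemma integral_gauss1 t b : 0 < t ->
  (\int[lam]_a (gauss1 t (a - b))%:E = 1)%E.
Proof.
move=> t0; rewrite -(integral_normal_pdf b (Num.sqrt (2 * t))).
apply: eq_integral => a _; congr EFin.
have s0 : Num.sqrt (2 * t) != 0 by rewrite gt_eqF// sqrtr_gt0 mulr_gt0.
rewrite normal_pdfE// /gauss1 /normal_peak /normal_fun !sqr_sqrtr; last first.
  by rewrite mulr_ge0// ltW.
congr (_ * expR _).
  have -> : 2 * t * pi *+ 2 = 4 * pi * t by rewrite -mulr_natr; ring.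
  rewrite powRN mul1r powR12_sqrt// !mulr_ge0// ?pi_ge0// ltW//.
by rewrite mulNr; congr (- (_ / _)); rewrite -mulr_natr; ring.
Qed.

(** Completing the square in [z]. The first factor is the Gaussian that the convolution
    must produce and the second one is a Gaussian density in [z], whose integral is
    one. *)
Lemma gauss1_mul t s a b z : 0 < t -> 0 < s ->
  gauss1 t (a - z) * gauss1 s (z - b) =
  gauss1 (t + s) (a - b) * gauss1 (t * s / (t + s)) (z - (s * a + t * b) / (t + s)).
Proof.
move=> t0 s0; rewrite /gauss1.
have ts0 : 0 < t + s by rewrite addr_gt0.
rewrite [LHS]mulrACA [RHS]mulrACA -!expRD -!powRM; try by rewrite !mulr_ge0 ?pi_ge0 ?invr_ge0// ltW.
congr (_ `^ _ * expR _).
  by field; rewrite gt_eqF.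
by field; rewrite !gt_eqF.
Qed.

Lemma gauss1_chapman t s a b : 0 < t -> 0 < s ->
  (\int[lam]_z (gauss1 t (a - z) * gauss1 s (z - b))%:E = (gauss1 (t + s) (a - b))%:E)%E.
Proof.
move=> t0 s0; under eq_integral do rewrite gauss1_mul// EFinM.
rewrite ge0_integralZl//.
- by rewrite integral_gauss1 ?mule1// divr_gt0 ?mulr_gt0 ?addr_gt0.
- apply/measurable_EFinP.
  apply: (measurableT_comp (measurable_gauss1 _)).
  exact: measurable_funB.
- by move=> x _; rewrite lee_fin gauss1_ge0.
- by rewrite lee_fin gauss1_ge0.
Qed.

Context (n : nat).
Implicit Types x y z : Rn R n.
Local Notation mu := (lebesgue_Rn R n).

Lemma enorm_sqr x : enorm x ^+ 2 = \sum_(i < n) tnth x i ^+ 2.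
Proof. by rewrite sqr_sqrtr// sumr_ge0// => i _; rewrite sqr_ge0. Qed.

Lemma heat_kernelE t x : 0 < t ->
  heat_kernel t x = \prod_(i < n) gauss1 t (tnth x i).
Proof.
move=> t0; rewrite big_split/= -expR_sum prodr_const card_ord.
rewrite /heat_kernel enorm_sqr; congr (_ * expR _).
  by rewrite -powR_mulrn ?powR_ge0// -powRrM; congr (_ `^ _); lra.
by rewrite mulr_suml -sumrN.
Qed.

Lemma heat_kernel_ge0 t x : 0 <= heat_kernel t x.
Proof. by rewrite mulr_ge0 ?powR_ge0 ?expR_ge0. Qed.

Lemma tnth_sub_Rn x y i : tnth (sub_Rn x y) i = tnth x i - tnth y i.
Proof. by rewrite tnth_mktuple. Qed.

Lemma integral_heat_kernel t x : 0 < t ->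
  (\int[mu]_y (heat_kernel t (sub_Rn x y))%:E = 1)%E.
Proof.
move=> t0.
transitivity (\int[mu]_y (\prod_(i < n) gauss1 t (tnth y i - tnth x i))%:E)%E.
  apply: eq_integral => y _; rewrite heat_kernelE//; congr EFin.
  apply: eq_bigr => i _; by rewrite tnth_sub_Rn /gauss1 -sqrrN opprB.
rewrite (integral_prod_Rn (f := fun i a => gauss1 t (a - tnth x i))).
- by rewrite big1// => i _; exact: integral_gauss1.
- move=> i; apply: (measurableT_comp (measurable_gauss1 _)).
  exact: measurable_funB.
- by move=> *; exact: gauss1_ge0.
Qed.

Lemma heat_kernel_chapman t s x y : 0 < t -> 0 < s ->
  (\int[mu]_z (heat_kernel t (sub_Rn x z) * heat_kernel s (sub_Rn z y))%:E =
  (heat_kernel (t + s) (sub_Rn x y))%:E)%E.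
Proof.
move=> t0 s0.
under eq_integral => z _.
  rewrite !heat_kernelE// -big_split/=.
  under eq_bigr do rewrite !tnth_sub_Rn.
  over.
rewrite (integral_prod_Rn (f := fun i a => gauss1 t (tnth x i - a) * gauss1 s (a - tnth y i))).
- rewrite heat_kernelE ?addr_gt0//; under [in RHS]eq_bigr do rewrite tnth_sub_Rn.
  by rewrite -prodEFin; apply: eq_bigr => i _; exact: gauss1_chapman.
- move=> i; apply: measurable_funM.
    by apply: (measurableT_comp (measurable_gauss1 _)); exact: measurable_funB.
  by apply: (measurableT_comp (measurable_gauss1 _)); exact: measurable_funB.
- by move=> *; rewrite mulr_ge0 ?gauss1_ge0.
Qed.

End kernel.

(** * Measurability of parametric integrals and of the heat flow *)

Section measurability.
Context (R : realType).
Local Notation lam := (@lebesgue_measure R).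

Lemma measurable_invr : measurable_fun [set: R] (GRing.inv : R -> R).
Proof.
have -> : (GRing.inv : R -> R) = (fun x => x * (x ^+ 2) `^ (-1)).
  apply/funext => x; rewrite powR_inv1 ?sqr_ge0//.
  have [->|x0] := eqVneq x 0; first by rewrite invr0 mul0r.
  by rewrite expr2 invfM mulrA divff// mul1r.
apply: measurable_funM => //; apply: (@measurableT_comp _ _ _ _ _ _ (@powR R ^~ (-1))) => //.
Qed.

Section parametric.
Context d (T : measurableType d).

(** Tonelli gives the measurability of the integrals of the positive and the negative
    part. *)
Lemma measurable_integral_snd d2 (T2 : measurableType d2)
    (m2 : {sigma_finite_measure set T2 -> \bar R}) (F : T * T2 -> \bar R) :
  measurable_fun setT F -> measurable_fun setT (fun x => \int[m2]_y F (x, y))%E.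
Proof.
move=> mF.
under eq_fun do rewrite integralE.
apply: emeasurable_funB.
- rewrite (_ : (fun x => _) = fubini_F m2 (F^\+)%E); last first.
    by apply/funext => x; apply: eq_integral => y _; rewrite !funeposE.
  apply: measurable_fun_fubini_tonelli_F => //; exact: measurable_funepos.
- rewrite (_ : (fun x => _) = fubini_F m2 (F^\-)%E); last first.
    by apply/funext => x; apply: eq_integral => y _; rewrite !funenegE.
  apply: measurable_fun_fubini_tonelli_F => //; exact: measurable_funeneg.
Qed.

Lemma measurable_Rintegral_snd d2 (T2 : measurableType d2)
    (m2 : {sigma_finite_measure set T2 -> \bar R}) (F : T * T2 -> R) :
  measurable_fun setT F -> measurable_fun setT (fun x => \int[m2]_y F (x, y)).
Proof.
move=> mF; apply: (measurableT_comp (fine_measurable measurableT)).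
by apply: (measurable_integral_snd m2 (F := EFin \o F)); exact/measurable_EFinP.
Qed.

Context (n : nat).

Lemma measurable_sub_Rn (X Y : T -> Rn R n) :
  measurable_fun setT X -> measurable_fun setT Y ->
  measurable_fun setT (fun z => sub_Rn (X z) (Y z)).
Proof.
move=> mX mY; apply/measurable_fun_tnthP => i.
rewrite (_ : _ \o _ = (fun z => tnth (X z) i - tnth (Y z) i)); last first.
  by apply/funext => z /=; rewrite tnth_sub_Rn.
by apply: measurable_funB; apply: (measurableT_comp (measurable_tnth i)).
Qed.

Lemma measurable_enorm_sqr (X : T -> Rn R n) :
  measurable_fun setT X -> measurable_fun setT (fun z => enorm (X z) ^+ 2).
Proof.
move=> mX; under eq_fun do rewrite enorm_sqr.
apply: measurable_sum => i; apply: measurable_funX.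
exact: (measurableT_comp (measurable_tnth i)).
Qed.

Lemma measurable_enorm (X : T -> Rn R n) :
  measurable_fun setT X -> measurable_fun setT (fun z => enorm (X z)).
Proof.
move=> mX; under eq_fun => z.
  rewrite -[enorm _]ger0_norm ?sqrtr_ge0// -sqrtr_sqr -powR12_sqrt ?sqr_ge0//.
  over.
apply: (@measurableT_comp _ _ _ _ _ _ (@powR R ^~ (2^-1))) => //.
exact: measurable_enorm_sqr.
Qed.

Lemma measurable_heat_kernel (tau : T -> R) (X : T -> Rn R n) :
  measurable_fun setT tau -> measurable_fun setT X ->
  measurable_fun setT (fun z => heat_kernel (tau z) (X z)).
Proof.
move=> mt mX; apply: measurable_funM.
  apply: (@measurableT_comp _ _ _ _ _ _ (@powR R ^~ _)) => //.
  exact: measurable_funM.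
apply: measurableT_comp => //; apply: measurableT_comp => //.
apply: measurable_funM; first exact: measurable_enorm_sqr.
by apply: (measurableT_comp measurable_invr); exact: measurable_funM.
Qed.

End parametric.

(** Time, point and datum all depend on the parameter because, in the Duhamel integral,
    the time of the flow and the function that it acts on both vary with the integration
    variable. *)
Lemma measurable_heat_semigroup d (T : measurableType d) n (tau : T -> R) (X : T -> Rn R n)
    (w : T -> Rn R n -> R) :
  measurable_fun setT tau -> measurable_fun setT X ->
  measurable_fun setT (fun z : T * Rn R n => w z.1 z.2) ->
  measurable_fun setT (fun z => heat_semigroup (tau z) (w z) (X z)).
Proof.
move=> mt mX mw.
rewrite (_ : (fun z => _) = (fun z => if 0 < tau z then
   \int[lebesgue_Rn R n]_y (heat_kernel (tau z) (sub_Rn (X z) y) * w z y) else w z (X z))); last first.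
  by apply/funext => z; rewrite /heat_semigroup; case: ifP.
apply: measurable_fun_ifT; first exact: measurable_fun_ltr.
  apply: (measurable_Rintegral_snd (lebesgue_Rn R n)
    (F := fun p => heat_kernel (tau p.1) (sub_Rn (X p.1) p.2) * w p.1 p.2)).
  apply: measurable_funM => //; apply: measurable_heat_kernel.
    exact: (measurableT_comp mt).
  by apply: measurable_sub_Rn => //; exact: (measurableT_comp mX).
apply: (measurableT_comp mw (g := fun z => (z, X z))).
exact: measurable_fun_pair.
Qed.

Context (n : nat).
Local Notation mu := (lebesgue_Rn R n).

Definition duhamel (w : R -> Rn R n -> R) (t : R) (x : Rn R n) : R :=
  \int[lam]_(s in `[0, t]) heat_semigroup (t - s) (w s) x.

Definition jointly_measurable (w : R -> Rn R n -> R) :=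
  measurable_fun setT (fun z : measurableTypeR R * Rn R n => w z.1 z.2).

Lemma jointly_measurable_comp d (T : measurableType d) w (tau : T -> R)
    (Y : T -> Rn R n) : jointly_measurable w ->
  measurable_fun setT tau -> measurable_fun setT Y ->
  measurable_fun setT (fun z => w (tau z) (Y z)).
Proof.
move=> mw mt mY; apply: (measurableT_comp mw (g := fun z => (tau z, Y z))).
exact: measurable_fun_pair.
Qed.

Lemma jointly_measurable_section w t : jointly_measurable w -> measurable_fun setT (w t).
Proof. by move=> mw; exact: jointly_measurable_comp. Qed.

Lemma measurable_semigroup_time w t x : jointly_measurable w ->
  measurable_fun [set: measurableTypeR R] (fun s => heat_semigroup (t - s) (w s) x).
Proof.
move=> mw; apply: measurable_heat_semigroup => //.
exact: measurable_funB.
Qed.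

Lemma measurable_duhamel w : jointly_measurable w -> jointly_measurable (duhamel w).
Proof.
move=> mw; rewrite /jointly_measurable /duhamel.
under eq_fun => z.
  rewrite Rintegral_mkcond.
  over.
(* Extending the integrand by zero outside the time interval removes the dependence of
   the domain of integration on the parameter. *)
pose F (p : (measurableTypeR R * Rn R n) * measurableTypeR R) :=
  if (0 <= p.2) && (p.2 <= p.1.1) then heat_semigroup (p.1.1 - p.2) (w p.2) p.1.2 else 0 : R.
rewrite (_ : (fun z => _) = (fun z => \int[lam]_s F (z, s))); last first.
  apply/funext => z; apply: eq_Rintegral => s _.
  by rewrite patchE /F /= mem_setE in_itv.
apply: (measurable_Rintegral_snd lam (F := F)).
have m2 : measurable_fun [set: (measurableTypeR R * Rn R n) * measurableTypeR R]
  (fun p => p.2 : R) by exact: measurable_snd.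
have m11 : measurable_fun [set: (measurableTypeR R * Rn R n) * measurableTypeR R]
  (fun p => p.1.1 : R) by exact: (measurableT_comp measurable_fst).
apply: measurable_fun_ifT => //.
  apply: measurable_and.
    exact: measurable_fun_ler.
  exact: measurable_fun_ler.
apply: (measurable_heat_semigroup (w := fun p => w p.2)).
- exact: measurable_funB.
- exact: (measurableT_comp measurable_snd).
- apply: jointly_measurable_comp => //.
  exact: (measurableT_comp measurable_snd).
Qed.

End measurability.

(** * The heat semigroup on functions of moderate growth *)

Section Rintegral_facts.
Context (R : realType) d (T : measurableType d) (m : {measure set T -> \bar R}).
Implicit Types (D : set T) (f g : T -> R).

Lemma Rintegral_EFin D f : measurable D -> m.-integrable D (EFin \o f) ->
  (\int[m]_(x in D) f x)%:E = (\int[m]_(x in D) (f x)%:E)%E.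
Proof. by move=> mD fi; rewrite /Rintegral fineK//; exact: integrable_fin_num. Qed.

Lemma integrable_scale D f (c : R) : measurable D -> m.-integrable D (EFin \o f) ->
  m.-integrable D (EFin \o (fun x => c * f x)).
Proof. by move=> mD fi; exact: (integrableZl mD c fi). Qed.

Lemma integrable_add D f g : measurable D -> m.-integrable D (EFin \o f) ->
  m.-integrable D (EFin \o g) -> m.-integrable D (EFin \o (fun x => f x + g x)).
Proof. by move=> mD fi gi; exact: (integrableD mD fi gi). Qed.

End Rintegral_facts.

Section heat_operator.
Context (R : realType) (n : nat).
Local Notation mu := (lebesgue_Rn R n).
Implicit Types (f g : Rn R n -> R) (x y z : Rn R n) (s t M : R).

Lemma heat_kernel_le t x : 0 < t -> heat_kernel t x <= (4 * pi * t) `^ (- (n%:R / 2)).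
Proof.
move=> t0; rewrite ler_piMr ?powR_ge0//.
by rewrite -[leRHS]expR0 ler_expR oppr_le0 divr_ge0 ?sqr_ge0// mulr_ge0// ltW.
Qed.

(** Up to the ratio of the normalizing factors the kernel increases with time, since its
    exponent does. *)
Lemma heat_kernel_time_le s t x : 0 < s -> s <= t ->
  heat_kernel s x <= (t / s) `^ (n%:R / 2) * heat_kernel t x.
Proof.
move=> s0 st; have t0 : 0 < t by exact: lt_le_trans st.
rewrite /heat_kernel mulrA.
have -> : (t / s) `^ (n%:R / 2) * (4 * pi * t) `^ (- (n%:R / 2)) =
   (4 * pi * s) `^ (- (n%:R / 2)).
  have -> : 4 * pi * t = (t / s) * (4 * pi * s) by field; rewrite gt_eqF.
  rewrite [(t / s * (4 * pi * s)) `^ _]powRM; last 2 first.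
    by rewrite divr_ge0// ltW.
    by rewrite !mulr_ge0// ?pi_ge0// ltW.
  rewrite mulrA -powRD ?subrr ?powRr0 ?mul1r//.
  by apply/implyP => _; rewrite gt_eqF// divr_gt0.
rewrite ler_wpM2l ?powR_ge0// ler_expR lerN2.
by rewrite ler_wpM2l ?sqr_ge0// lef_pV2 ?posrE ?mulr_gt0// ler_wpM2l.
Qed.

Lemma measurable_heat_kernel_sub t x :
  measurable_fun setT (fun y : Rn R n => heat_kernel t (sub_Rn x y)).
Proof. by apply: measurable_heat_kernel => //; exact: measurable_sub_Rn. Qed.

Lemma integrable_heat_kernel t x : 0 < t ->
  mu.-integrable setT (fun y => (heat_kernel t (sub_Rn x y))%:E).
Proof.
move=> t0; apply/integrableP; split.
  by apply/measurable_EFinP; exact: measurable_heat_kernel_sub.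
under eq_integral do rewrite gee0_abs ?lee_fin ?heat_kernel_ge0//.
by rewrite integral_heat_kernel// ltry.
Qed.

(** The functions on which the flow is given by absolutely convergent integrals. They
    contain the bounded measurable and the integrable functions, and, unlike each of
    these two classes, also all sums of both; the semigroup law is proved on them. *)
Definition heatable f := measurable_fun setT f /\
  forall t x, 0 < t ->
    mu.-integrable setT (fun y => (heat_kernel t (sub_Rn x y) * f y)%:E).

Lemma le_heatable f g : heatable g -> measurable_fun setT f ->
  (forall x, `|f x| <= `|g x|) -> heatable f.
Proof.
move=> [mg ig] mf fg; split => // t x t0.
apply: le_integrable (ig t x t0) => //.
  apply/measurable_EFinP; apply: measurable_funM => //.
  exact: measurable_heat_kernel_sub.
by move=> y _; rewrite !abse_EFin lee_fin !normrM ler_wpM2l.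
Qed.

Lemma heatable_bounded f M : measurable_fun setT f -> (forall x, `|f x| <= M) -> heatable f.
Proof.
move=> mf fM; apply: (@le_heatable _ (cst M)) => //; last first.
  by move=> x; rewrite (le_trans (fM x))// ler_norm.
split => // t x t0.
under eq_fun do rewrite mulrC EFinM.
by apply: integrableZl => //; exact: integrable_heat_kernel.
Qed.

Lemma heatable_integrable f : mu.-integrable setT (EFin \o f) -> heatable f.
Proof.
move=> fi; have mf : measurable_fun setT f.
  by apply/measurable_EFinP; exact: (measurable_int _ fi).
split => // t x t0.
apply: (@le_integrable _ _ _ mu setT _ _
  (fun y => ((4 * pi * t) `^ (- (n%:R / 2)))%:E * (f y)%:E)%E) => //.
- apply/measurable_EFinP; apply: measurable_funM => //.
  exact: measurable_heat_kernel_sub.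
- move=> y _; rewrite -EFinM !abse_EFin lee_fin !normrM ler_wpM2r//.
  by rewrite !ger0_norm ?heat_kernel_ge0 ?powR_ge0// heat_kernel_le.
- exact: integrableZl.
Qed.

Lemma heatableD f g : heatable f -> heatable g -> heatable (fun x => f x + g x).
Proof.
move=> [mf fi] [mg gi]; split; first exact: measurable_funD.
move=> t x t0; under eq_fun do rewrite mulrDr EFinD.
by apply: integrableD => //; [exact: fi | exact: gi].
Qed.

Lemma heatableZ c f : heatable f -> heatable (fun x => c * f x).
Proof.
move=> [mf fi]; split; first exact: measurable_funM.
move=> t x t0; under eq_fun do rewrite mulrCA EFinM.
by apply: integrableZl => //; exact: fi.
Qed.

Lemma heatable_norm f : heatable f -> heatable (fun x => `|f x|).
Proof.
move=> hf; apply: (le_heatable hf); last by move=> x; rewrite normr_id.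
by apply: measurableT_comp => //; exact: hf.1.
Qed.

Lemma heat_semigroup0 f x : heat_semigroup 0 f x = f x.
Proof. by rewrite /heat_semigroup ltxx. Qed.

Lemma heat_semigroupE t f x : 0 < t ->
  heat_semigroup t f x = \int[mu]_y (heat_kernel t (sub_Rn x y) * f y).
Proof. by rewrite /heat_semigroup => ->. Qed.

Lemma heat_semigroup_EFin t f x : 0 < t -> heatable f ->
  (heat_semigroup t f x)%:E = (\int[mu]_y (heat_kernel t (sub_Rn x y) * f y)%:E)%E.
Proof. by move=> t0 [mf fi]; rewrite heat_semigroupE// Rintegral_EFin//; exact: fi. Qed.

Lemma heat_semigroupD t f g x : 0 <= t -> heatable f -> heatable g ->
  heat_semigroup t (fun y => f y + g y) x = heat_semigroup t f x + heat_semigroup t g x.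
Proof.
rewrite le_eqVlt => /predU1P[<-|t0]; first by rewrite !heat_semigroup0.
move=> [mf fi] [mg gi]; rewrite !heat_semigroupE// -RintegralD//.
- by apply: eq_Rintegral => y _; rewrite mulrDr.
- exact: fi.
- exact: gi.
Qed.

Lemma heat_semigroupZ t c f x : 0 <= t -> heatable f ->
  heat_semigroup t (fun y => c * f y) x = c * heat_semigroup t f x.
Proof.
rewrite le_eqVlt => /predU1P[<-|t0]; first by rewrite !heat_semigroup0.
move=> [mf fi]; rewrite !heat_semigroupE// -RintegralZl//; last exact: fi.
by apply: eq_Rintegral => y _; rewrite mulrCA.
Qed.

Lemma le_heat_semigroup t f g x : 0 <= t -> heatable f -> heatable g ->
  (forall y, f y <= g y) -> heat_semigroup t f x <= heat_semigroup t g x.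
Proof.
rewrite le_eqVlt => /predU1P[<-|t0]; first by rewrite !heat_semigroup0.
move=> [mf fi] [mg gi] fg; rewrite !heat_semigroupE//; apply: le_Rintegral => //.
- exact: fi.
- exact: gi.
- by move=> y _; rewrite ler_wpM2l ?heat_kernel_ge0.
Qed.

Lemma heat_semigroup_ge0 t f x : (forall y, 0 <= f y) -> 0 <= heat_semigroup t f x.
Proof.
move=> f0; rewrite /heat_semigroup; case: ifP => // _.
by apply: Rintegral_ge0 => y _; rewrite mulr_ge0 ?heat_kernel_ge0.
Qed.

Lemma heat_semigroup_cst t c x : 0 <= t -> heat_semigroup t (fun=> c) x = c.
Proof.
rewrite le_eqVlt => /predU1P[<-|t0]; first by rewrite !heat_semigroup0.
rewrite heat_semigroupE//; under eq_Rintegral do rewrite mulrC.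
rewrite RintegralZl//; last exact: integrable_heat_kernel.
by rewrite /Rintegral integral_heat_kernel// mulr1.
Qed.

Lemma norm_heat_semigroup_le t f x : 0 <= t -> heatable f ->
  `|heat_semigroup t f x| <= heat_semigroup t (fun y => `|f y|) x.
Proof.
rewrite le_eqVlt => /predU1P[<-|t0]; first by rewrite !heat_semigroup0.
move=> [mf fi]; rewrite !heat_semigroupE//.
apply: le_trans (le_normr_Rintegral measurableT (fi t x t0)) _.
rewrite le_eqVlt; apply/orP; left; apply/eqP; apply: eq_Rintegral => y _.
by rewrite normrM ger0_norm// heat_kernel_ge0.
Qed.

Lemma norm_heat_semigroup_bound t f x M : 0 <= t -> measurable_fun setT f ->
  (forall y, `|f y| <= M) -> `|heat_semigroup t f x| <= M.
Proof.
move=> t0 mf fM; have hf := heatable_bounded mf fM.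
apply: le_trans (norm_heat_semigroup_le x t0 hf) _.
rewrite -[leRHS](heat_semigroup_cst M x t0); apply: le_heat_semigroup => //.
  exact: heatable_norm.
by apply: (@heatable_bounded _ `|M|) => // y; rewrite lexx.
Qed.

Lemma heat_semigroup_integrable_le t f x : 0 < t -> mu.-integrable setT (EFin \o f) ->
  (forall y, 0 <= f y) ->
  heat_semigroup t f x <= (4 * pi * t) `^ (- (n%:R / 2)) * \int[mu]_y f y.
Proof.
move=> t0 fi f0; have [mf hf] := heatable_integrable fi.
rewrite heat_semigroupE// -RintegralZl//; apply: le_Rintegral => //.
- exact: hf.
- exact: integrable_scale.
- by move=> y _; rewrite ler_wpM2r// heat_kernel_le.
Qed.

Lemma heat_semigroup_time_le s t f x : 0 < s -> s <= t -> heatable f ->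
  (forall y, 0 <= f y) ->
  heat_semigroup s f x <= (t / s) `^ (n%:R / 2) * heat_semigroup t f x.
Proof.
move=> s0 st [mf hf] f0; have t0 : 0 < t by exact: lt_le_trans st.
rewrite !heat_semigroupE// -RintegralZl//; last exact: hf.
apply: le_Rintegral => //.
- exact: hf.
- by apply: integrable_scale => //; exact: hf.
- by move=> y _; rewrite mulrA ler_wpM2r// heat_kernel_time_le.
Qed.

Lemma heat_semigroup_ae t f g x : 0 < t -> measurable_fun setT f ->
  measurable_fun setT g -> {ae mu, forall y, f y = g y} ->
  heat_semigroup t f x = heat_semigroup t g x.
Proof.
move=> t0 mf mg fg; rewrite !heat_semigroupE// /Rintegral; congr fine.
apply: ae_eq_integral => //.
- by apply/measurable_EFinP; apply: measurable_funM => //; exact: measurable_heat_kernel_sub.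
- by apply/measurable_EFinP; apply: measurable_funM => //; exact: measurable_heat_kernel_sub.
- by apply: filterS fg => y fgy _; rewrite fgy.
Qed.

(** Tonelli and the Chapman-Kolmogorov identity. Extended real values are allowed because
    the identity is used to prove that the flow of a heatable function is heatable. *)
Lemma ge0_heat_chapman t s (f : Rn R n -> \bar R) x : 0 < t -> 0 < s ->
  measurable_fun [set: Rn R n] f -> (forall y, 0 <= f y)%E ->
  (\int[mu]_z ((heat_kernel t (sub_Rn x z))%:E *
     \int[mu]_y ((heat_kernel s (sub_Rn z y))%:E * f y)) =
   \int[mu]_y ((heat_kernel (t + s) (sub_Rn x y))%:E * f y))%E.
Proof.
move=> t0 s0 mf f0.
have k0 r z : (0 <= (heat_kernel r z : R)%:E)%E by rewrite lee_fin heat_kernel_ge0.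
transitivity (\int[mu]_z \int[mu]_y ((heat_kernel t (sub_Rn x z))%:E *
   ((heat_kernel s (sub_Rn z y))%:E * f y)))%E.
  apply: eq_integral => z _; rewrite ge0_integralZl//.
    apply: emeasurable_funM => //.
    by apply/measurable_EFinP; exact: measurable_heat_kernel_sub.
  by move=> y _; rewrite mule_ge0.
have := fubini_tonelli (m1 := mu) (m2 := mu) (fun p : Rn R n * Rn R n =>
   (heat_kernel t (sub_Rn x p.1))%:E * ((heat_kernel s (sub_Rn p.1 p.2))%:E * f p.2))%E.
move=> /= ->; last 2 first.
- apply: emeasurable_funM.
    apply/measurable_EFinP; apply: measurable_heat_kernel => //.
    exact: measurable_sub_Rn.
  apply: emeasurable_funM; last exact: (measurableT_comp mf).
  apply/measurable_EFinP; apply: measurable_heat_kernel => //.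
  exact: measurable_sub_Rn.
- by move=> p; rewrite !mule_ge0.
apply: eq_integral => y _.
under eq_integral do rewrite muleA.
rewrite ge0_integralZr//.
- under eq_integral do rewrite -EFinM.
  by rewrite heat_kernel_chapman.
- apply: emeasurable_funM; apply/measurable_EFinP; apply: measurable_heat_kernel => //.
    exact: measurable_sub_Rn.
  exact: measurable_sub_Rn.
- by move=> z _; rewrite mule_ge0.
Qed.

Lemma measurable_heat_semigroup_space t f : measurable_fun setT f ->
  measurable_fun setT (heat_semigroup t f).
Proof.
move=> mf; apply: (measurable_heat_semigroup (T := Rn R n) (tau := fun=> t) (X := id) (w := fun=> f)) => //.
exact: (measurableT_comp mf).
Qed.

Lemma heat_semigroup_heatable t f : 0 <= t -> heatable f -> (forall y, 0 <= f y) ->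
  heatable (heat_semigroup t f).
Proof.
rewrite le_eqVlt => /predU1P[<-|t0] hf f0.
  by rewrite (_ : heat_semigroup 0 f = f)//; apply/funext => x; rewrite heat_semigroup0.
split; first exact: measurable_heat_semigroup_space hf.1.
move=> s x s0; apply/integrableP; split.
  apply/measurable_EFinP; apply: measurable_funM => //.
    exact: measurable_heat_kernel_sub.
  exact: measurable_heat_semigroup_space hf.1.
under eq_integral => y _.
  rewrite gee0_abs; last first.
    by rewrite lee_fin mulr_ge0//; [exact: heat_kernel_ge0 | exact: heat_semigroup_ge0].
  rewrite EFinM heat_semigroup_EFin//.
  under eq_integral do rewrite EFinM.
  over.
rewrite ge0_heat_chapman//; last by apply/measurable_EFinP; exact: hf.1.
under eq_integral do rewrite -EFinM.
by rewrite -heat_semigroup_EFin ?addr_gt0// ltry.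
Qed.

Lemma heat_semigroup_add t s f x : 0 <= t -> 0 <= s -> heatable f -> (forall y, 0 <= f y) ->
  heat_semigroup t (heat_semigroup s f) x = heat_semigroup (t + s) f x.
Proof.
rewrite le_eqVlt => /predU1P[<-|t0]; first by rewrite heat_semigroup0 add0r.
rewrite le_eqVlt => /predU1P[<-|s0].
  by rewrite addr0 (_ : heat_semigroup 0 f = f)//; apply/funext => y; rewrite heat_semigroup0.
move=> hf f0; apply: EFin_inj; rewrite !heat_semigroup_EFin ?addr_gt0//; last first.
  by apply: heat_semigroup_heatable => //; exact: ltW.
under eq_integral => y _.
  rewrite EFinM heat_semigroup_EFin//.
  under eq_integral do rewrite EFinM.
  over.
by rewrite ge0_heat_chapman//; apply/measurable_EFinP; exact: hf.1.
Qed.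

Lemma heat_semigroup_heatable_signed t f : 0 <= t -> heatable f -> heatable (heat_semigroup t f).
Proof.
move=> t0 hf; apply: (@le_heatable _ (heat_semigroup t (fun y => `|f y|))).
- by apply: heat_semigroup_heatable => //; exact: heatable_norm.
- exact: measurable_heat_semigroup_space hf.1.
- move=> x; apply: le_trans (norm_heat_semigroup_le x t0 hf) _; exact: ler_norm.
Qed.

(** The nonnegative case applies to both terms of the decomposition of [f] as [`|f|]
    minus [`|f| - f]. *)
Lemma heat_semigroup_add_signed t s f x : 0 <= t -> 0 <= s -> heatable f ->
  heat_semigroup t (heat_semigroup s f) x = heat_semigroup (t + s) f x.
Proof.
move=> t0 s0 hf; pose g y := `|f y| + -1 * f y.
have habs := heatable_norm hf.
have hg : heatable g by apply: heatableD => //; exact: heatableZ.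
have g0 y : 0 <= g y by rewrite /g mulN1r subr_ge0 ler_norm.
have fE : f = (fun y => `|f y| + -1 * g y).
  by apply/funext => y; rewrite /g; ring.
have ts0 : 0 <= t + s by rewrite addr_ge0.
have decomp r y : 0 <= r ->
    heat_semigroup r f y = heat_semigroup r (fun y => `|f y|) y + -1 * heat_semigroup r g y.
  move=> r0; rewrite {1}fE heat_semigroupD//; last exact: heatableZ.
  by rewrite heat_semigroupZ.
rewrite [RHS]decomp// (_ : heat_semigroup s f = (fun y =>
  heat_semigroup s (fun y => `|f y|) y + -1 * heat_semigroup s g y)); last first.
  by apply/funext => y; exact: decomp.
rewrite heat_semigroupD//; last first.
- by apply: heatableZ; exact: heat_semigroup_heatable.
- exact: heat_semigroup_heatable.
rewrite heat_semigroupZ//; last exact: heat_semigroup_heatable.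
by rewrite !heat_semigroup_add.
Qed.

(** The Chapman-Kolmogorov identity with the second kernel centred at the origin. *)
Lemma heat_semigroup_kernel t s x : 0 < t -> 0 < s ->
  heat_semigroup t (heat_kernel s) x = heat_kernel (t + s) x.
Proof.
move=> t0 s0.
pose o : Rn R n := [tuple (0 : measurableTypeR R) | i < n].
have subo y : sub_Rn y o = y by apply: eq_from_tnth => i; rewrite tnth_sub_Rn tnth_mktuple subr0.
apply: EFin_inj; rewrite heat_semigroup_EFin//; last first.
  apply: (@heatable_bounded _ ((4 * pi * s) `^ (- (n%:R / 2)))).
    exact: measurable_heat_kernel.
  by move=> y; rewrite ger0_norm ?heat_kernel_ge0 ?heat_kernel_le.
have := heat_kernel_chapman x o t0 s0; rewrite subo => <-.
by apply: eq_integral => y _; rewrite subo.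
Qed.

Lemma heatable_heat_kernel s : 0 < s -> heatable (heat_kernel s).
Proof.
move=> s0; apply: (@heatable_bounded _ ((4 * pi * s) `^ (- (n%:R / 2)))).
  exact: measurable_heat_kernel.
by move=> y; rewrite ger0_norm ?heat_kernel_ge0 ?heat_kernel_le.
Qed.

End heat_operator.

(** * Time integrals and the Duhamel operator *)

Section time_integral.
Context (R : realType).
Local Notation lam := (@lebesgue_measure R).
Implicit Types (f g : R -> R) (a b c t s : R).

Lemma integrable_itv_bounded f (M a b : R) : measurable_fun [set: measurableTypeR R] f ->
  (forall s, a <= s <= b -> `|f s| <= M) ->
  lam.-integrable `[a, b] (EFin \o f).
Proof.
move=> mf fM.
apply: (@le_integrable _ _ _ lam `[a, b] _ _ (EFin \o cst M)) => //.
- apply/measurable_EFinP; exact: measurable_funTS.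
- move=> s /=; rewrite in_itv/= => sab; rewrite lee_fin.
  by rewrite (le_trans (fM s sab))// ler_norm.
- apply/integrableP; split; first exact/measurable_EFinP.
  rewrite /= integral_cst//= lebesgue_measure_itv/=.
  by case: ifP => _; rewrite ?mule0 ?ltry// -EFinD -EFinM ltry.
Qed.

Lemma Rintegral_itv_cst a b c : a <= b -> \int[lam]_(_ in `[a, b]) c = c * (b - a).
Proof.
rewrite le_eqVlt => /predU1P[->|ab].
  by rewrite set_itv1 Rintegral_set1 subrr mulr0.
by rewrite Rintegral_cst//= lebesgue_measure_itv/= lte_fin ab.
Qed.

Lemma Rintegral_itv_split f a b c : a <= b -> b <= c ->
  lam.-integrable `[a, c] (EFin \o f) ->
  \int[lam]_(s in `[a, c]) f s =
    \int[lam]_(s in `[a, b]) f s + \int[lam]_(s in `[b, c]) f s.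
Proof.
move=> ab bc fi.
have ibc : lam.-integrable `[b, c] (EFin \o f).
  by apply: integrableS fi => //; apply: subset_itvr; rewrite bnd_simp.
have := @Rintegral_itvB R f (BLeft a) (BRight c) b fi.
rewrite !bnd_simp => /(_ ab bc) /eqP; rewrite subr_eq addrC => /eqP ->.
congr (_ + _); apply: Rintegral_itv_obnd_cbnd.
by apply: integrableS ibc => //; apply: subset_itvr; rewrite bnd_simp.
Qed.

Lemma Rintegral_derivative (F f : R -> R) a b : a <= b ->
  (forall x, a <= x <= b -> is_derive x 1 F (f x)) ->
  (forall x, a <= x <= b -> {for x, continuous f}) ->
  \int[lam]_(s in `[a, b]) f s = F b - F a.
Proof.
rewrite le_eqVlt => /predU1P[<- _ _|ab dF cf].
  by rewrite set_itv1 Rintegral_set1 subrr.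
have cF x : a <= x <= b -> {for x, continuous F}.
  move=> xab; apply: differentiable_continuous; apply/derivable1_diffP.
  by case: (dF x xab).
rewrite /Rintegral (@continuous_FTC2 _ f F)//.
- apply: continuous_in_subspaceT => x; rewrite inE/= in_itv/=; exact: cf.
- split.
  + move=> x; rewrite in_itv/= => /andP[ax xb].
    by case: (dF x); rewrite // !ltW.
  + by apply: cvg_at_right_filter; apply: cF; rewrite lexx ltW.
  + by apply: cvg_at_left_filter; apply: cF; rewrite lexx ltW.
- move=> x; rewrite in_itv/= => /andP[ax xb].
  by rewrite derive1E; case: (dF x); rewrite // !ltW.
Qed.

End time_integral.

Section duhamel_operator.
Context (R : realType) (n : nat).
Local Notation mu := (lebesgue_Rn R n).
Local Notation lam := (@lebesgue_measure R).
Implicit Types (w : R -> Rn R n -> R) (x y z : Rn R n) (s t r M : R).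

Definition bounded_spacetime w M :=
  jointly_measurable w /\ forall s y, `|w s y| <= M.

Lemma integrable_duhamel w M t a b x : bounded_spacetime w M -> b <= t ->
  lam.-integrable `[a, b] (EFin \o (fun s => heat_semigroup (t - s) (w s) x)).
Proof.
move=> [mw wM] bt; apply: (@integrable_itv_bounded _ _ M).
  exact: measurable_semigroup_time.
move=> s /andP[s0 st]; apply: norm_heat_semigroup_bound => //.
  by rewrite subr_ge0 (le_trans st).
exact: jointly_measurable_section.
Qed.

Lemma bounded_spacetime_heatable w M s : bounded_spacetime w M -> heatable (w s).
Proof.
move=> [mw wM]; apply: (@heatable_bounded _ _ _ M) => //.
exact: jointly_measurable_section.
Qed.

Lemma bounded_spacetimeD w1 w2 M1 M2 : bounded_spacetime w1 M1 -> bounded_spacetime w2 M2 ->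
  bounded_spacetime (fun s y => w1 s y + w2 s y) (M1 + M2).
Proof.
move=> [m1 b1] [m2 b2]; split; first exact: measurable_funD.
by move=> s y; rewrite (le_trans (ler_normD _ _))// lerD.
Qed.

Lemma duhamel_ge0 w t x : (forall s y, 0 <= w s y) -> 0 <= duhamel w t x.
Proof. by move=> w0; apply: Rintegral_ge0 => s _; exact: heat_semigroup_ge0. Qed.

Lemma le_duhamel w1 w2 M1 M2 t x : bounded_spacetime w1 M1 -> bounded_spacetime w2 M2 ->
  (forall s y, w1 s y <= w2 s y) -> duhamel w1 t x <= duhamel w2 t x.
Proof.
move=> b1 b2 w12; apply: le_Rintegral => //.
- exact: integrable_duhamel b1 _.
- exact: integrable_duhamel b2 _.
- move=> s /=; rewrite in_itv/= => /andP[_ st]; apply: le_heat_semigroup => //.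
  + by rewrite subr_ge0.
  + exact: bounded_spacetime_heatable b1.
  + exact: bounded_spacetime_heatable b2.
Qed.

Lemma duhamelD w1 w2 M1 M2 t x : bounded_spacetime w1 M1 -> bounded_spacetime w2 M2 ->
  duhamel (fun s y => w1 s y + w2 s y) t x = duhamel w1 t x + duhamel w2 t x.
Proof.
move=> b1 b2; rewrite /duhamel -RintegralD//.
- apply: eq_Rintegral => s; rewrite inE/= in_itv/= => /andP[_ st].
  rewrite heat_semigroupD//.
  + by rewrite subr_ge0.
  + exact: bounded_spacetime_heatable b1.
  + exact: bounded_spacetime_heatable b2.
- exact: integrable_duhamel b1 _.
- exact: integrable_duhamel b2 _.
Qed.

Lemma duhamel_time (m : R -> R) t x :
  duhamel (fun s _ => m s) t x = \int[lam]_(s in `[0, t]) m s.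
Proof.
apply: eq_Rintegral => s; rewrite inE/= in_itv/= => /andP[_ st].
by rewrite heat_semigroup_cst// subr_ge0.
Qed.

(** If the source at time [s] is below [g s] times a profile which the flow carries, from
    [s] to [t], below [C] times the profile at time [t], then the contributions of all
    times [s] add up to a multiple of that same profile. *)
Lemma duhamel_barrier w (g : R -> R) (Theta : R -> Rn R n -> R) M C t x :
  bounded_spacetime w M ->
  (forall s, 0 <= s <= t -> 0 <= g s) ->
  lam.-integrable `[0, t] (EFin \o g) ->
  (forall s, 0 <= s <= t -> heatable (Theta s)) ->
  (forall s y, 0 <= s <= t -> w s y <= g s * Theta s y) ->
  (forall s, 0 <= s <= t -> heat_semigroup (t - s) (Theta s) x <= C * Theta t x) ->
  duhamel w t x <= C * Theta t x * \int[lam]_(s in `[0, t]) g s.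
Proof.
move=> bw g0 gi hT wg HT.
rewrite -RintegralZl//; apply: le_Rintegral => //.
- exact: integrable_duhamel bw _.
- exact: integrable_scale.
- move=> s /=; rewrite in_itv/= => sT; have /andP[s0 st] := sT.
  have ts : 0 <= t - s by rewrite subr_ge0.
  apply: (@le_trans _ _ (heat_semigroup (t - s) (fun y => g s * Theta s y) x)).
    apply: le_heat_semigroup => //.
    + exact: bounded_spacetime_heatable bw.
    + by apply: heatableZ; exact: hT.
    + by move=> y; exact: wg.
  rewrite heat_semigroupZ//; last exact: hT.
  by rewrite mulrC ler_wpM2r ?g0// HT.
Qed.

Lemma heatable_duhamel w M r : 0 <= r -> bounded_spacetime w M ->
  (forall s y, 0 <= w s y) -> heatable (duhamel w r).
Proof.
move=> r0 bw w0; have [mw wM] := bw.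
apply: (@heatable_bounded _ _ _ (M * r)).
  by apply: jointly_measurable_section; exact: measurable_duhamel.
move=> y; rewrite ger0_norm ?duhamel_ge0//.
apply: (@le_trans _ _ (\int[lam]_(s in `[0, r]) M)).
  apply: le_Rintegral => //.
  - exact: integrable_duhamel bw _.
  - exact: (@integrable_itv_bounded _ _ `|M|).
  - move=> s /=; rewrite in_itv/= => /andP[_ sr].
    rewrite (le_trans (ler_norm _))//; apply: norm_heat_semigroup_bound => //.
      by rewrite subr_ge0.
    exact: jointly_measurable_section.
by rewrite Rintegral_itv_cst// subr0.
Qed.

(** Tonelli exchanges the outer flow with the time integral, and the semigroup law merges
    it with the flow inside. *)
Lemma heat_semigroup_duhamel w M t r x : 0 < t -> 0 <= r -> bounded_spacetime w M ->
  (forall s y, 0 <= w s y) ->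
  heat_semigroup t (duhamel w r) x =
  \int[lam]_(s in `[0, r]) heat_semigroup (t + r - s) (w s) x.
Proof.
move=> t0 r0 bw w0; have [mw wM] := bw.
have md := heatable_duhamel r0 bw w0.
apply: EFin_inj; rewrite heat_semigroup_EFin// Rintegral_EFin//; last first.
  by apply: integrable_duhamel bw _; rewrite lerDr ltW.
under [LHS]eq_integral => z _.
  rewrite EFinM Rintegral_EFin//; last exact: integrable_duhamel bw _.
  rewrite integral_mkcond -ge0_integralZl//; first last.
  - by rewrite lee_fin heat_kernel_ge0.
  - move=> s _; rewrite patchE; case: ifPn => // _.
    by rewrite lee_fin heat_semigroup_ge0.
  - apply/(measurable_restrictT _ _).1 => //; apply/measurable_EFinP.
    by apply: measurable_funTS; exact: measurable_semigroup_time.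
  over.
pose F (p : Rn R n * measurableTypeR R) : \bar R :=
  ((heat_kernel t (sub_Rn x p.1) * (if (0 <= p.2) && (p.2 <= r) then heat_semigroup (r - p.2) (w p.2) p.1 else 0))%:E)%E.
transitivity (\int[mu]_z \int[lam]_s F (z, s))%E.
  apply: eq_integral => z _; apply: eq_integral => s _.
  by rewrite /F /= patchE mem_setE in_itv/=; case: ifP => _; rewrite EFinM.
rewrite fubini_tonelli; last 2 first.
- apply/measurable_EFinP; apply: measurable_funM.
    by apply: measurable_heat_kernel => //; exact: measurable_sub_Rn.
  have m2 : measurable_fun [set: Rn R n * measurableTypeR R] (fun p => p.2 : R).
    exact: measurable_snd.
  apply: measurable_fun_ifT => //.
    by apply: measurable_and; exact: measurable_fun_ler.
  apply: (measurable_heat_semigroup (T := (Rn R n * measurableTypeR R)%type)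
    (w := fun p => w p.2)) => //.
  + exact: measurable_funB.
  + apply: jointly_measurable_comp => //.
    exact: (measurableT_comp measurable_snd).
- move=> p; rewrite lee_fin mulr_ge0//; first exact: heat_kernel_ge0.
  by case: ifP => // _; exact: heat_semigroup_ge0.
rewrite [RHS]integral_mkcond; apply: eq_integral => s _.
rewrite patchE mem_setE in_itv/= /F/=; case: ifPn => [/andP[s0 sr]|_]; last first.
  by under eq_integral do rewrite mulr0; rewrite integral0.
have hw : heatable (w s) := bounded_spacetime_heatable s bw.
have rs : 0 <= r - s by rewrite subr_ge0.
rewrite -heat_semigroup_EFin//; last exact: heat_semigroup_heatable.
congr EFin; rewrite -addrA; exact: heat_semigroup_add (ltW t0) rs hw (w0 s).
Qed.

End duhamel_operator.

(** * Existence of solutions below a supersolution *)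

Section scalar.
Context (R : realType).
Implicit Types (a b c p B x : R).

(** Convexity of the power, in the form of its tangent at [b]. It is the Young inequality
    with exponents [p] and [p / (p - 1)] applied to [a] and [b `^ (p - 1)]. *)
Lemma powR_tangent p a b : 1 < p -> 0 <= a -> 0 <= b ->
  b `^ p + p * b `^ (p - 1) * (a - b) <= a `^ p.
Proof.
move=> p1 a0 b0; have p0 : 0 < p by rewrite (lt_trans _ p1).
have q0 : 0 < p / (p - 1) by rewrite divr_gt0// subr_gt0.
have pq : p^-1 + (p / (p - 1))^-1 = 1.
  by field; rewrite !gt_eqF ?subr_gt0.
have := conjugate_powR a0 (powR_ge0 b (p - 1)) p0 q0 pq.
rewrite -powRrM mulrCA divff ?mulr1; last by rewrite gt_eqF// subr_gt0.
rewrite invf_div => yg.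
have := ler_wpM2l (ltW p0) yg.
have -> : p * (a `^ p / p + b `^ p * ((p - 1) / p)) = a `^ p + (p - 1) * b `^ p.
  by field; rewrite gt_eqF.
have := mulr_powRB1 b0 p0; move: (b `^ (p - 1)) (b `^ p) (a `^ p) => u w z <- h.
nra.
Qed.

(** The tangent at the larger of the two arguments has slope at most
    [p * B `^ (p - 1)]. *)
Lemma powR_lipschitz p a b B : 1 < p -> `|a| <= B -> `|b| <= B ->
  `|a| `^ p <= `|b| `^ p + p * B `^ (p - 1) * `|a - b|.
Proof.
move=> p1 aB bB; have p0 : 0 < p by rewrite (lt_trans _ p1).
have := powR_tangent p1 (normr_ge0 b) (normr_ge0 a).
have [ab|ab] := leP `|a| `|b|.
  move=> _; apply: (@le_trans _ _ (`|b| `^ p)).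
    by rewrite ge0_ler_powR ?nnegrE// ltW.
  by rewrite lerDl !mulr_ge0 ?powR_ge0// ltW.
rewrite -lerBrDr => h; apply: (le_trans h).
rewrite lerD2l -mulrN opprB.
apply: (@le_trans _ _ (p * B `^ (p - 1) * (`|a| - `|b|))).
  apply: ler_wpM2r; first by rewrite subr_ge0 ltW.
  apply: ler_wpM2l; first exact: ltW.
  by rewrite ge0_ler_powR ?nnegrE// ?subr_ge0 ?(ltW p1)// (le_trans _ aB).
apply: ler_wpM2l; first by rewrite mulr_ge0 ?powR_ge0// ltW.
exact: lerB_dist.
Qed.

Lemma le0_geometric x c : (forall k, x <= c * 2^-1 ^+ k) -> x <= 0.
Proof.
move=> h; have : (fun k => c * 2^-1 ^+ k) @ \oo --> (c * 0).
  apply: cvgM; first exact: cvg_cst.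
  by apply: cvg_expr; rewrite ger0_norm// invf_lt1// ltr1n.
rewrite mulr0 => /cvgr_to_ge; apply.
by near=> k; exact: h.
Unshelve. all: by end_near. Qed.

End scalar.

Lemma Rintegral_exp_le (R : realType) (c t : R) : 0 < c -> 0 <= t ->
  \int[@lebesgue_measure R]_(s in `[0, t]) expR (c * s) <= c^-1 * expR (c * t).
Proof.
move=> c0 t0.
have d x : 0 <= x <= t -> is_derive x 1 (fun s => c^-1 * expR (c * s)) (expR (c * x)).
  move=> _; have h : is_derive x 1 (fun s : R => expR (c * s)) (expR (c * x) * c).
    have := @is_derive1_comp R expR (fun s : R => c * s) x (expR (c * x)) c.
    apply => //.
    have := @is_deriveZ R R^o R^o id c x 1 1 _.
    by rewrite /GRing.scale/= mulr1; apply.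
  have := @is_deriveZ R R^o R^o (fun s : R => expR (c * s)) c^-1 x 1 _ h.
  by rewrite /GRing.scale/= mulrCA mulVf ?mulr1// gt_eqF.
have e x : 0 <= x <= t -> {for x, continuous (fun s : R => expR (c * s))}.
  move=> _; apply: continuous_comp; last exact: continuous_expR.
  exact: mulrl_continuous.
by rewrite (Rintegral_derivative t0 d e) gerBl mulr_ge0 ?expR_ge0// invr_ge0 ltW.
Qed.

Section picard.
Context (R : realType) (n : nat).
Local Notation mu := (lebesgue_Rn R n).
Local Notation lam := (@lebesgue_measure R).
Implicit Types (w u : R -> Rn R n -> R) (x y z : Rn R n) (s t r M : R).
Variables (p eps T B : R) (v0 : Rn R n -> R) (U : R -> Rn R n -> R).
Hypothesis p1 : 1 < p.
Hypothesis eps0 : 0 < eps.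
Hypothesis B0 : 0 < B.
Hypothesis mv0 : measurable_fun setT v0.
Hypothesis U_ge0 : forall t x, 0 <= t <= T -> 0 <= U t x <= B.
(** This says that [U] is a supersolution: any source below [U `^ p] produces, together
    with the linear flow, a function below [U]. The Picard iterates therefore stay below
    [U], hence below [B], where the nonlinearity has a Lipschitz constant [L]. *)
Hypothesis U_barrier : forall w, jointly_measurable w ->
  (forall s y, 0 <= w s y <= if 0 <= s <= T then U s y `^ p else 0) ->
  forall t x, 0 <= t <= T ->
  eps * `|heat_semigroup t v0 x| + duhamel w t x <= U t x.

Let source u s y := `|u s y| `^ p.

(** The iterates vanish outside [[0, T]], so that they are functions on all of space-time
    and joint measurability can be stated without restricting the domain. *)
Let picard u t x : R := if 0 <= t <= T
  then eps * heat_semigroup t v0 x + duhamel (source u) t x else 0.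

Let below_barrier u := jointly_measurable u /\
  forall s y, `|u s y| <= if 0 <= s <= T then U s y else 0.

Let p0 : 0 < p. Proof. exact: lt_trans p1. Qed.

Let below_bounded u s y : below_barrier u -> `|u s y| <= B.
Proof.
move=> [_ /(_ s y)]; case: ifPn => [sT|_] h; last by rewrite (le_trans h)// ltW.
by have /andP[_] := U_ge0 y sT; exact: le_trans.
Qed.

Let measurable_source u : jointly_measurable u -> jointly_measurable (source u).
Proof.
move=> mu'; apply: (@measurableT_comp _ _ _ _ _ _ (@powR R ^~ p)) => //.
exact: measurableT_comp.
Qed.

Let source_bounded u : below_barrier u -> bounded_spacetime (source u) (B `^ p).
Proof.
move=> bu; split; first exact: measurable_source bu.1.
move=> s y; rewrite ger0_norm ?powR_ge0// ge0_ler_powR ?nnegrE//.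
- exact: ltW.
- exact: ltW.
- exact: below_bounded.
Qed.

Let source_ge0 u s y : 0 <= source u s y. Proof. exact: powR_ge0. Qed.

Let measurable_time_window : measurable_fun setT
  (fun z : measurableTypeR R * Rn R n => (0 <= (z.1 : R)) && ((z.1 : R) <= T)).
Proof. by apply: measurable_and; exact: measurable_fun_ler. Qed.

Let picard_below u : below_barrier u -> below_barrier (picard u).
Proof.
move=> bu; split.
  apply: measurable_fun_ifT => //; apply: measurable_funD; last first.
    by apply: measurable_duhamel; exact: measurable_source bu.1.
  apply: measurable_funM => //.
  apply: (measurable_heat_semigroup (w := fun=> v0)) => //.
  exact: measurableT_comp.
move=> t x; rewrite /picard; case: ifPn => [tT|_]; last by rewrite normr0.
apply: le_trans (ler_normD _ _) _.
rewrite normrM (gtr0_norm eps0) [X in _ + X]ger0_norm; last first.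
  by apply: duhamel_ge0 => s y; exact: source_ge0.
apply: U_barrier => //; first exact: measurable_source bu.1.
move=> s y; rewrite source_ge0/=.
have := bu.2 s y; case: ifPn => [sT|_].
  move=> h; rewrite ge0_ler_powR ?nnegrE//; first exact: ltW.
  by have /andP[] := U_ge0 y sT.
by rewrite normr_le0 => /eqP h; rewrite /source h normr0 powR0// gt_eqF.
Qed.

Let L := p * B `^ (p - 1).
Let lamb := 2 * L.

Let L0 : 0 < L. Proof. by rewrite mulr_gt0// powR_gt0. Qed.
Let lamb0 : 0 < lamb. Proof. by rewrite mulr_gt0. Qed.

(** With the weight [expR (- lamb * s)] in time, where [lamb = 2 * L], the Picard map
    contracts distances by one half: the time integral of [L * expR (lamb * s)] is at
    most [L / lamb * expR (lamb * t)]. *)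
Let source_gap u1 u2 (d : R) t x : below_barrier u1 -> below_barrier u2 -> 0 <= d ->
  (forall s y, 0 <= s <= T -> `|u1 s y - u2 s y| <= d * expR (lamb * s)) ->
  0 <= t <= T ->
  duhamel (source u1) t x - duhamel (source u2) t x <= d / 2 * expR (lamb * t).
Proof.
move=> b1 b2 d0 gap tT; have /andP[t0 tleT] := tT.
pose m s := if 0 <= s <= T then L * d * expR (lamb * s) else 0.
have mm : measurable_fun [set: measurableTypeR R] m.
  apply: measurable_fun_ifT => //.
    by apply: measurable_and; exact: measurable_fun_ler.
  apply: measurable_funM => //; apply: measurableT_comp => //.
have m0 s : 0 <= m s by rewrite /m; case: ifP => // _; exact: (mulr_ge0 (mulr_ge0 (ltW L0) d0) (expR_ge0 _)).
have mB s : `|m s| <= L * d * expR (lamb * T).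
  rewrite ger0_norm// /m; case: ifPn => [/andP[_ sT]|_].
    apply: ler_wpM2l; first exact: mulr_ge0 (ltW L0) d0.
    by rewrite ler_expR; apply: ler_wpM2l => //; exact: ltW.
  exact: (mulr_ge0 (mulr_ge0 (ltW L0) d0) (expR_ge0 _)).
have bm : bounded_spacetime (fun s (_ : Rn R n) => m s) (L * d * expR (lamb * T)).
  by split => //; exact: (measurableT_comp mm).
have bs1 := source_bounded b1; have bs2 := source_bounded b2.
rewrite lerBlDl; apply: (@le_trans _ _ (duhamel (fun s y => source u2 s y + m s) t x)).
  apply: le_duhamel bs1 (bounded_spacetimeD bs2 bm) _ => s y.
  apply: le_trans (powR_lipschitz p1 (below_bounded s y b1) (below_bounded s y b2)) _.
  rewrite lerD2l /m; case: ifPn => [sT|sT].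
    by rewrite -/L -[leRHS]mulrA; apply: ler_wpM2l; [exact: ltW | exact: gap].
  have := b1.2 s y; have := b2.2 s y; rewrite (negbTE sT) !normr_le0.
  by move=> /eqP -> /eqP ->; rewrite subrr normr0 mulr0.
rewrite (duhamelD _ _ bs2 bm) lerD2l duhamel_time.
apply: (@le_trans _ _ (\int[lam]_(s in `[0, t]) (L * d * expR (lamb * s)))).
  rewrite le_eqVlt; apply/orP; left; apply/eqP; apply: eq_Rintegral => s.
  by rewrite inE/= in_itv/= /m => /andP[-> st]/=; rewrite (le_trans st).
rewrite RintegralZl//; last first.
  apply: (@integrable_itv_bounded _ _ (expR (lamb * t))).
    by apply: measurableT_comp.
  move=> s /andP[_ st]; rewrite ger0_norm ?expR_ge0// ler_expR.
  by apply: ler_wpM2l => //; exact: ltW.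
apply: (@le_trans _ _ (L * d * (lamb^-1 * expR (lamb * t)))).
  apply: ler_wpM2l; first exact: mulr_ge0 (ltW L0) d0.
  exact: Rintegral_exp_le.
rewrite mulrA /lamb (_ : L * d / (2 * L) = d / 2)//.
by field; rewrite gt_eqF.
Qed.

Let picard_gap u1 u2 (d : R) t x : below_barrier u1 -> below_barrier u2 -> 0 <= d ->
  (forall s y, 0 <= s <= T -> `|u1 s y - u2 s y| <= d * expR (lamb * s)) ->
  0 <= t <= T ->
  `|picard u1 t x - picard u2 t x| <= d / 2 * expR (lamb * t).
Proof.
move=> b1 b2 d0 gap tT; rewrite /picard tT opprD addrACA subrr add0r ler_norml.
apply/andP; split; last exact: source_gap.
rewrite lerNl opprB; apply: source_gap => // s y sT.
by rewrite distrC gap.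
Qed.

Let iter_picard k := iter k picard (fun _ _ => 0).

Let iter_below k : below_barrier (iter_picard k).
Proof.
elim: k => [|k IH]; last exact: picard_below.
split; first exact: measurable_cst.
move=> s y /=; rewrite normr0; case: ifPn => // sT.
by have /andP[] := U_ge0 y sT.
Qed.

Let iter_gap k t x : 0 <= t <= T ->
  `|iter_picard k.+1 t x - iter_picard k t x| <= B * 2^-1 ^+ k * expR (lamb * t).
Proof.
elim: k t x => [|k IH] t x tT.
  rewrite [X in _ - X]/= subr0 expr0 mulr1.
  apply: le_trans (below_bounded t x (iter_below 1)) _.
  rewrite ler_peMr ?(ltW B0)// -expR0 ler_expR mulr_ge0// ?(ltW lamb0)//.
  by case/andP: tT.
have d0 : 0 <= B * 2^-1 ^+ k by rewrite mulr_ge0 ?(ltW B0)// exprn_ge0.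
rewrite exprSr mulrA.
exact: (picard_gap x (iter_below k.+1) (iter_below k) d0 (fun s y => IH s y) tT).
Qed.

Let C := 2 * (B * expR (lamb * T)).
Let C0 : 0 <= C. Proof. by rewrite !mulr_ge0 ?expR_ge0// ltW. Qed.

Let iter_step k t x :
  `|iter_picard k.+1 t x - iter_picard k t x| <= C * 2^-1 ^+ k.+1.
Proof.
have [tT|tT] := boolP (0 <= t <= T).
  apply: le_trans (iter_gap k x tT) _.
  rewrite /C exprS (_ : 2 * _ * (2^-1 * _) = B * 2^-1 ^+ k * expR (lamb * T)).
    rewrite ler_wpM2l ?mulr_ge0 ?exprn_ge0 ?(ltW B0)// ler_expR ler_wpM2l ?(ltW lamb0)//.
    by case/andP: tT.
  by field.
have z j : iter_picard j t x = 0.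
  have := (iter_below j).2 t x; rewrite (negbTE tT) normr_le0 => /eqP //.
by rewrite !z subrr normr0 mulr_ge0 ?exprn_ge0.
Qed.

Let iter_cauchy j k t x : (k <= j)%N ->
  `|iter_picard j t x - iter_picard k t x| <= C * 2^-1 ^+ k.
Proof.
move=> kj.
suff : `|iter_picard j t x - iter_picard k t x| <= C * (2^-1 ^+ k - 2^-1 ^+ j).
  by move=> h; apply: (le_trans h); rewrite ler_wpM2l// gerBl exprn_ge0.
elim: j kj => [|j IH]; first by rewrite leqn0 => /eqP ->; rewrite !subrr normr0 mulr0.
rewrite leq_eqVlt => /predU1P[->|]; first by rewrite !subrr normr0 mulr0.
rewrite ltnS => /IH h.
rewrite (_ : iter_picard j.+1 t x - _ = (iter_picard j.+1 t x - iter_picard j t x) +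
  (iter_picard j t x - iter_picard k t x)); last by ring.
apply: le_trans (ler_normD _ _) _.
apply: le_trans (lerD (iter_step j t x) h) _.
by rewrite -mulrDr ler_wpM2l// exprS; lra.
Qed.

(** Each of these functions is below each iterate increased by its error bound, so their
    supremum is within the error bound of every iterate and is the limit. *)
Let lower k t x := iter_picard k t x - C * 2^-1 ^+ k.

Let sol t x := sup (range (fun k => lower k t x)).

Let sol_close k t x : `|sol t x - iter_picard k t x| <= C * 2^-1 ^+ k.
Proof.
have ub m j : lower j t x <= iter_picard m t x + C * 2^-1 ^+ m.
  rewrite /lower lerBlDr; have [jm|/ltnW mj] := leqP j m.
    have := iter_cauchy t x jm; rewrite ler_norml => /andP[+ _].
    have : 0 <= C * 2^-1 ^+ m by rewrite mulr_ge0 ?exprn_ge0.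
    lra.
  have := iter_cauchy t x mj; rewrite ler_norml => /andP[_].
  have : 0 <= C * 2^-1 ^+ j by rewrite mulr_ge0 ?exprn_ge0.
  lra.
have ne : range (fun k => lower k t x) !=set0 by exists (lower 0 t x); exists 0%N.
rewrite ler_norml; apply/andP; split.
  rewrite lerBrDl; apply: ub_le_sup; last by exists k.
  by exists (iter_picard 0 t x + C * 2^-1 ^+ 0) => _ [j _ <-]; exact: ub.
by rewrite lerBlDl; apply: ge_sup => // _ [j _ <-]; exact: ub.
Qed.

Let sol_below : below_barrier sol.
Proof.
split.
  apply: (measurable_fun_cvg (h := fun k (z : measurableTypeR R * Rn R n) => iter_picard k z.1 z.2)).
    by move=> k; exact: (iter_below k).1.
  move=> [t x] _ /=; apply/cvgrPdist_le => e e0.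
  have : (fun k => C * 2^-1 ^+ k) @ \oo --> (C * 0).
    apply: cvgM; first exact: cvg_cst.
    by apply: cvg_expr; rewrite ger0_norm// invf_lt1// ltr1n.
  rewrite mulr0 => /cvgrPdist_le /(_ _ e0); apply: filterS => k.
  rewrite sub0r normrN ger0_norm; last by rewrite mulr_ge0 ?exprn_ge0.
  exact: le_trans (sol_close k t x).
move=> s y; rewrite -subr_le0; apply: (@le0_geometric _ _ C) => k.
rewrite lerBlDr addrC.
rewrite (_ : sol s y = iter_picard k s y + (sol s y - iter_picard k s y)); last by ring.
apply: le_trans (ler_normD _ _) _; apply: lerD; last exact: sol_close.
exact: (iter_below k).2.
Qed.

Let sol_fixpoint t x : 0 <= t <= T -> sol t x = picard sol t x.
Proof.
move=> tT; apply/eqP; rewrite -subr_eq0 -normr_le0.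
apply: (@le0_geometric _ _ (C + C * expR (lamb * t))) => k.
rewrite -(subrKA (iter_picard k.+1 t x)) mulrDl.
apply: le_trans (ler_normD _ _) _; apply: lerD.
  apply: le_trans (sol_close k.+1 t x) _; rewrite ler_wpM2l// exprS.
  by rewrite ler_piMl ?exprn_ge0// invf_le1// ler1n.
apply: le_trans (picard_gap (d := C * 2^-1 ^+ k) x (iter_below k) sol_below _ _ tT) _.
- by rewrite mulr_ge0 ?exprn_ge0.
- move=> s y /andP[s0 _]; rewrite distrC; apply: le_trans (sol_close k s y) _.
  apply: ler_peMr; first by rewrite mulr_ge0 ?exprn_ge0.
  by rewrite -[leLHS]expR0 ler_expR mulr_ge0// ltW.
- rewrite [leRHS]mulrAC; apply: ler_wpM2r; first exact: expR_ge0.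
  apply: ler_piMr; first by rewrite mulr_ge0 ?exprn_ge0.
  by rewrite invf_le1// ler1n.
Qed.

(** The limit of the iterates is a fixed point of the Picard map. The flow of [v0] and
    that of [u0] coincide at positive times, and at time zero they agree almost
    everywhere, which is all that the definition of a mild solution asks for. *)
Lemma exists_mild_solution (u0 : Rn R n -> R) : measurable_fun setT u0 ->
  {ae mu, forall y, v0 y = u0 y} ->
  exists u, bounded_mild_solution p eps u0 T%:E u.
Proof.
move=> mu0 vu; exists sol; split.
- apply: measurable_funTS; exact: sol_below.1.
- move=> T' _; exists B => t x _; exact: below_bounded.
- move=> t t0; rewrite lte_fin => tT.
  have tT' : 0 <= t <= T by rewrite t0 ltW.
  have [t00|tpos] := eqVneq t 0.
    rewrite {}t00 in tT tT' *.
    apply: filterS vu => x vux; rewrite sol_fixpoint// /picard tT'.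
    by rewrite !heat_semigroup0 vux.
  have {}tpos : 0 < t by rewrite lt_neqAle eq_sym tpos.
  apply: nearW => x; rewrite sol_fixpoint// /picard tT'.
  by rewrite (heat_semigroup_ae x tpos mv0 mu0 vu).
Qed.

End picard.

(** * Euclidean norm and Lipschitz bound for the heat kernel *)

Section euclidean.
Context (R : realType) (n : nat).
Implicit Types (x y z : Rn R n) (a b : R).

Definition dot x y : R := \sum_(i < n) tnth x i * tnth y i.

Lemma enorm_ge0 x : 0 <= enorm x.
Proof. exact: sqrtr_ge0. Qed.

Lemma norm_coordinate_le x i : `|tnth x i| <= enorm x.
Proof.
rewrite -sqrtr_sqr ler_sqrt ?sumr_ge0// => [|j _]; last exact: sqr_ge0.
by rewrite (bigD1 i)//= lerDl sumr_ge0// => j _; exact: sqr_ge0.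
Qed.

Lemma enorm_sub_sqr x y :
  enorm (sub_Rn x y) ^+ 2 = enorm x ^+ 2 - 2 * dot x y + enorm y ^+ 2.
Proof.
rewrite !enorm_sqr mulr_sumr -sumrB -big_split/=; apply: eq_bigr => i _.
by rewrite tnth_sub_Rn; ring.
Qed.

(** Cauchy-Schwarz: after multiplication by twice the product of the norms, the
    difference of the two sides is a sum of squares. *)
Lemma norm_dot_le x y : `|dot x y| <= enorm x * enorm y.
Proof.
have [x0|x0] := eqVneq (enorm x) 0.
  rewrite x0 mul0r normr_le0 /dot big1// => i _.
  have := norm_coordinate_le x i; rewrite x0 normr_le0 => /eqP ->.
  by rewrite mul0r.
have [y0|y0] := eqVneq (enorm y) 0.
  rewrite y0 mulr0 normr_le0 /dot big1// => i _.
  have := norm_coordinate_le y i; rewrite y0 normr_le0 => /eqP ->.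
  by rewrite mulr0.
have X0 : 0 < enorm x by rewrite lt_neqAle eq_sym x0 enorm_ge0.
have Y0 : 0 < enorm y by rewrite lt_neqAle eq_sym y0 enorm_ge0.
have h (e : R) : e ^+ 2 = 1 -> e * dot x y <= enorm x * enorm y.
  move=> e1; rewrite -subr_ge0 -(pmulr_rge0 _ (mulr_gt0 X0 Y0)) -(pmulr_rge0 _ (@ltr0Sn R 1)).
  have -> : 2 * (enorm x * enorm y * (enorm x * enorm y - e * dot x y)) =
     \sum_(i < n) (enorm y * tnth x i - e * enorm x * tnth y i) ^+ 2.
    transitivity (enorm y ^+ 2 * enorm x ^+ 2 + e ^+ 2 * enorm x ^+ 2 * enorm y ^+ 2
       - 2 * e * enorm x * enorm y * dot x y).
      by rewrite e1; ring.
    have -> : enorm y ^+ 2 * enorm x ^+ 2 = \sum_(i < n) enorm y ^+ 2 * tnth x i ^+ 2.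
      by rewrite (enorm_sqr x) mulr_sumr.
    have -> : e ^+ 2 * enorm x ^+ 2 * enorm y ^+ 2 =
        \sum_(i < n) e ^+ 2 * enorm x ^+ 2 * tnth y i ^+ 2.
      by rewrite (enorm_sqr y) mulr_sumr.
    rewrite /dot mulr_sumr -sumrN -!big_split/=.
    by apply: eq_bigr => i _; ring.
  by apply: sumr_ge0 => i _; exact: sqr_ge0.
rewrite ler_norml; apply/andP; split.
  have e1 : (-1 : R) ^+ 2 = 1 by rewrite sqrrN expr1n.
  by have := h _ e1; rewrite mulN1r lerNl.
by have := h 1 (expr1n _ _); rewrite mul1r.
Qed.

Lemma enorm_sub_dist x y : `|enorm (sub_Rn x y) - enorm x| <= enorm y.
Proof.
rewrite ler_norml lerNl opprB.
have h := norm_dot_le x y; have := ler_normlP _ _ h => -[h1 h2].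
apply/andP; split.
  rewrite lerBlDr -(@ler_pXn2r _ 2) ?nnegrE ?addr_ge0 ?enorm_ge0//.
  have : `|dot (sub_Rn x y) y| <= enorm (sub_Rn x y) * enorm y by exact: norm_dot_le.
  have -> : dot (sub_Rn x y) y = dot x y - enorm y ^+ 2.
    rewrite enorm_sqr -sumrB; apply: eq_bigr => i _; rewrite tnth_sub_Rn; ring.
  rewrite ler_norml => /andP[_ h3].
  rewrite sqrrD -mulr_natr.
  have := enorm_sub_sqr x y; lra.
rewrite lerBlDr -(@ler_pXn2r _ 2) ?nnegrE ?addr_ge0 ?enorm_ge0//.
rewrite enorm_sub_sqr sqrrD -mulr_natr; lra.
Qed.

(** Half of the exponent pays for the derivative: when [b - a <= 1], the factor
    [2 * a + 1] produced by the mean value theorem is absorbed by [expR (a ^+ 2 / 2)].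
    When [b - a > 1] the left-hand side is at most one Gaussian. *)
Lemma gauss_lipschitz a b : 0 <= a -> 0 <= b ->
  `|expR (- a ^+ 2) - expR (- b ^+ 2)| <=
  3 * `|a - b| * (expR (- (a ^+ 2 / 2)) + expR (- (b ^+ 2 / 2))).
Proof.
wlog ab : a b / a <= b.
  move=> wl a0 b0; have [ab|/ltW ba] := leP a b; first exact: wl.
  by have := wl _ _ ba b0 a0; rewrite distrC (distrC b) [X in _ <= _ * X]addrC.
move=> a0 b0.
have le1 : expR (- b ^+ 2) <= expR (- a ^+ 2).
  by rewrite ler_expR lerN2 ler_pXn2r ?nnegrE.
rewrite ger0_norm ?subr_ge0// ler0_norm ?subr_le0// opprB.
apply: (@le_trans _ _ (3 * (b - a) * expR (- (a ^+ 2 / 2)))); last first.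
  by rewrite ler_wpM2l ?mulr_ge0 ?subr_ge0// lerDl expR_ge0.
have sq : expR (- a ^+ 2) = expR (- (a ^+ 2 / 2)) * expR (- (a ^+ 2 / 2)).
  by rewrite -expRD; congr expR; field.
have e2 : 1 + a ^+ 2 / 2 <= expR (a ^+ 2 / 2) by exact: expR_ge1Dx.
have eV : expR (a ^+ 2 / 2) * expR (- (a ^+ 2 / 2)) = 1 by rewrite -expRD subrr expR0.
have E0 : 0 < expR (- (a ^+ 2 / 2)) by exact: expR_gt0.
have E1 : expR (- (a ^+ 2 / 2)) <= 1.
  by rewrite -[leRHS]expR0 ler_expR oppr_le0 divr_ge0// sqr_ge0.
have [d1|d1] := leP (b - a) 1; last first.
  apply: (@le_trans _ _ (expR (- a ^+ 2))); first by rewrite gerBl expR_ge0.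
  rewrite sq; apply: ler_wpM2r; first exact: ltW.
  by apply: (le_trans E1); lra.
have -> : expR (- a ^+ 2) - expR (- b ^+ 2) =
  expR (- a ^+ 2) * (1 - expR (- (b ^+ 2 - a ^+ 2))).
  by rewrite mulrBr mulr1 -expRD; congr (_ - expR _); ring.
apply: (@le_trans _ _ (expR (- a ^+ 2) * ((b - a) * (2 * a + 1)))).
  apply: ler_wpM2l; first exact: expR_ge0.
  have := expR_ge1Dx (- (b ^+ 2 - a ^+ 2)).
  have : 0 <= (b - a) * (1 - (b - a)) by rewrite mulr_ge0// subr_ge0.
  nra.
rewrite sq mulrAC; apply: ler_wpM2r; first exact: ltW.
have : 0 <= (b - a) * expR (- (a ^+ 2 / 2)) * (3 * expR (a ^+ 2 / 2) - (2 * a + 1)).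
  apply: mulr_ge0; first by rewrite mulr_ge0 ?subr_ge0// ltW.
  nra.
rewrite mulrBr (_ : (b - a) * _ * (3 * _) = 3 * (b - a) * (expR (a ^+ 2 / 2) * expR (- (a ^+ 2 / 2)))); last by ring.
rewrite eV; nra.
Qed.

(** The bound [gauss_lipschitz] on the scale [2 * Num.sqrt t]. Halving the exponent of
    the kernel at time [t] gives, up to a constant, the kernel at time [2 * t]. The
    factor [t `^ (- (1 / 2))] is the gain on which the decay of mean-zero data rests. *)
Lemma heat_kernel_lipschitz (t : R) x y : 0 < t ->
  `|heat_kernel t (sub_Rn x y) - heat_kernel t x| <=
  2 `^ (n%:R / 2) * (3 / 2) * t `^ (- (1 / 2)) * enorm y *
    (heat_kernel (2 * t) (sub_Rn x y) + heat_kernel (2 * t) x).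
Proof.
move=> t0; have st0 : 0 < Num.sqrt t by rewrite sqrtr_gt0.
pose s := 2 * Num.sqrt t; have s0 : 0 < s by rewrite mulr_gt0.
have s2 : s ^+ 2 = 4 * t by rewrite exprMn sqr_sqrtr ?ltW//; ring.
have ex z : enorm z ^+ 2 / (4 * t) = (enorm z / s) ^+ 2 by rewrite expr_div_n s2.
have ex2 z : enorm z ^+ 2 / (4 * (2 * t)) = (enorm z / s) ^+ 2 / 2.
  by rewrite expr_div_n s2; field; rewrite gt_eqF.
rewrite /heat_kernel !ex !ex2 -mulrBr normrM ger0_norm ?powR_ge0//.
have -> : (4 * pi * (2 * t)) `^ (- (n%:R / 2)) =
  2 `^ (- (n%:R / 2)) * (4 * pi * t) `^ (- (n%:R / 2)).
  by rewrite -powRM ?mulr_ge0 ?pi_ge0 ?(ltW t0)//; congr (_ `^ _); ring.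
rewrite -mulrDr.
set K := (4 * pi * t) `^ _; set E := _ + expR _.
have two : 2 `^ (n%:R / 2) * 2 `^ (- (n%:R / 2)) = 1 :> R.
  by rewrite -powRD ?subrr ?powRr0//; apply/implyP.
have -> : 2 `^ (n%:R / 2) * (3 / 2) * t `^ (- (1 / 2)) * enorm y *
   (2 `^ (- (n%:R / 2)) * K * E) = K * (3 * (enorm y / s) * E).
  have -> : t `^ (- (1 / 2)) = (Num.sqrt t)^-1 by rewrite powRN mul1r powR12_sqrt// ltW.
  rewrite (_ : _ * (_ * K * E) = (2 `^ (n%:R / 2) * 2 `^ (- (n%:R / 2))) *
    (K * E * (3 * (enorm y / (2 * Num.sqrt t))))); last by field; rewrite gt_eqF.
  by rewrite two /s; ring.
apply: ler_wpM2l; first exact: powR_ge0.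
apply: le_trans (gauss_lipschitz _ _) _; try by rewrite divr_ge0 ?enorm_ge0// ltW.
apply: ler_wpM2r; first by rewrite addr_ge0 ?expR_ge0.
apply: ler_wpM2l => //.
rewrite -mulrBl normrM [X in _ * X]ger0_norm ?invr_ge0 ?(ltW s0)//.
apply: ler_wpM2r; last exact: enorm_sub_dist.
by rewrite invr_ge0 ltW.
Qed.

End euclidean.

(** * The barrier profile *)

Section barrier.
Context (R : realType) (n : nat).
Local Notation mu := (lebesgue_Rn R n).
Local Notation lam := (@lebesgue_measure R).
Implicit Types (x y z : Rn R n) (s t r : R).
Variables (v0 : Rn R n -> R) (M0 : R).
Hypothesis mv0 : measurable_fun setT v0.
Hypothesis v0M : forall y, `|v0 y| <= M0.
Hypothesis iv0 : mu.-integrable setT (EFin \o v0).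
Hypothesis ipsi : mu.-integrable setT (EFin \o (fun y => enorm y * `|v0 y|)).
Hypothesis v0_mean : \int[mu]_y v0 y = 0.

Definition moment_density (f : Rn R n -> R) y : R := enorm y * `|f y|.
Local Notation psi := (moment_density v0).
Local Notation c2 := (2 `^ (n%:R / 2) : R).

Let m1 := \int[mu]_y psi y.

Let psi0 y : 0 <= psi y. Proof. by rewrite mulr_ge0 ?enorm_ge0. Qed.
Let m1_ge0 : 0 <= m1. Proof. by apply: Rintegral_ge0 => y _. Qed.
Let c2_ge0 : 0 <= c2. Proof. exact: powR_ge0. Qed.
Let c2_ge1 : 1 <= c2.
Proof. by rewrite -[leLHS](powRr0 2) ler_powR ?ler1n// divr_ge0. Qed.
Let hpsi : heatable psi. Proof. exact: heatable_integrable. Qed.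
Let hv0 : heatable v0. Proof. exact: heatable_integrable. Qed.

(** Since the mean of [v0] vanishes, the kernel at [x - y] may be replaced by its
    difference with the kernel at [x], which is of relative size [enorm y] over the
    square root of [t]. *)
Lemma heat_semigroup_mean_zero t x : 0 < t ->
  `|heat_semigroup t v0 x| <= c2 * (3 / 2) * t `^ (- (1 / 2)) *
    (heat_semigroup (2 * t) psi x + heat_kernel (2 * t) x * m1).
Proof.
move=> t0; have t20 : 0 < 2 * t by rewrite mulr_gt0.
have ik : mu.-integrable setT (EFin \o (fun y => heat_kernel t x * v0 y)) by exact: integrable_scale.
have iK : mu.-integrable setT (EFin \o (fun y => heat_kernel t (sub_Rn x y) * v0 y)) by exact: hv0.2.
have -> : heat_semigroup t v0 x =
  \int[mu]_y ((heat_kernel t (sub_Rn x y) - heat_kernel t x) * v0 y).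
  rewrite heat_semigroupE// -[LHS]subr0 -(mulr0 (heat_kernel t x)) -v0_mean.
  rewrite -RintegralZl// -RintegralB//.
  by apply: eq_Rintegral => y _; rewrite mulrBl.
have iB : mu.-integrable setT
    (EFin \o (fun y => (heat_kernel t (sub_Rn x y) - heat_kernel t x) * v0 y)).
  rewrite (_ : _ \o _ = (fun y => (heat_kernel t (sub_Rn x y) * v0 y)%:E - (heat_kernel t x * v0 y)%:E)%E).
    exact: integrableB.
  by apply/funext => y /=; rewrite mulrBl.
have iP : mu.-integrable setT (EFin \o (fun y => heat_kernel (2 * t) x * psi y)) by exact: integrable_scale.
have iQ : mu.-integrable setT (EFin \o (fun y => heat_kernel (2 * t) (sub_Rn x y) * psi y)) by exact: hpsi.2.
apply: le_trans (le_normr_Rintegral measurableT iB) _.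
rewrite heat_semigroupE// -(RintegralZl _ measurableT ipsi).
rewrite -RintegralD// -RintegralZl//; last first.
  by rewrite (_ : _ \o _ = (fun y => (heat_kernel (2 * t) (sub_Rn x y) * psi y)%:E +
    (heat_kernel (2 * t) x * psi y)%:E)%E)//; exact: integrableD.
apply: le_Rintegral => //.
- exact: integrable_norm.
- apply: integrable_scale => //.
  by rewrite (_ : _ \o _ = (fun y => (heat_kernel (2 * t) (sub_Rn x y) * psi y)%:E +
    (heat_kernel (2 * t) x * psi y)%:E)%E)//; exact: integrableD.
- move=> y _; rewrite normrM -mulrDl mulrCA mulrA /moment_density mulrA.
  apply: ler_wpM2r => //.
  apply: le_trans (heat_kernel_lipschitz x y t0) _.
  by rewrite le_eqVlt; apply/orP; left; apply/eqP; ring.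
Qed.

(** The three terms are those needed to dominate the flow of [v0]: the crude bound by the
    flow of [`|v0|] and the two terms of the mean-zero estimate. The latter are moved
    forward by one unit of time because they need not be bounded at time zero. *)
Let phi y := `|v0 y| + (heat_semigroup 1 psi y + m1 * heat_kernel 1 y).

Let habs : heatable (fun y => `|v0 y|). Proof. exact: heatable_norm. Qed.
Let hH1 : heatable (heat_semigroup 1 psi). Proof. exact: heat_semigroup_heatable. Qed.
Let hG1 : heatable (fun y : Rn R n => m1 * heat_kernel 1 y).
Proof. by apply: heatableZ; exact: heatable_heat_kernel. Qed.
Let hphi : heatable phi.
Proof. by apply: heatableD => //; exact: heatableD. Qed.
Let phi0 y : 0 <= phi y.
Proof.
by rewrite !addr_ge0 ?heat_semigroup_ge0// mulr_ge0// heat_kernel_ge0.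
Qed.

(** The flow runs at doubled speed so that the profile is almost invariant under the heat
    flow. Flowing from time [s] to time [t] turns the heat time [2 * s] into [t + s],
    which lies between [t] and [2 * t]; on that range the flow of a nonnegative function
    increases in time up to the constant [2 `^ (n%:R / 2)]. *)
Definition heat_barrier t x : R := heat_semigroup (2 * t) phi x.

Lemma heatable_heat_barrier t : 0 <= t -> heatable (heat_barrier t).
Proof. by move=> t0; apply: heat_semigroup_heatable => //; rewrite mulr_ge0. Qed.

Lemma heat_barrier_ge0 t x : 0 <= heat_barrier t x.
Proof. exact: heat_semigroup_ge0. Qed.

Let heat_barrierE t x : 0 < t -> heat_barrier t x =
  heat_semigroup (2 * t) (fun y => `|v0 y|) x +
  (heat_semigroup (2 * t + 1) psi x + m1 * heat_kernel (2 * t + 1) x).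
Proof.
move=> t0; have t20 : 0 < 2 * t by rewrite mulr_gt0.
rewrite /heat_barrier /phi.
rewrite heat_semigroupD ?(ltW t20)//; last exact: heatableD.
rewrite heat_semigroupD ?(ltW t20)// heat_semigroup_add ?(ltW t20)//.
rewrite heat_semigroupZ ?(ltW t20)//; last exact: heatable_heat_kernel.
by rewrite heat_semigroup_kernel.
Qed.

Let ratio_le r : 0 <= r <= 2 -> r `^ (n%:R / 2) <= c2.
Proof.
move=> /andP[r0 r2]; by rewrite ge0_ler_powR ?nnegrE.
Qed.

Lemma heat_barrier_flow s t x : 0 <= s <= t ->
  heat_semigroup (t - s) (heat_barrier s) x <= c2 * heat_barrier t x.
Proof.
move=> /andP[s0 st]; have t0 : 0 <= t by exact: le_trans st.
rewrite heat_semigroup_add//; [|by rewrite subr_ge0|by rewrite mulr_ge0].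
have -> : t - s + 2 * s = t + s by ring.
have [z|ts0] := eqVneq (t + s) 0.
  have -> : s = 0 by apply/eqP; rewrite eq_le s0 andbT -z lerDr.
  have -> : t = 0 by apply/eqP; rewrite eq_le t0 andbT -z lerDl.
  by rewrite /heat_barrier mulr0 addr0 ler_peMl ?heat_semigroup_ge0.
have {}ts0 : 0 < t + s by rewrite lt_neqAle eq_sym ts0 addr_ge0.
have ts : t + s <= 2 * t by rewrite mulr_natl mulr2n lerD2l.
apply: le_trans (heat_semigroup_time_le x ts0 ts hphi phi0) _.
apply: ler_wpM2r; first exact: heat_barrier_ge0.
apply: ratio_le; rewrite divr_ge0 ?mulr_ge0 ?(ltW ts0)//=.
by rewrite ler_pdivrMr// ler_wpM2l// lerDl.
Qed.

Let decay_le s t : 0 <= t -> 1 + t <= s ->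
  s `^ (- (n%:R / 2)) <= (1 + t) `^ (- (n%:R / 2)) :> R.
Proof.
move=> t0 ts; have t1 : 0 < 1 + t by rewrite ltr_pwDl.
have s0 : 0 < s by exact: lt_le_trans ts.
by rewrite !powRN lef_pV2 ?posrE ?powR_gt0// ge0_ler_powR ?nnegrE ?(ltW t1) ?(ltW s0).
Qed.

(** Up to time one the flow of [`|v0|] is bounded by the bound on [v0], afterwards by the
    maximum of the kernel times its integral. The two other terms start from heat time
    one, and there the second bound applies from the beginning. *)
Lemma heat_barrier_decay : exists C : R, 0 < C /\ forall t x, 0 <= t ->
  heat_barrier t x <= C * (1 + t) `^ (- (n%:R / 2)).
Proof.
pose m0 := \int[mu]_y `|v0 y|.
have m00 : 0 <= m0 by apply: Rintegral_ge0 => y _.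
have M00 : 0 <= M0 by apply: le_trans (v0M [tuple 0 | i < n]).
have pi3 : 1 <= pi :> R by rewrite (le_trans _ (pi_ge2 R))// ler1n.
pose C := c2 * M0 + m0 + m1 + m1 + 1.
exists C; split.
  by rewrite ltr_wpDl// !addr_ge0// mulr_ge0.
have psi_part s t x : 0 <= t -> 1 + t <= s ->
    heat_semigroup s psi x <= m1 * (1 + t) `^ (- (n%:R / 2)).
  move=> t0 ts; have s0 : 0 < s by rewrite (lt_le_trans _ ts)// ltr_pwDl.
  apply: le_trans (heat_semigroup_integrable_le x s0 ipsi psi0) _.
  rewrite mulrC; apply: ler_wpM2l => //; apply: decay_le => //.
  by apply: (le_trans ts); rewrite ler_peMl ?(ltW s0)//; nra.
have ker_part s t x : 0 <= t -> 1 + t <= s ->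
    m1 * heat_kernel s x <= m1 * (1 + t) `^ (- (n%:R / 2)).
  move=> t0 ts; have s0 : 0 < s by rewrite (lt_le_trans _ ts)// ltr_pwDl.
  apply: ler_wpM2l => //; apply: le_trans (heat_kernel_le x s0) _; apply: decay_le => //.
  by apply: (le_trans ts); rewrite ler_peMl ?(ltW s0)//; nra.
have abs_part t x : 0 <= t ->
    heat_semigroup (2 * t) (fun y => `|v0 y|) x <=
    (c2 * M0 + m0) * (1 + t) `^ (- (n%:R / 2)).
  move=> t0; have t20' : 0 <= 2 * t by rewrite mulr_ge0.
  rewrite [leRHS]mulrDl; have [t1|t1] := leP t 1.
    apply: (@le_trans _ _ M0).
      apply: le_trans (ler_norm _) _; apply: norm_heat_semigroup_bound.
      - exact: t20'.
      - exact: measurableT_comp.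
      - by move=> y; rewrite normr_id.
    rewrite -[leLHS]addr0; apply: lerD; last by rewrite mulr_ge0 ?powR_ge0.
    rewrite -mulrA mulrCA ler_peMr// powRN ler_pdivlMr ?powR_gt0 ?ltr_pwDl// mul1r.
    by apply: ratio_le; rewrite addr_ge0//=; lra.
  have t20 : 0 < 2 * t by rewrite mulr_gt0// (lt_trans _ t1).
  rewrite -[leLHS]add0r; apply: lerD; first by rewrite !mulr_ge0 ?powR_ge0.
  apply: le_trans (heat_semigroup_integrable_le x t20 _ _) _ => //.
    exact: integrable_norm.
  rewrite mulrC; apply: ler_wpM2l => //; apply: decay_le => //; nra.
move=> t x t0.
have -> : C * (1 + t) `^ (- (n%:R / 2)) = (c2 * M0 + m0) * (1 + t) `^ (- (n%:R / 2)) +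
  (m1 * (1 + t) `^ (- (n%:R / 2)) + m1 * (1 + t) `^ (- (n%:R / 2))) + (1 + t) `^ (- (n%:R / 2)).
  by rewrite /C; ring.
rewrite -[leLHS]addr0; apply: lerD; last exact: powR_ge0.
have [tz|tnz] := eqVneq t 0.
  rewrite {}tz in t0 *.
  rewrite /heat_barrier mulr0 heat_semigroup0 /phi; apply: lerD.
    by have := abs_part 0 x t0; rewrite mulr0 heat_semigroup0.
  by apply: lerD; [apply: psi_part | apply: ker_part]; rewrite ?addr0.
have {}tnz : 0 < t by rewrite lt_neqAle eq_sym tnz.
rewrite heat_barrierE//; apply: lerD; first exact: abs_part.
by apply: lerD; [apply: psi_part | apply: ker_part] => //; lra.
Qed.

(** Up to time one the crude bound by the flow of [`|v0|] is enough; afterwards the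
    mean-zero estimate applies. *)
Lemma heat_semigroup_le_barrier : exists C : R, 0 < C /\ forall t x, 0 <= t ->
  `|heat_semigroup t v0 x| <= C * (1 + t) `^ (- (1 / 2)) * heat_barrier t x.
Proof.
have half s t : 0 < s -> 0 < t -> t <= 4 * s -> s `^ (- (1 / 2)) <= 2 * t `^ (- (1 / 2)) :> R.
  move=> s0 t0 ts; rewrite !powRN mul1r !powR12_sqrt; [|exact: ltW|exact: ltW].
  rewrite ler_pdivlMr ?sqrtr_gt0// mulrC ler_pdivrMr ?sqrtr_gt0//.
  rewrite -(@ler_pXn2r _ 2) ?nnegrE ?mulr_ge0 ?sqrtr_ge0//.
  by rewrite exprMn !sqr_sqrtr; [lra|exact: ltW|exact: ltW].
exists (3 * c2 * c2); split.
  by rewrite !mulr_gt0// (lt_le_trans _ c2_ge1).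
move=> t x t0.
have base : `|heat_semigroup t v0 x| <= heat_semigroup t (fun y => `|v0 y|) x.
  exact: norm_heat_semigroup_le.
have B0 := heat_barrier_ge0 t x.
have [t1|t1] := leP t 1.
  apply: le_trans base _.
  have h1 : heat_semigroup t (fun y => `|v0 y|) x <= c2 * heat_barrier t x.
    have := @heat_barrier_flow 0 t x; rewrite lexx t0 => /(_ isT); apply: le_trans.
    rewrite subr0; apply: le_heat_semigroup => //; first exact: heatable_heat_barrier.
    move=> y; rewrite /heat_barrier mulr0 heat_semigroup0 /phi lerDl.
    by rewrite addr_ge0 ?heat_semigroup_ge0// mulr_ge0// heat_kernel_ge0.
  apply: (le_trans h1); apply: ler_wpM2r => //.
  have h2 : 1 <= 2 * (1 + t) `^ (- (1 / 2)) :> R.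
    by have := half 1 (1 + t); rewrite powR1; apply => //; lra.
  rewrite (_ : 3 * c2 * c2 * _ = c2 * (c2 * (3 * (1 + t) `^ (- (1 / 2))))); last by ring.
  by rewrite ler_peMr// mulr_ege1//; lra.
have t00 : 0 < t by rewrite (lt_trans _ t1).
have t20 : 0 < 2 * t by rewrite mulr_gt0.
have t4 : 1 + t <= 4 * t by lra.
apply: le_trans (heat_semigroup_mean_zero x t00) _.
have tt : 2 * t <= 2 * t + 1 by rewrite lerDl.
have rt : (2 * t + 1) / (2 * t) <= 2 by rewrite ler_pdivrMr//; lra.
have rt0 : 0 <= (2 * t + 1) / (2 * t) by apply: divr_ge0; [lra|exact: ltW].
have rr : ((2 * t + 1) / (2 * t)) `^ (n%:R / 2) <= c2 by apply: ratio_le; rewrite rt0.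
have hA : heat_semigroup (2 * t) psi x <= c2 * heat_semigroup (2 * t + 1) psi x.
  apply: le_trans (heat_semigroup_time_le x t20 tt hpsi psi0) _.
  by apply: ler_wpM2r => //; exact: heat_semigroup_ge0.
have hB : heat_kernel (2 * t) x * m1 <= c2 * (m1 * heat_kernel (2 * t + 1) x).
  rewrite [leRHS]mulrCA mulrC; apply: ler_wpM2l => //.
  apply: le_trans (heat_kernel_time_le x t20 tt) _.
  by apply: ler_wpM2r => //; exact: heat_kernel_ge0.
have hC : heat_semigroup (2 * t) psi x + heat_kernel (2 * t) x * m1 <= c2 * heat_barrier t x.
  rewrite heat_barrierE// 2!mulrDr; apply: (le_trans (lerD hA hB)).
  rewrite lerDr; apply: mulr_ge0; first exact: c2_ge0.
  by apply: heat_semigroup_ge0 => y; exact: normr_ge0.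
have h2 : t `^ (- (1 / 2)) <= 2 * (1 + t) `^ (- (1 / 2)) :> R.
  by apply: half; [exact: t00 | exact: ltr_pwDl | exact: t4].
apply: (@le_trans _ _ (c2 * (3 / 2) * (2 * (1 + t) `^ (- (1 / 2))) * (c2 * heat_barrier t x))).
  apply: ler_pM => //.
  - by rewrite !mulr_ge0 ?powR_ge0.
  - by rewrite addr_ge0 ?heat_semigroup_ge0// mulr_ge0// heat_kernel_ge0.
  - by apply: ler_wpM2l => //; rewrite mulr_ge0.
by rewrite le_eqVlt; apply/orP; left; apply/eqP; field.
Qed.

End barrier.

(** * Lower bound for the lifespan *)

Section lower_bound.
Context (R : realType) (n : nat).
Local Notation mu := (lebesgue_Rn R n).
Local Notation lam := (@lebesgue_measure R).
Implicit Types (x y z : Rn R n) (s t r : R).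
Variables (v0 u0 : Rn R n -> R) (M0 p : R).
Hypothesis mv0 : measurable_fun setT v0.
Hypothesis v0M : forall y, `|v0 y| <= M0.
Hypothesis iv0 : mu.-integrable setT (EFin \o v0).
Hypothesis ipsi : mu.-integrable setT (EFin \o (fun y => enorm y * `|v0 y|)).
Hypothesis v0_mean : \int[mu]_y v0 y = 0.
Hypothesis mu0 : measurable_fun setT u0.
Hypothesis vu : {ae mu, forall y, v0 y = u0 y}.
Hypothesis p1 : 1 < p.

Lemma powRD_le (a b q : R) : 0 <= a -> 0 <= b -> 0 <= q ->
  (a + b) `^ q <= 2 `^ q * (a `^ q + b `^ q).
Proof.
wlog ab : a b / a <= b.
  move=> wl a0 b0 q0; have [ab|/ltW ba] := leP a b; first exact: wl.
  by rewrite addrC (addrC (a `^ q)) wl.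
move=> a0 b0 q0; apply: (@le_trans _ _ ((2 * b) `^ q)).
  by rewrite ge0_ler_powR ?nnegrE ?addr_ge0 ?mulr_ge0//; lra.
by rewrite powRM// ler_wpM2l ?powR_ge0// lerDr powR_ge0.
Qed.

Lemma measurable_shift_powR e :
  measurable_fun [set: measurableTypeR R] (fun s => (1 + s) `^ e : R).
Proof.
apply: (@measurableT_comp _ _ _ _ _ _ (@powR R ^~ e)) => //.
exact: measurable_funD.
Qed.

Lemma integrable_shift_powR (e T : R) : 0 <= e ->
  lam.-integrable `[0, T] (EFin \o (fun s => (1 + s) `^ (- e))).
Proof.
move=> e0; apply: (@integrable_itv_bounded _ _ 1); first exact: measurable_shift_powR.
move=> s /andP[s0 _]; rewrite ger0_norm ?powR_ge0// powRN invf_le1 ?powR_gt0 ?ltr_pwDl//.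
by rewrite -[leLHS](powRr0 (1 + s)) ler_powR// lerDl.
Qed.

(** The supersolution is [U t = (C1 * eps * (1 + t) `^ (- (1 / 2)) + h) * Theta t], where
    [Theta] is the barrier profile: the first term dominates the linear flow, and the
    constant [h], of order [eps `^ p * I], accounts for the source. By the decay of
    [Theta], [U `^ p] is at most [g s * Theta s], where [g] is a combination of the two
    powers of [1 + s] whose integrals are [I] and [J], so that [duhamel_barrier] bounds
    the source term. The smallness condition says that what the second term of [U]
    contributes is below [h / 2]. *)
Lemma lifespan_ge : exists delta : R, 0 < delta /\
  forall eps T I J : R, 0 < eps -> 0 < T -> 0 < I -> 0 < J ->
  \int[lam]_(s in `[0, T]) (1 + s) `^ (- (p / 2 + n%:R * (p - 1) / 2)) <= I ->
  \int[lam]_(s in `[0, T]) (1 + s) `^ (- (n%:R * (p - 1) / 2)) <= J ->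
  (eps `^ p * I) `^ (p - 1) * J <= delta ->
  (T%:E <= lifespan p eps u0)%E.
Proof.
have p0 : 0 < p by exact: lt_trans p1.
have q0 : 0 < p - 1 by rewrite subr_gt0.
have [C1 [C1_gt0 HC1]] := heat_semigroup_le_barrier iv0 ipsi v0_mean.
have [C2 [C2_gt0 HC2]] := heat_barrier_decay mv0 v0M iv0 ipsi.
pose Th := heat_barrier v0.
have Th0 t x : 0 <= Th t x by exact: (heat_barrier_ge0 v0 t x).
pose a := n%:R * (p - 1) / 2; pose b := p / 2 + n%:R * (p - 1) / 2.
have a0 : 0 <= a by rewrite divr_ge0// mulr_ge0// ltW.
have b0 : 0 <= b by rewrite addr_ge0// divr_ge0// ltW.
pose K := 2 `^ p * C2 `^ (p - 1).
have K0 : 0 < K by rewrite mulr_gt0// powR_gt0.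
pose D := 2 `^ (n%:R / 2) * K.
have D0 : 0 < D by rewrite mulr_gt0// powR_gt0.
exists (2 * D * (2 * D * C1 `^ p) `^ (p - 1))^-1; split.
  by rewrite invr_gt0 !mulr_gt0// powR_gt0// !mulr_gt0// powR_gt0.
move=> eps T I J e0 T0 I0 J0 hI hJ hd.
(* With this choice the contribution of the linear flow to the source term is exactly
   [h / 2]. *)
pose h := 2 * D * C1 `^ p * (eps `^ p * I).
have eI : 0 < eps `^ p * I by rewrite mulr_gt0// powR_gt0.
have h0 : 0 < h by rewrite !mulr_gt0// powR_gt0.
have hJ2 : D * h `^ p * J <= h / 2.
  have -> : h `^ p = h * ((2 * D * C1 `^ p) `^ (p - 1) * (eps `^ p * I) `^ (p - 1)).
    rewrite -powRM ?(ltW eI)//; last by rewrite !mulr_ge0 ?powR_ge0// ltW.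
    by rewrite mulr_powRB1// ltW.
  move: hd; set A := _ `^ (p - 1); set E := (2 * D * _) `^ (p - 1) => hd.
  have E0 : 0 < E by rewrite powR_gt0// !mulr_gt0// powR_gt0.
  have := ler_wpM2l (ltW (mulr_gt0 D0 (mulr_gt0 h0 E0))) hd.
  rewrite (_ : D * (h * E) * (2 * D * E)^-1 = h / 2); last by field; rewrite !gt_eqF.
  by rewrite (_ : D * (h * E) * (A * J) = D * (h * (E * A)) * J)//; ring.
pose al t := C1 * eps * (1 + t) `^ (- (1 / 2)) + h.
have al0 t : 0 < al t by rewrite ltr_wpDl// !mulr_ge0 ?powR_ge0// ltW.
pose U t x := al t * Th t x.
pose B := (C1 * eps + h) * C2.
have B0 : 0 < B by rewrite mulr_gt0// addr_gt0// mulr_gt0.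
have le1 e t : 0 <= e -> 0 <= t -> (1 + t) `^ (- e) <= 1 :> R.
  move=> e0' t0; rewrite powRN invf_le1 ?powR_gt0 ?ltr_pwDl//.
  by rewrite -[leLHS](powRr0 (1 + t)) ler_powR// lerDl.
have UB t x : 0 <= t <= T -> 0 <= U t x <= B.
  move=> /andP[t0 tT]; rewrite mulr_ge0 ?(ltW (al0 t))//=.
  apply: ler_pM => //; first exact: ltW.
    by rewrite /al lerD2r ler_piMr ?le1// mulr_ge0// ltW.
  apply: le_trans (HC2 t x t0) _.
  by rewrite ler_piMr ?le1// ?divr_ge0// ltW.
pose g s := K * ((C1 * eps) `^ p * (1 + s) `^ (- b) + h `^ p * (1 + s) `^ (- a)).
have gi t : lam.-integrable `[0, t] (EFin \o g).
  apply: integrable_scale => //.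
  by apply: integrable_add => //; apply: integrable_scale => //; exact: integrable_shift_powR.
have g0 s : 0 <= g s.
  by rewrite mulr_ge0 ?(ltW K0)// addr_ge0// mulr_ge0 ?powR_ge0.
have Ug s y : 0 <= s -> U s y `^ p <= g s * Th s y.
  move=> s0.
  rewrite powRM ?(ltW (al0 s))// -[Th s y `^ p](mulr_powRB1 (Th0 s y) p0).
  rewrite mulrCA [leRHS]mulrC; apply: ler_wpM2l => //.
  have h1 : al s `^ p <= 2 `^ p * ((C1 * eps) `^ p * (1 + s) `^ (- (p / 2)) + h `^ p).
    apply: le_trans (powRD_le _ _ _) _; rewrite ?(ltW h0) ?(ltW p0)//.
      by rewrite !mulr_ge0 ?powR_ge0// ltW.
    rewrite powRM ?powR_ge0//; last by rewrite mulr_ge0// ltW.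
    by rewrite -powRrM (_ : - (1 / 2) * p = - (p / 2))//; field.
  have h2 : Th s y `^ (p - 1) <= C2 `^ (p - 1) * (1 + s) `^ (- a).
    rewrite (_ : (1 + s) `^ (- a) = ((1 + s) `^ (- (n%:R / 2))) `^ (p - 1)); last first.
      by rewrite -powRrM; congr (_ `^ _); rewrite /a; field.
    rewrite -powRM ?powR_ge0 ?(ltW C2_gt0)//.
    by rewrite ge0_ler_powR ?nnegrE ?mulr_ge0 ?powR_ge0 ?(ltW q0) ?(ltW C2_gt0)// HC2.
  apply: le_trans (ler_pM _ _ h1 h2) _; rewrite ?powR_ge0//.
  rewrite /g /K.
  have -> : (1 + s) `^ (- b) = (1 + s) `^ (- (p / 2)) * (1 + s) `^ (- a).
    rewrite -powRD; first by congr (_ `^ _); rewrite /a /b; ring.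
    by apply/implyP => _; rewrite gt_eqF// ltr_pwDl.
  by rewrite le_eqVlt; apply/orP; left; apply/eqP; ring.
have gI t : 0 <= t <= T -> \int[lam]_(s in `[0, t]) g s <=
    K * ((C1 * eps) `^ p * I + h `^ p * J).
  move=> /andP[t0 tT].
  apply: (@le_trans _ _ (\int[lam]_(s in `[0, T]) g s)).
    rewrite (Rintegral_itv_split t0 tT (gi T)) lerDl.
    by apply: Rintegral_ge0.
  rewrite /g RintegralZl//; last first.
    by apply: integrable_add => //; apply: integrable_scale => //; exact: integrable_shift_powR.
  apply: ler_wpM2l; first exact: ltW.
  rewrite RintegralD//; last 2 first.
    by apply: integrable_scale => //; exact: integrable_shift_powR.
    by apply: integrable_scale => //; exact: integrable_shift_powR.
  rewrite !RintegralZl//; try exact: integrable_shift_powR.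
  by apply: lerD; apply: ler_wpM2l; rewrite ?powR_ge0.
have [u Hu] : exists u, bounded_mild_solution p eps u0 T%:E u.
  apply: (exists_mild_solution (U := U) (B := B) p1 e0 B0 mv0 UB _ mu0 vu).
  move=> w mw wU t x tT; have /andP[t0 tleT] := tT.
  have bw : bounded_spacetime w (B `^ p).
    split=> // s y; have /andP[w0 wu] := wU s y; rewrite ger0_norm//.
    apply: (le_trans wu); case: ifPn => [sT|_]; last exact: powR_ge0.
    have /andP[u0' uB] := UB s y sT.
    by rewrite ge0_ler_powR ?nnegrE ?(ltW p0) ?(ltW B0).
  have hd1 : duhamel w t x <= 2 `^ (n%:R / 2) * Th t x * \int[lam]_(s in `[0, t]) g s.
    apply: (duhamel_barrier (g := g) (Theta := Th) (M := B `^ p)) => //.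
    - move=> s /andP[s0 _]; exact: (heatable_heat_barrier iv0 ipsi s0).
    - move=> s y /andP[s0 st]; have /andP[_ wu] := wU s y.
      apply: (le_trans wu); rewrite s0 (le_trans st tleT)/=; exact: Ug.
    - move=> s sT; exact: heat_barrier_flow.
  apply: (@le_trans _ _ (eps * (C1 * (1 + t) `^ (- (1 / 2)) * Th t x) +
    2 `^ (n%:R / 2) * Th t x * (K * ((C1 * eps) `^ p * I + h `^ p * J)))).
    apply: lerD; first by apply: ler_wpM2l (HC1 t x t0); exact: ltW.
    apply: (le_trans hd1); apply: ler_wpM2l; first by rewrite mulr_ge0 ?powR_ge0.
    exact: gI.
  rewrite /U /al mulrDl.
  have -> : eps * (C1 * (1 + t) `^ (- (1 / 2)) * Th t x) = C1 * eps * (1 + t) `^ (- (1 / 2)) * Th t x.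
    by ring.
  rewrite lerD2l.
  rewrite (_ : 2 `^ (n%:R / 2) * Th t x * _ = (D * (C1 * eps) `^ p * I + D * h `^ p * J) * Th t x); last first.
    by rewrite /D; ring.
  apply: ler_wpM2r => //.
  have -> : D * (C1 * eps) `^ p * I = h / 2.
    by rewrite /h powRM ?(ltW C1_gt0) ?(ltW e0)//; field.
  by rewrite [leRHS](splitr h) lerD2l.
apply: ereal_sup_ubound; split; first by rewrite lte_fin.
by exists u.
Qed.

End lower_bound.

(** * Integrals of powers of time *)

Section power_integrals.
Context (R : realType).
Local Notation lam := (@lebesgue_measure R).
Implicit Types e x y T s t : R.

Lemma integrable_powRN e x y : 0 <= e -> 1 <= x ->
  lam.-integrable `[x, y] (EFin \o (fun s => s `^ (- e))).
Proof.
move=> e0 x1; apply: (@integrable_itv_bounded _ _ 1).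
  exact: (@measurableT_comp _ _ _ _ _ _ (@powR R ^~ (- e))).
move=> s /andP[xs _]; have s1 : 1 <= s by exact: le_trans xs.
have s0 : 0 < s by exact: lt_le_trans s1.
rewrite ger0_norm ?powR_ge0// powRN invf_le1 ?powR_gt0//.
by rewrite -[leLHS](powRr0 s) ler_powR.
Qed.

Lemma ge_Rintegral_powRN e x y : 0 <= e -> 1 <= x -> x <= y ->
  (y - x) * y `^ (- e) <= \int[lam]_(s in `[x, y]) s `^ (- e).
Proof.
move=> e0 x1 xy; have x0 : 0 < x by exact: lt_le_trans x1.
rewrite mulrC -(Rintegral_itv_cst _ xy); apply: le_Rintegral => //.
- by apply: (@integrable_itv_bounded _ _ `|y `^ (- e)|).
- exact: integrable_powRN.
- move=> s /=; rewrite in_itv/= => /andP[xs sy].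
  have s0 : 0 < s by exact: lt_le_trans xs.
  rewrite !powRN lef_pV2 ?posrE ?powR_gt0 ?(lt_le_trans s0)//.
  by rewrite ge0_ler_powR ?nnegrE ?(ltW s0)// (le_trans (ltW s0)).
Qed.

Lemma Rintegral_powRN1 x y : 0 < x -> x <= y ->
  \int[lam]_(s in `[x, y]) s `^ (-1) = ln y - ln x.
Proof.
move=> x0 xy.
have pos s : x <= s <= y -> 0 < s by move=> /andP[xs _]; exact: lt_le_trans xs.
transitivity (\int[lam]_(s in `[x, y]) s^-1).
  by apply: eq_Rintegral => s; rewrite inE/= in_itv/= => /pos/ltW; exact: powR_inv1.
have d s : x <= s <= y -> is_derive s 1 (@ln R) (s^-1) by move=> /pos; exact: is_derive1_ln.
have c s : x <= s <= y -> {for s, continuous (fun s : R => s^-1)}.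
  by move=> /pos s0; apply: inv_continuous; rewrite gt_eqF.
exact: (Rintegral_derivative xy d c).
Qed.

Let is_derive_shift e s : 0 <= s ->
  is_derive s 1 (fun s : R => (1 + s) `^ e) (e * (1 + s) `^ (e - 1)).
Proof.
move=> s0; have s1 : 0 < 1 + s by rewrite ltr_pwDl.
have d1 : is_derive s 1 (fun s : R => 1 + s) 1.
  by have := @is_deriveD R R^o R^o (cst 1) id s 1 0 1 _ _; rewrite add0r; apply.
have := @is_derive1_comp R (fun u => u `^ e) (fun s => 1 + s) s _ _ (is_derive1_powR e s1) d1.
by rewrite mulr1.
Qed.

Let continuous_shift e s : 0 <= s -> {for s, continuous (fun s : R => (1 + s) `^ e)}.
Proof.
move=> s0; apply: differentiable_continuous; apply/derivable1_diffP.
by case: (is_derive_shift e s0).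
Qed.

Lemma Rintegral_shift_powR e T : 0 <= T -> e != 1 ->
  \int[lam]_(s in `[0, T]) (1 + s) `^ (- e) = ((1 + T) `^ (1 - e) - 1) / (1 - e).
Proof.
move=> T0 e1; have e1' : 1 - e != 0 by rewrite subr_eq0 eq_sym.
have d s : 0 <= s <= T ->
    is_derive s 1 (fun s : R => (1 - e)^-1 * (1 + s) `^ (1 - e)) ((1 + s) `^ (- e)).
  move=> /andP[s0 _].
  have := @is_deriveZ R R^o R^o _ (1 - e)^-1 s 1 _ (is_derive_shift (1 - e) s0).
  rewrite /GRing.scale/= mulrA mulVf// mul1r.
  by rewrite (_ : 1 - e - 1 = - e)//; ring.
have c s : 0 <= s <= T -> {for s, continuous (fun s : R => (1 + s) `^ (- e))}.
  by move=> /andP[s0 _]; exact: continuous_shift.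
by rewrite (Rintegral_derivative T0 d c) addr0 powR1 mulr1; field.
Qed.

Lemma Rintegral_shift_powR_lt1 e T : 0 <= T -> e < 1 ->
  \int[lam]_(s in `[0, T]) (1 + s) `^ (- e) <= (1 + T) `^ (1 - e) / (1 - e).
Proof.
move=> T0 e1; rewrite Rintegral_shift_powR ?lt_eqF//.
by apply: ler_wpM2r; rewrite ?invr_ge0 ?subr_ge0 ?(ltW e1)// gerBl.
Qed.

Lemma Rintegral_shift_powR_gt1 e T : 0 <= T -> 1 < e ->
  \int[lam]_(s in `[0, T]) (1 + s) `^ (- e) <= (e - 1)^-1.
Proof.
move=> T0 e1; rewrite Rintegral_shift_powR ?gt_eqF//.
rewrite (_ : _ / _ = (1 - (1 + T) `^ (1 - e)) * (e - 1)^-1); last first.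
  have h1 : 1 - e != 0 by rewrite subr_eq0 lt_eqF.
  have h2 : e - 1 != 0 by rewrite subr_eq0 gt_eqF.
  by apply/eqP; rewrite eqr_div//; apply/eqP; ring.
by rewrite ler_piMl ?invr_ge0 ?subr_ge0 ?(ltW e1)// gerBl powR_ge0.
Qed.

Lemma Rintegral_shift_powR_eq1 T : 0 <= T ->
  \int[lam]_(s in `[0, T]) (1 + s) `^ (-1) = ln (1 + T).
Proof.
move=> T0.
have d s : 0 <= s <= T -> is_derive s 1 (fun s : R => ln (1 + s)) ((1 + s) `^ (-1)).
  move=> /andP[s0 _]; have s1 : 0 < 1 + s by rewrite ltr_pwDl.
  have d1 : is_derive s 1 (fun s : R => 1 + s) 1.
    by have := @is_deriveD R R^o R^o (cst 1) id s 1 0 1 _ _; rewrite add0r; apply.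
  have := @is_derive1_comp R (@ln R) (fun s => 1 + s) s _ _ (is_derive1_ln s1) d1.
  by rewrite mulr1 powR_inv1 ?(ltW s1).
have c s : 0 <= s <= T -> {for s, continuous (fun s : R => (1 + s) `^ (-1))}.
  by move=> /andP[s0 _]; exact: continuous_shift.
by rewrite (Rintegral_derivative T0 d c) addr0 ln1 subr0.
Qed.

Lemma Rintegral_shift_powR_le e T : 0 <= e -> 0 <= T ->
  \int[lam]_(s in `[0, T]) (1 + s) `^ (- e) <= T.
Proof.
move=> e0 T0; rewrite [leRHS](_ : T = 1 * (T - 0)); last by ring.
rewrite -(Rintegral_itv_cst 1 T0); apply: le_Rintegral => //.
- apply: (@integrable_itv_bounded _ _ 1).
    apply: (@measurableT_comp _ _ _ _ _ _ (@powR R ^~ (- e))) => //.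
    exact: measurable_funD.
  move=> s /andP[s0 _]; rewrite ger0_norm ?powR_ge0// powRN invf_le1 ?powR_gt0 ?ltr_pwDl//.
  by rewrite -[leLHS](powRr0 (1 + s)) ler_powR// lerDl.
- by apply: (@integrable_itv_bounded _ _ 1) => // s _; rewrite normr1.
- move=> s /=; rewrite in_itv/= => /andP[s0 _].
  rewrite powRN invf_le1 ?powR_gt0 ?ltr_pwDl//.
  by rewrite -[leLHS](powRr0 (1 + s)) ler_powR// lerDl.
Qed.

Lemma powR_solve_le (x t K th : R) : 0 < x -> 0 < t -> 0 < th -> 0 <= K ->
  x * t `^ th <= K -> t <= K `^ (th^-1) * x `^ (- th^-1).
Proof.
move=> x0 t0 th0 K0 h.
have : t `^ th <= K / x by rewrite ler_pdivlMr// mulrC.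
move=> h2; have : (t `^ th) `^ (th^-1) <= (K / x) `^ (th^-1).
  by rewrite ge0_ler_powR ?nnegrE ?powR_ge0 ?divr_ge0 ?invr_ge0 ?(ltW th0) ?(ltW x0).
rewrite -powRrM divff ?gt_eqF// powRr1 ?(ltW t0)// powRM ?invr_ge0 ?(ltW x0)//.
by rewrite -[x^-1](powR_inv1 (ltW x0)) -powRrM mulN1r.
Qed.

Lemma powR_small (X e : R) : 0 < X -> 0 < e -> exists2 r, 0 < r &
  forall x, 0 < x -> x < r -> x `^ e <= X.
Proof.
move=> X0 e0; exists (X `^ (e^-1)); first exact: powR_gt0.
move=> x x0 /ltW xr; rewrite -[leRHS]powRr1 ?(ltW X0)// -(@mulVf _ e) ?gt_eqF// powRrM.
by rewrite ge0_ler_powR ?nnegrE ?powR_ge0 ?(ltW e0) ?(ltW x0).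
Qed.

Lemma lee_real_lt (l : \bar R) (X : R) : (forall t : R, (t%:E < l)%E -> t <= X) -> (l <= X%:E)%E.
Proof.
move=> h; rewrite leNgt; apply/negP; case: l h => [r| |] h // Xl.
  have := h ((X + r) / 2); rewrite !lte_fin in Xl *; lra.
by have := h (X + 1) (ltry _); lra.
Qed.

End power_integrals.

(** * An integral inequality that forces blow-up *)

Section blow_up_inequality.
Context (R : realType).
Local Notation lam := (@lebesgue_measure R).
Implicit Types (f g h K : R -> R) (a b c t s x : R).

Lemma continuous_integrable_itv f a b : continuous f -> lam.-integrable `[a, b] (EFin \o f).
Proof.
move=> cf; apply: continuous_compact_integrable; first exact: segment_compact.
exact: continuous_subspaceT.
Qed.

Lemma is_derive_Rintegral f a x : continuous f -> a < x ->
  is_derive x 1 (fun t => \int[lam]_(s in `[a, t]) f s) (f x).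
Proof.
move=> cf ax.
have x1 : x < x + 1 by rewrite ltrDl.
have [d e] := continuous_FTC1_closed x1 (continuous_integrable_itv a (x + 1) cf) ax (cf x).
by apply: DeriveDef; [exact: d | rewrite -derive1E; exact: e].
Qed.

Lemma continuous_powR_pos f p : continuous f -> (forall x, 0 < f x) ->
  continuous (fun x => f x `^ p).
Proof.
move=> cf f0 x; apply: (continuous_comp (f := f) (g := fun y => y `^ p)); first exact: cf.
apply: differentiable_continuous; apply/derivable1_diffP.
by case: (is_derive1_powR p (f0 x)).
Qed.

(** The right-hand side [y] of the hypothesis satisfies [y <= K], hence
    [y^' >= c * g * y `^ p], so that [y `^ (1 - p) + c * (p - 1) * \int g] does not
    increase. It equals [A `^ (1 - p)] at time [t1], and it bounds its second term at
    time [t2]. *)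
Lemma blow_up_bound K g (A c p t1 t2 : R) : 1 < p -> 0 < A -> 0 < c -> t1 <= t2 ->
  continuous K -> continuous g -> (forall t, 0 <= g t) ->
  (forall t, t1 <= t <= t2 -> A + c * \int[lam]_(s in `[t1, t]) (g s * K s `^ p) <= K t) ->
  A `^ (p - 1) * (c * (p - 1) * \int[lam]_(s in `[t1, t2]) g s) <= 1.
Proof.
move=> p1 A0 c0 t12 cK cg g0 HK.
have p0 : 0 < p by exact: lt_trans p1.
have KA t : t1 <= t <= t2 -> A <= K t.
  move=> tt; apply: le_trans (HK t tt); rewrite lerDl mulr_ge0 ?(ltW c0)//.
  by apply: Rintegral_ge0 => s _; rewrite mulr_ge0 ?powR_ge0.
(* On [[t1, t2]] this is [K] itself, but it is positive everywhere; together with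
   primitives that start before [t1] it allows differentiation on both sides of every
   point of [[t1, t2]]. *)
pose L s := Num.max (K s) A.
have cL : continuous L by move=> x; apply: continuous_max; [exact: cK|exact: cst_continuous].
have L0 s : 0 < L s by rewrite lt_max A0 orbT.
have LK s : t1 <= s <= t2 -> L s = K s by move=> ss; rewrite /L max_l// KA.
pose h s := g s * L s `^ p.
have ch : continuous h.
  by move=> x; apply: cvgM; [exact: cg|exact: continuous_powR_pos].
have h0 s : 0 <= h s by rewrite mulr_ge0 ?powR_ge0.
pose a := t1 - 1; have at1 : a < t1 by rewrite gtrBl.
pose H t := \int[lam]_(s in `[a, t]) h s.
pose G t := \int[lam]_(s in `[a, t]) g s.
have split f t : continuous f -> t1 <= t ->
    \int[lam]_(s in `[t1, t]) f s = \int[lam]_(s in `[a, t]) f s - \int[lam]_(s in `[a, t1]) f s.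
  move=> cf tt; rewrite (Rintegral_itv_split (ltW at1) tt); last exact: continuous_integrable_itv.
  by rewrite addrC addKr.
pose y t := A + c * (H t - H t1).
have yK t : t1 <= t <= t2 -> A <= y t <= K t.
  move=> tt; have /andP[t1t tt2] := tt.
  rewrite /y /H -split//; apply/andP; split.
    by rewrite lerDl mulr_ge0 ?(ltW c0)//; apply: Rintegral_ge0 => s _.
  apply: le_trans (HK t tt).
  have -> : \int[lam]_(s in `[t1, t]) h s = \int[lam]_(s in `[t1, t]) (g s * K s `^ p).
    apply: eq_Rintegral => s; rewrite inE/= in_itv/= => /andP[s1 s2].
    by rewrite /h LK// s1 (le_trans s2).
  exact: lexx.
pose z t := y t `^ (1 - p) + (p - 1) * c * (G t - G t1).
have dz t : t1 <= t <= t2 -> is_derive t 1 z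
   ((1 - p) * y t `^ (1 - p - 1) * (c * h t) + (p - 1) * c * g t).
  move=> tt; have /andP[t1t tt2] := tt.
  have at' : a < t by exact: lt_le_trans t1t.
  have y0 : 0 < y t by have /andP[+ _] := yK t tt; exact: lt_le_trans.
  have dH := is_derive_Rintegral ch at'.
  have dG := is_derive_Rintegral cg at'.
  have dy : is_derive t 1 y (c * h t).
    have -> : c * h t = 0 + c *: (h t - 0) by rewrite add0r subr0.
    by apply: is_deriveD; apply: is_deriveZ; apply: is_deriveB.
  have -> : (p - 1) * c * g t = ((p - 1) * c) *: (g t - 0) by rewrite subr0.
  have dB : is_derive t 1 (fun t => G t - G t1) (g t - 0) by apply: is_deriveB.
  have dS := @is_deriveZ R R^o R^o _ ((p - 1) * c) t 1 _ dB.
  apply: is_deriveD dS.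
  have dp := is_derive1_powR (1 - p) y0.
  rewrite mulrC [_ * h t]mulrC.
  have := @is_derive1_comp R (fun u => u `^ (1 - p)) y t _ _ dp dy.
  by rewrite mulrC [h t * c]mulrC.
have zle : z t2 <= z t1.
  apply: (@ler0_derive1_nincr _ z t1 t2) => //.
  - by move=> t; rewrite in_itv/= => /andP[/ltW u1 /ltW u2]; case: (dz t); rewrite ?u1.
  - move=> t; rewrite in_itv/= => /andP[/ltW u1 /ltW u2].
    have tt : t1 <= t <= t2 by rewrite u1.
    have /andP[yA ykt] := yK t tt.
    have y0 : 0 < y t by exact: lt_le_trans yA.
    rewrite derive1E; case: (dz t tt) => _ ->.
    have e1 : y t `^ (1 - p - 1) * K t `^ p >= 1.
      have -> : 1 - p - 1 = - p by ring.
      rewrite powRN mulrC ler_pdivlMr ?powR_gt0// mul1r.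
      by rewrite ge0_ler_powR ?nnegrE ?(ltW p0) ?(ltW y0)// (le_trans (ltW y0)).
    rewrite /h LK//.
    have -> : (1 - p) * y t `^ (1 - p - 1) * (c * (g t * K t `^ p)) + (p - 1) * c * g t =
      - ((p - 1) * c * g t * (y t `^ (1 - p - 1) * K t `^ p - 1)) by ring.
    by rewrite oppr_le0 !mulr_ge0 ?subr_ge0 ?(ltW p1) ?(ltW c0).
  - apply: derivable_within_continuous => t; rewrite in_itv/= => tt.
    by case: (dz t tt).
have yt1 : y t1 = A by rewrite /y subrr mulr0 addr0.
move: zle; rewrite {2}/z yt1 subrr mulr0 addr0 /z => zle.
have : (p - 1) * c * (G t2 - G t1) <= A `^ (1 - p).
  by apply: le_trans zle; rewrite lerDr powR_ge0.
rewrite -split// => zl.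
rewrite [leRHS](_ : 1 = A `^ (p - 1) * A `^ (1 - p)); last first.
  rewrite -powRD; last by apply/implyP => _; rewrite gt_eqF.
  by rewrite (_ : p - 1 + (1 - p) = 0) ?powRr0//; ring.
by apply: ler_wpM2l; [exact: powR_ge0|rewrite [c * _]mulrC].
Qed.

End blow_up_inequality.

(** * The linear flow and the heat kernel along a moving centre *)

Section linear_lower_bound.
Context (R : realType) (n : nat).
Local Notation mu := (lebesgue_Rn R n).
Implicit Types (x y z xi : Rn R n) (s t r w : R).

Definition scale r x : Rn R n := [tuple (r * tnth x i : measurableTypeR R) | i < n].

Lemma tnth_scale r x i : tnth (scale r x) i = r * tnth x i.
Proof. by rewrite tnth_mktuple. Qed.

Lemma enorm_scale_sub r x y :
  enorm (sub_Rn (scale r x) y) ^+ 2 = r ^+ 2 * enorm x ^+ 2 - 2 * r * dot x y + enorm y ^+ 2.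
Proof.
rewrite !enorm_sqr /dot !mulr_sumr -sumrB -big_split/=; apply: eq_bigr => i _.
by rewrite tnth_sub_Rn tnth_scale; ring.
Qed.

Lemma expR_taylor_le w E : 1 <= E -> expR w <= E -> 0 <= expR w - 1 - w <= E * w ^+ 2.
Proof.
move=> E1 wE; have h1 := expR_ge1Dx w; have h2 := expR_ge1Dx (- w).
have E0 : 0 < expR w by exact: expR_gt0.
have eV : expR w * expR (- w) = 1 by rewrite -expRD subrr expR0.
have h3 : expR w - 1 <= w * expR w.
  by have := ler_wpM2l (ltW E0) h2; rewrite eV mulrDr mulr1 mulrN mulrC; lra.
apply/andP; split; first by lra.
have [w0|w0] := leP 0 w.
  have : w * (expR w - 1) <= w * (w * E).
    by apply: ler_wpM2l => //; apply: (le_trans h3); exact: ler_wpM2l.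
  by rewrite mulrA mulrC -expr2; nra.
have : 0 <= (- w) * (expR w - 1 - w) by rewrite mulr_ge0; lra.
have : 0 <= (E - 1) * w ^+ 2 by rewrite mulr_ge0 ?sqr_ge0// subr_ge0.
nra.
Qed.

(** Away from its centre, at distance of order the square root of [t], the kernel is a
    constant times the exponential of a linear form in [y] plus lower order terms; this
    is how the first moment becomes visible. *)
Lemma heat_kernel_off_center t xi y : 0 < t ->
  heat_kernel (2 * t) (sub_Rn (scale (Num.sqrt t) xi) y) =
  (8 * pi * t) `^ (- (n%:R / 2)) * expR (- (enorm xi ^+ 2 / 8)) *
    expR (dot xi y / (4 * Num.sqrt t) - enorm y ^+ 2 / (8 * t)).
Proof.
move=> t0; have st0 : 0 < Num.sqrt t by rewrite sqrtr_gt0.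
rewrite /heat_kernel -[RHS]mulrA -expRD enorm_scale_sub; congr (_ `^ _ * expR _).
  by ring.
have tE : t = Num.sqrt t ^+ 2 by rewrite sqr_sqrtr// ltW.
by rewrite [in LHS]tE [in RHS]tE !sqrtr_sqr !gtr0_norm//; field; rewrite gt_eqF.
Qed.

Section moment.
Variables (v0 : Rn R n -> R) (i : 'I_n).
Hypothesis iv0 : mu.-integrable setT (EFin \o v0).
Hypothesis ipsi : mu.-integrable setT (EFin \o (fun y => enorm y * `|v0 y|)).
Hypothesis v0_mean : \int[mu]_y v0 y = 0.
Let m := \int[mu]_y (tnth y i * v0 y).
Hypothesis m_neq0 : m != 0.

(** A single nonzero component of the first moment is enough to fix a direction along
    which the pairing with the moment is positive. *)
Definition moment_direction : Rn R n :=
  [tuple (if j == i then m else 0 : measurableTypeR R) | j < n].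
Local Notation xi := moment_direction.

Let dot_xi y : dot xi y = m * tnth y i.
Proof.
rewrite /dot (bigD1 i)//= big1 ?addr0 ?tnth_mktuple ?eqxx// => j ji.
by rewrite tnth_mktuple (negbTE ji) mul0r.
Qed.

Let mv0 : measurable_fun setT v0.
Proof. exact: (heatable_integrable iv0).1. Qed.

Let measurable_coord : measurable_fun setT (fun y : Rn R n => tnth y i : R).
Proof. exact: measurable_tnth. Qed.

Let measurable_norm : measurable_fun setT (fun y : Rn R n => enorm y).
Proof. by apply: measurable_enorm. Qed.

Let icoord : mu.-integrable setT (EFin \o (fun y => tnth y i * v0 y)).
Proof.
apply: le_integrable ipsi => //.
  by apply/measurable_EFinP; exact: measurable_funM.
move=> y _; rewrite /= lee_fin [leRHS]ger0_norm ?mulr_ge0 ?enorm_ge0// normrM.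
by apply: ler_wpM2r => //; exact: norm_coordinate_le.
Qed.

(** Up to the factor [C / Num.sqrt t], this bounds the remainder of the expansion of the
    kernel at first order. It is dominated by the integrable function [enorm y * `|v0 y|]
    and tends to zero pointwise, so its integral tends to zero although no second moment
    is available. *)
Let cutmom t y : R := enorm y * Num.min 1 (enorm y / Num.sqrt t) * `|v0 y|.

Let cutmom_ge0 t y : 0 <= cutmom t y.
Proof. by rewrite !mulr_ge0 ?enorm_ge0// le_min ler01 divr_ge0 ?enorm_ge0. Qed.

Let cutmom_le t y : cutmom t y <= enorm y * `|v0 y|.
Proof.
rewrite /cutmom; apply: ler_wpM2r => //; rewrite ler_piMr ?enorm_ge0//.
by rewrite ge_min lexx.
Qed.

Let measurable_cutmom t : measurable_fun setT (cutmom t).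
Proof.
apply: measurable_funM; last exact: measurableT_comp.
apply: measurable_funM => //; apply: measurable_minr => //.
exact: measurable_funM.
Qed.

Let icutmom t : mu.-integrable setT (EFin \o cutmom t).
Proof.
apply: le_integrable ipsi => //; first exact/measurable_EFinP.
move=> y _; rewrite /= lee_fin ger0_norm// ger0_norm//.
by rewrite mulr_ge0 ?enorm_ge0.
Qed.

Let cutmom_small (e : R) : 0 < e -> exists N : nat, \int[mu]_y cutmom (N.+1%:R ^+ 2) y <= e.
Proof.
move=> e0.
have hm k : measurable_fun setT (fun y => (cutmom (k.+1%:R ^+ 2) y)%:E).
  exact/measurable_EFinP.
have hcv : {ae mu, forall y, setT y ->
    (fun k => (cutmom (k.+1%:R ^+ 2) y)%:E) @ \oo --> (cst 0%E : Rn R n -> \bar R) y}.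
  apply: nearW => y _; apply/fine_cvgP; split; first exact: nearW.
  have hh : (fun k => enorm y ^+ 2 * `|v0 y| * harmonic k) @ \oo --> enorm y ^+ 2 * `|v0 y| * 0.
    by apply: cvgM; [exact: cvg_cst | exact: cvg_harmonic].
  rewrite mulr0 in hh.
  apply: (@squeeze_cvgr _ _ _ _ (cst 0) (fun k => enorm y ^+ 2 * `|v0 y| * harmonic k)) => //.
    apply: nearW => k /=; rewrite cutmom_ge0/= /cutmom sqrtr_sqr ger0_norm//.
    rewrite [leRHS](_ : _ = enorm y * (enorm y / k.+1%:R) * `|v0 y|); last by rewrite expr2; ring.
    apply: ler_wpM2r => //; apply: ler_wpM2l; first exact: enorm_ge0.
    by rewrite ge_min lexx orbT.
  exact: cvg_cst.
have hdom : {ae mu, forall y, forall k, setT y ->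
    (`|(cutmom (k.+1%:R ^+ 2) y)%:E| <= (enorm y * `|v0 y|)%:E)%E}.
  by apply: nearW => y k _; rewrite /= lee_fin ger0_norm.
(* Dominated convergence along the times that are squares of integers; cutmom decreases
   in time. *)
have [_ _ h] := dominated_convergence measurableT hm (measurable_cst _) hcv ipsi hdom.
move: h; rewrite integral0 => /fine_cvg /cvgrPdist_le /(_ _ e0) [N _ HN].
exists N; have := HN N (leqnn _); rewrite sub0r normrN /= => /(le_trans (ler_norm _)).
exact.
Qed.

(** Expand the exponential in [heat_kernel_off_center]. The constant term is killed by
    the vanishing mean, the linear one gives the square of the component [m] of the
    moment over [4 * Num.sqrt t], and the remainder is at most half of this for large
    times. *)
Lemma linear_lower_bound : exists t0 c : R, [/\ 1 <= t0, 0 < c & forall t, t0 <= t ->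
  c * t `^ (- (n.+1%:R / 2)) <=
  heat_semigroup (2 * t) v0 (scale (Num.sqrt t) moment_direction)].
Proof.
pose X := enorm xi; pose E := expR (X ^+ 2 / 8).
have X0 : 0 <= X by exact: enorm_ge0.
have E1 : 1 <= E by rewrite -[leLHS]expR0 ler_expR divr_ge0// sqr_ge0.
pose D := X / 4 + 1 / 8; have D0 : 0 <= D by rewrite /D; lra.
pose C := E * D ^+ 2 + 1 / 8 + (E + 1 + X / 4).
have ED : 0 <= E * D ^+ 2 by rewrite mulr_ge0 ?sqr_ge0// (le_trans _ E1).
have C0 : 0 < C by rewrite /C; lra.
have m20 : 0 < m ^+ 2 by rewrite exprn_even_gt0.
have [N HN] := cutmom_small (divr_gt0 (divr_gt0 m20 (ltr0Sn R 7)) C0).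
exists (N.+1%:R ^+ 2), ((8 * pi) `^ (- (n%:R / 2)) * expR (- (X ^+ 2 / 8)) * (m ^+ 2 / 8)); split.
- by rewrite exprn_ege1// ler1n.
- apply: mulr_gt0; last by rewrite divr_gt0.
  by apply: mulr_gt0; [apply: powR_gt0; rewrite mulr_gt0// pi_gt0 | exact: expR_gt0].
move=> t Nt.
have t0 : 0 < t by apply: lt_le_trans Nt; rewrite exprn_gt0// ltr0n.
pose s := Num.sqrt t; have s0 : 0 < s by rewrite sqrtr_gt0.
have s2 : s ^+ 2 = t by rewrite sqr_sqrtr// ltW.
pose l y := m / (4 * s) * tnth y i.
pose W y := l y - enorm y ^+ 2 / (8 * t).
pose A := (8 * pi * t) `^ (- (n%:R / 2)) * expR (- (X ^+ 2 / 8)).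
have A0 : 0 <= A by rewrite mulr_ge0 ?powR_ge0 ?expR_ge0.
(* Completing the square: the exponent is at most an eighth of the squared norm of the
   centre. *)
have WE y : expR (W y) <= E.
  rewrite ler_expR /W /l -subr_ge0.
  have := sqr_ge0 (enorm (sub_Rn (scale s xi) y)); rewrite enorm_scale_sub dot_xi -/X s2 => h.
  rewrite (_ : X ^+ 2 / 8 - _ = (t * X ^+ 2 - 2 * s * (m * tnth y i) + enorm y ^+ 2) / (8 * t)).
    by rewrite divr_ge0// mulr_ge0// ltW.
  by rewrite -s2; field; rewrite gt_eqF.
have mW : measurable_fun setT (fun y : Rn R n => expR (W y)).
  apply: measurableT_comp => //; apply: measurable_funB.
    exact: measurable_funM.
  by apply: measurable_funM => //; exact: measurable_enorm_sqr.
have iE : mu.-integrable setT (EFin \o (fun y => expR (W y) * v0 y)).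
  apply: (@le_integrable _ _ _ mu setT _ _ (EFin \o (fun y => E * v0 y))) => //.
  - by apply/measurable_EFinP; exact: measurable_funM.
  - move=> y _; rewrite /= lee_fin !normrM; apply: ler_wpM2r => //.
    by rewrite !ger0_norm ?expR_ge0.
  - exact: integrable_scale.
have il : mu.-integrable setT (EFin \o (fun y => m / (4 * s) * (tnth y i * v0 y))).
  exact: integrable_scale.
pose Rem y := expR (W y) * v0 y - v0 y - m / (4 * s) * (tnth y i * v0 y).
have iS : mu.-integrable setT (EFin \o (fun y => expR (W y) * v0 y - v0 y)).
  exact: (integrableB measurableT iE iv0).
have iR : mu.-integrable setT (EFin \o Rem).
  exact: (integrableB measurableT iS il).
have RemE : \int[mu]_y Rem y = \int[mu]_y (expR (W y) * v0 y) - m / (4 * s) * m.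
  rewrite /Rem RintegralB// RintegralB// v0_mean subr0; congr (_ - _).
  by rewrite RintegralZl.
have Rem_le y : `|Rem y| <= C / s * cutmom t y.
  rewrite /Rem (_ : _ - _ = (expR (W y) - 1 - l y) * v0 y); last by rewrite /l; ring.
  rewrite normrM /cutmom mulrA; apply: ler_wpM2r => //.
  pose Y := enorm y / s; have Y0 : 0 <= Y by rewrite divr_ge0 ?enorm_ge0// ltW.
  rewrite (_ : C / s * _ = C * (Y * Num.min 1 Y)); last by rewrite /Y -/s; ring.
  have lY : `|l y| <= X / 4 * Y.
    have := norm_dot_le xi y; rewrite dot_xi => h.
    rewrite (_ : l y = (m * tnth y i) * (4 * s)^-1); last by rewrite /l; ring.
    rewrite normrM [X in _ * X]ger0_norm ?invr_ge0 ?mulr_ge0 ?(ltW s0)//.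
    rewrite (_ : X / 4 * Y = X * enorm y * (4 * s)^-1).
      by apply: ler_wpM2r h; rewrite invr_ge0 mulr_ge0// ltW.
    by rewrite /Y; field; rewrite gt_eqF.
  have WY : W y = l y - Y ^+ 2 / 8.
    by rewrite /W /Y; congr (_ - _); rewrite -s2; field; rewrite gt_eqF.
  have E0 := expR_gt0 (W y); have WEy := WE y.
  (* Taylor expansion at second order where [enorm y] is at most [Num.sqrt t], the crude
     bounds on each term elsewhere. *)
  have [Y1|Y1] := leP Y 1.
    have /andP[e1 e2] := expR_taylor_le E1 (WE y).
    have WD : `|W y| <= D * Y.
      rewrite WY; apply: le_trans (ler_normB _ _) _.
      rewrite [X in _ + X]ger0_norm ?divr_ge0 ?sqr_ge0//.
      have : Y ^+ 2 <= Y by rewrite expr2 ler_piMl.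
      rewrite /D; lra.
    have W2 : W y ^+ 2 <= D ^+ 2 * Y ^+ 2.
      by rewrite -exprMn -real_normK ?num_real// ler_pXn2r ?nnegrE// mulr_ge0.
    have eW2 : E * W y ^+ 2 <= E * (D ^+ 2 * Y ^+ 2).
      by apply: ler_wpM2l => //; exact: le_trans E1.
    have Y2 : 0 <= Y ^+ 2 by exact: sqr_ge0.
    have P : 0 <= (E + 1 + X / 4) * Y ^+ 2 by rewrite mulr_ge0//; lra.
    rewrite -expr2 /C !mulrDl in P *.
    rewrite ler_norml; apply/andP; split; rewrite WY in e1 e2 eW2 *; lra.
  rewrite mulr1.
  have Q : 0 <= (E * D ^+ 2 + 1 / 8) * Y by rewrite mulr_ge0//; lra.
  have P : (E + 1) * 1 <= (E + 1) * Y by apply: ler_wpM2l; lra.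
  move: lY; rewrite ler_norml => /andP[l1 l2].
  by rewrite /C ler_norml; apply/andP; split; lra.
have Rint : `|\int[mu]_y Rem y| <= C / s * \int[mu]_y cutmom t y.
  apply: le_trans (le_normr_Rintegral measurableT iR) _.
  rewrite -RintegralZl//; apply: le_Rintegral => //.
  - exact: integrable_norm.
  - exact: integrable_scale.
have cutN : \int[mu]_y cutmom t y <= m ^+ 2 / 8 / C.
  apply: le_trans HN; apply: le_Rintegral => // y _.
  rewrite /cutmom; apply: ler_wpM2r => //; apply: ler_wpM2l; first exact: enorm_ge0.
  rewrite le_min !ge_min lexx/= -/s; apply/orP; right.
  apply: ler_wpM2l; first exact: enorm_ge0.
  by rewrite lef_pV2 ?posrE// ?ler_wsqrtr// sqrtr_gt0 exprn_gt0// ltr0n.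
have t20 : 0 < 2 * t by rewrite mulr_gt0.
rewrite heat_semigroupE//.
have -> : \int[mu]_y (heat_kernel (2 * t) (sub_Rn (scale (Num.sqrt t) xi) y) * v0 y) =
    A * \int[mu]_y (expR (W y) * v0 y).
  rewrite -RintegralZl//; apply: eq_Rintegral => y _.
  rewrite heat_kernel_off_center// mulrA; congr (_ * expR _ * _).
  by rewrite /W /l dot_xi; congr (_ - _); rewrite -/s; ring.
have key : m ^+ 2 / (8 * s) <= \int[mu]_y (expR (W y) * v0 y).
  have h1 : C / s * \int[mu]_y cutmom t y <= m ^+ 2 / (8 * s).
    apply: (@le_trans _ _ (C / s * (m ^+ 2 / 8 / C))).
      by apply: ler_wpM2l cutN; rewrite divr_ge0// ltW.
    by rewrite le_eqVlt; apply/orP; left; apply/eqP; field; rewrite !gt_eqF.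
  move: (le_trans Rint h1); rewrite RemE ler_norml => /andP[h2 _].
  move: h2; rewrite (_ : m / (4 * s) * m = m ^+ 2 / (8 * s) + m ^+ 2 / (8 * s)).
    by lra.
  by field; rewrite gt_eqF.
apply: (le_trans _ (ler_wpM2l A0 key)).
rewrite le_eqVlt; apply/orP; left; apply/eqP.
have -> : t `^ (- (n.+1%:R / 2)) = t `^ (- (n%:R / 2)) * s^-1.
  rewrite /s -powR12_sqrt ?(ltW t0)// -powRN -powRD.
    by congr (_ `^ _); rewrite -natr1; field.
  by apply/implyP => _; rewrite gt_eqF.
rewrite /A (powRM _ (x := 8 * pi)) ?(ltW t0)//; last by rewrite mulr_ge0// pi_ge0.
by field; rewrite gt_eqF.
Qed.

End moment.

(** As time goes from [s] to [t] the centre moves by [(Num.sqrt t - Num.sqrt s)] times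
    [xi]; the kernel at time [2 * t - s] is wide enough to dominate the one at time [s]
    around the old centre, up to a constant and the ratio of the normalizing factors. *)
Lemma heat_kernel_moving_center s t xi y : 0 < s -> s <= t ->
  2 `^ (- (n%:R / 2)) * expR (- (enorm xi ^+ 2 / 8)) * (s / t) `^ (n%:R / 2) *
    heat_kernel s (sub_Rn (scale (Num.sqrt s) xi) y) <=
  heat_kernel (2 * t - s) (sub_Rn (scale (Num.sqrt t) xi) y).
Proof.
move=> s0 st; have t0 : 0 < t by exact: lt_le_trans st.
pose a := Num.sqrt s; pose d := Num.sqrt t - a.
have a0 : 0 < a by rewrite sqrtr_gt0.
have d0 : 0 <= d by rewrite subr_ge0 ler_wsqrtr.
have sE : s = a ^+ 2 by rewrite sqr_sqrtr// ltW.
have tE : t = (a + d) ^+ 2 by rewrite /d addrC subrK sqr_sqrtr// ltW.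
have ts0 : 0 < 2 * t - s by lra.
(* Coordinate by coordinate, with [a] the square root of [s] and [a + d] that of [t], the
   difference of the two sides is a sum of squares with nonnegative coefficients. *)
have quad : s * enorm (sub_Rn (scale (Num.sqrt t) xi) y) ^+ 2 <=
  (2 * t - s) * enorm (sub_Rn (scale a xi) y) ^+ 2 + (2 * t - s) * s / 2 * enorm xi ^+ 2.
  rewrite !enorm_sqr !mulr_sumr -big_split/=; apply: ler_sum => i _.
  rewrite !tnth_sub_Rn !tnth_scale -subr_ge0.
  have -> : Num.sqrt t = a + d by rewrite /d addrC subrK.
  set x := tnth xi i; set w := tnth y i.
  rewrite sE tE (_ : _ - _ = 4 * a * d * (a * x - w) ^+ 2 + 2 * (a * a * a * d) * x ^+ 2 +
     (2 * d * (a * x - w) - a ^+ 2 * x) ^+ 2 / 2); last by field.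
  have a0' := ltW a0.
  apply: addr_ge0; last by rewrite divr_ge0// sqr_ge0.
  by apply: addr_ge0; (apply: mulr_ge0; last exact: sqr_ge0); rewrite !mulr_ge0.
rewrite /heat_kernel -/a.
set P := enorm _ ^+ 2 in quad *; set Q := enorm _ ^+ 2 in quad *; set X2 := enorm xi ^+ 2 in quad *.
have pis : 0 <= 4 * pi * s by rewrite !mulr_ge0 ?pi_ge0// ltW.
have -> : 2 `^ (- (n%:R / 2)) * expR (- (X2 / 8)) * (s / t) `^ (n%:R / 2) *
    ((4 * pi * s) `^ (- (n%:R / 2)) * expR (- (Q / (4 * s)))) =
  (4 * pi * (2 * t)) `^ (- (n%:R / 2)) * expR (- (X2 / 8) - Q / (4 * s)).
  have -> : (4 * pi * (2 * t)) `^ (- (n%:R / 2)) =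
     2 `^ (- (n%:R / 2)) * (s / t) `^ (n%:R / 2) * (4 * pi * s) `^ (- (n%:R / 2)).
    have -> : (s / t) `^ (n%:R / 2) = (t / s) `^ (- (n%:R / 2)).
      rewrite powRN; apply/esym/mulr1_eq.
      rewrite -powRM ?divr_ge0 ?(ltW s0) ?(ltW t0)// (_ : t / s * (s / t) = 1) ?powR1//.
      by field; rewrite !gt_eqF.
    rewrite -!powRM ?mulr_ge0 ?invr_ge0 ?pi_ge0 ?(ltW s0) ?(ltW t0)//.
    by congr (_ `^ _); field; rewrite gt_eqF.
  by rewrite expRD; ring.
apply: ler_pM; rewrite ?powR_ge0 ?expR_ge0//.
  rewrite !powRN lef_pV2 ?posrE ?powR_gt0 ?mulr_gt0 ?pi_gt0//.
  rewrite ge0_ler_powR ?nnegrE ?divr_ge0 ?mulr_ge0 ?pi_ge0 ?(ltW t0) ?(ltW ts0)//.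
  by apply: ler_wpM2l; [rewrite mulr_ge0// pi_ge0 | lra].
rewrite ler_expR -opprD lerN2 ler_pdivrMr ?mulr_gt0//.
rewrite -(ler_pM2l s0); apply: (le_trans quad).
by rewrite le_eqVlt; apply/orP; left; apply/eqP; field; rewrite gt_eqF.
Qed.

End linear_lower_bound.

(** * The mass created by the source *)

Section solution_source.
Context (R : realType) (n : nat).
Local Notation mu := (lebesgue_Rn R n).
Local Notation lam := (@lebesgue_measure R).
Implicit Types (x y z : Rn R n) (s t r tau : R).
Variables (v0 u0 : Rn R n -> R) (xi : Rn R n) (p t0 c0 : R).
Hypothesis p1 : 1 < p.
Hypothesis iv0 : mu.-integrable setT (EFin \o v0).
Hypothesis mu0 : measurable_fun setT u0.
Hypothesis vu : {ae mu, forall y, v0 y = u0 y}.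
Hypothesis t0_ge1 : 1 <= t0.
Hypothesis c0_gt0 : 0 < c0.
Hypothesis lin : forall t, t0 <= t ->
  c0 * t `^ (- (n.+1%:R / 2)) <= heat_semigroup (2 * t) v0 (scale (Num.sqrt t) xi).

Let p0 : 0 < p. Proof. exact: lt_trans p1. Qed.

Definition moving_constant : R := 2 `^ (- (n%:R / 2)) * expR (- (enorm xi ^+ 2 / 8)).
Local Notation kappa := moving_constant.

Lemma moving_constant_gt0 : 0 < kappa.
Proof. by rewrite mulr_gt0 ?powR_gt0 ?expR_gt0. Qed.

Lemma measurable_scale_sqrt :
  measurable_fun [set: measurableTypeR R] (fun s => scale (Num.sqrt s) xi).
Proof.
apply/measurable_fun_tnthP => i.
rewrite (_ : _ \o _ = (fun s => Num.sqrt s * tnth xi i)); last first.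
  by apply/funext => s /=; rewrite tnth_scale.
apply: measurable_funM => //.
apply: nondecreasing_measurable => // s r; exact: ler_wsqrtr.
Qed.

Lemma heat_semigroup_moving_center s tau (f : Rn R n -> R) :
  0 < s -> s <= tau -> heatable f -> (forall y, 0 <= f y) ->
  kappa * tau `^ (- (n%:R / 2)) *
    (s `^ (n%:R / 2) * heat_semigroup s f (scale (Num.sqrt s) xi)) <=
  heat_semigroup (2 * tau - s) f (scale (Num.sqrt tau) xi).
Proof.
move=> s0 st [mf hf] f0; have tau0 : 0 < tau by exact: lt_le_trans st.
have ts0 : 0 < 2 * tau - s by lra.
rewrite !heat_semigroupE// -!RintegralZl//; last 2 first.
  by apply: integrable_scale => //; exact: hf.
  exact: hf.
apply: le_Rintegral => //.
- by do 2 (apply: integrable_scale => //); exact: hf.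
- exact: hf.
- move=> y _; have := heat_kernel_moving_center xi y s0 st.
  move: (heat_kernel s _) (heat_kernel (2 * tau - s) _) => K1 K2 hK.
  rewrite !mulrA; apply: ler_wpM2r => //; apply: le_trans hK.
  rewrite le_eqVlt; apply/orP; left; apply/eqP; rewrite /moving_constant.
  rewrite (powRM _ (ltW s0)) ?invr_ge0 ?(ltW tau0)// -[tau^-1]powR_inv1 ?(ltW tau0)//.
  by rewrite -powRrM mulN1r; ring.
Qed.

(** Jensen for the probability density given by the heat kernel: integrate the tangent of
    the power at [l], which is below the power. *)
Lemma heat_semigroup_jensen t x (f w : Rn R n -> R) (l : R) : 0 <= t -> heatable f -> heatable w ->
  (forall y, `|f y| `^ p <= w y) -> 0 <= l -> l <= heat_semigroup t f x ->
  l `^ p <= heat_semigroup t w x.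
Proof.
move=> tt hf hw fw l0 lf.
have hc c : heatable (fun _ : Rn R n => c : R).
  by apply: (@heatable_bounded _ _ _ `|c|).
pose q := p * l `^ (p - 1).
have q0 : 0 <= q by rewrite mulr_ge0 ?powR_ge0// ltW.
have step : heat_semigroup t (fun y => (l `^ p - q * l) + q * f y) x <= heat_semigroup t w x.
  apply: le_heat_semigroup => //; first by apply: heatableD => //; exact: heatableZ.
  move=> y; apply: le_trans (fw y).
  have := powR_tangent p1 (normr_ge0 (f y)) l0; apply: le_trans.
  rewrite -/q mulrBr -addrA lerD2l addrC lerD2r.
  by apply: ler_wpM2l => //; exact: ler_norm.
apply: le_trans step; rewrite heat_semigroupD//; last exact: heatableZ.
rewrite heat_semigroup_cst// heat_semigroupZ// -addrA lerDl addrC subr_ge0.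
exact: ler_wpM2l.
Qed.

(** Here [k s] is, up to a constant, the mass which the source creates per unit time near
    the moving centre: [s `^ (n%:R / 2)] times the average of [`|u s| `^ p] against the
    kernel at time [s] centred at [scale (Num.sqrt s) xi]. Flowing the solution from
    [tau] to heat time [2 * tau] bounds its average at the centre from below by the
    linear part plus the contributions of all the earlier sources, transported by
    [heat_semigroup_moving_center]; Jensen turns this average into a bound for
    [k tau]. *)
Lemma source_inequality eps (T : \bar R) (T' : R) u : 0 < eps ->
  bounded_mild_solution p eps u0 T u -> (T'%:E < T)%E ->
  exists k : R -> R, [/\ measurable_fun [set: measurableTypeR R] k,
    (exists M : R, forall s, `|k s| <= M), (forall s, 0 <= k s) &
    forall tau, t0 <= tau <= T' ->
    tau `^ (- (n%:R * (p - 1) / 2)) *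
      (c0 * eps * tau `^ (- (1 / 2)) + kappa * \int[lam]_(s in `[t0, tau]) k s) `^ p <= k tau].
Proof.
move=> e0 [mu_ bu_ du_] T'T.
have [M HM] := bu_ T' T'T.
(* Cut off in time, the solution becomes a bounded function on all of space-time. *)
pose ut t x := if (0 <= t) && (t <= T') then u t x else 0.
have mut : jointly_measurable ut.
  pose S := [set z : measurableTypeR R * Rn R n | 0 <= (z.1 : R) <= T'].
  have mS : measurable S.
    rewrite (_ : S = fst @^-1` `[0, T']); last by apply/seteqP; split=> z /=; rewrite in_itv.
    by rewrite -[X in measurable X]setTI; apply: measurable_fst.
  have mD : measurable (fst @^-1` [set s : R | 0 <= s /\ (s%:E < T)%E] :
      set (measurableTypeR R * Rn R n)).
    rewrite -[X in measurable X]setTI; apply: measurable_fst => //.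
    apply: is_interval_measurable => a b [a0 aT] [b0 bT] c /andP[ac cb]; split.
      exact: le_trans ac.
    by apply: le_lt_trans bT; rewrite lee_fin.
  have mS' : measurable_fun S (fun q : measurableTypeR R * Rn R n => u q.1 q.2).
    apply: (measurable_funS mD _ mu_) => q /= /andP[q0 qT]; split => //.
    by apply: le_lt_trans T'T; rewrite lee_fin.
  rewrite /jointly_measurable.
  rewrite (_ : (fun q : measurableTypeR R * Rn R n => ut q.1 q.2) =
    (fun q : measurableTypeR R * Rn R n => u q.1 q.2) \_ S).
    exact/(measurable_restrictT _ _).1.
  by apply/funext => q; rewrite patchE /ut mem_setE.
have utM t x : `|ut t x| <= `|M|.
  rewrite /ut; case: ifPn => [tT|_]; last by rewrite normr0.
  by apply: le_trans (ler_norm _); exact: HM.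
pose w s y := `|ut s y| `^ p.
have w0 s y : 0 <= w s y by exact: powR_ge0.
have bw : bounded_spacetime w (`|M| `^ p).
  split.
    apply: (@measurableT_comp _ _ _ _ _ _ (@powR R ^~ p)) => //.
    exact: measurableT_comp.
  by move=> s y; rewrite ger0_norm// ge0_ler_powR ?nnegrE// ltW.
have hw s := bounded_spacetime_heatable s bw.
have hv0 := heatable_integrable iv0.
have eu tau x : 0 < tau -> tau <= T' -> heat_semigroup tau (ut tau) x =
    eps * heat_semigroup (2 * tau) v0 x +
    \int[lam]_(s in `[0, tau]) heat_semigroup (2 * tau - s) (w s) x.
  move=> tau0 tauT.
  have tau0' := ltW tau0.
  have mt := jointly_measurable_section tau mut.
  have hHv := heat_semigroup_heatable_signed tau0' hv0.
  have hdw := heatable_duhamel tau0' bw w0.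
  have ae : {ae mu, forall x, ut tau x = eps * heat_semigroup tau v0 x + duhamel w tau x}.
    have tT : (tau%:E < T)%E by apply: le_lt_trans T'T; rewrite lee_fin.
    apply: filterS (du_ tau tau0' tT) => z hz.
    have -> : ut tau z = u tau z by rewrite /ut tau0' tauT.
    have hH := heat_semigroup_ae z tau0 hv0.1 mu0 vu.
    apply: (etrans hz); apply: f_equal2; first by rewrite hH.
    apply: eq_Rintegral => s; rewrite inE/= in_itv/= => /andP[s0 st].
    congr (heat_semigroup _ _ _); apply/funext => y.
    by rewrite /w /ut s0 (le_trans st).
  have mrhs : measurable_fun setT (fun x => eps * heat_semigroup tau v0 x + duhamel w tau x).
    by apply: measurable_funD; [apply: measurable_funM => //; exact: hHv.1|exact: hdw.1].
  rewrite (heat_semigroup_ae x tau0 mt mrhs ae) heat_semigroupD//; last exact: heatableZ.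
  rewrite heat_semigroupZ// heat_semigroup_add_signed//.
  rewrite (heat_semigroup_duhamel x tau0 tau0' bw w0).
  by rewrite (_ : tau + tau = 2 * tau)//; ring.
pose k s := if (t0 <= s) && (s <= T')
  then s `^ (n%:R / 2) * heat_semigroup s (w s) (scale (Num.sqrt s) xi) else 0.
have t00 : 0 < t0 by exact: lt_le_trans t0_ge1.
have k0 s : 0 <= k s.
  by rewrite /k; case: ifP => // _; rewrite mulr_ge0 ?powR_ge0 ?heat_semigroup_ge0.
have mk : measurable_fun [set: measurableTypeR R] k.
  apply: measurable_fun_ifT => //.
    by apply: measurable_and; exact: measurable_fun_ler.
  apply: measurable_funM => //.
  apply: measurable_heat_semigroup => //; first exact: measurable_scale_sqrt.
  exact: bw.1.
have kM s : `|k s| <= `|T'| `^ (n%:R / 2) * `|M| `^ p.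
  rewrite ger0_norm// /k; case: ifPn => [/andP[s0 sT]|_]; last by rewrite mulr_ge0 ?powR_ge0.
  have ss : 0 <= s by rewrite (le_trans _ s0)// ltW.
  apply: ler_pM; rewrite ?powR_ge0 ?heat_semigroup_ge0//.
    rewrite ge0_ler_powR ?nnegrE ?divr_ge0//.
    by apply: (le_trans sT); exact: ler_norm.
  apply: le_trans (ler_norm _) _; apply: norm_heat_semigroup_bound => //.
    exact: (hw s).1.
  exact: bw.2.
exists k; split => //; first by exists (`|T'| `^ (n%:R / 2) * `|M| `^ p).
move=> tau /andP[t0t tT].
have tau0 : 0 < tau by exact: lt_le_trans t0t.
pose x0 := scale (Num.sqrt tau) xi.
pose lam_ := tau `^ (- (n%:R / 2)) *
  (c0 * eps * tau `^ (- (1 / 2)) + kappa * \int[lam]_(s in `[t0, tau]) k s).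
have I0 : 0 <= \int[lam]_(s in `[t0, tau]) k s by apply: Rintegral_ge0 => s _.
have B0 : 0 <= c0 * eps * tau `^ (- (1 / 2)) + kappa * \int[lam]_(s in `[t0, tau]) k s.
  apply: addr_ge0; first by rewrite !mulr_ge0 ?powR_ge0// ltW.
  by rewrite mulr_ge0// ltW// moving_constant_gt0.
have l0 : 0 <= lam_ by rewrite mulr_ge0 ?powR_ge0.
have ik : lam.-integrable `[t0, tau] (EFin \o k).
  exact: (@integrable_itv_bounded _ _ (`|T'| `^ (n%:R / 2) * `|M| `^ p)).
have lF : lam_ <= heat_semigroup tau (ut tau) x0.
  rewrite eu// /lam_ mulrDr; apply: lerD.
    rewrite (_ : _ * (c0 * eps * _) = eps * (c0 * tau `^ (- (n.+1%:R / 2)))); last first.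
      rewrite (_ : - (n.+1%:R / 2) = - (n%:R / 2) + - (1 / 2) :> R); last by rewrite -natr1; field.
      rewrite powRD; first by ring.
      by apply/implyP => _; rewrite gt_eqF.
    by apply: ler_wpM2l; [exact: ltW | exact: lin].
  have ifull : lam.-integrable `[0, tau] (EFin \o (fun s => heat_semigroup (2 * tau - s) (w s) x0)).
    by apply: integrable_duhamel bw _; lra.
  rewrite (Rintegral_itv_split (ltW t00) t0t ifull).
  rewrite -[leLHS]add0r; apply: lerD.
    by apply: Rintegral_ge0 => s _; exact: heat_semigroup_ge0.
  rewrite mulrA [_ * kappa]mulrC -RintegralZl//; apply: le_Rintegral => //.
  - exact: integrable_scale.
  - by apply: integrable_duhamel bw _; lra.
  - move=> s /=; rewrite in_itv/= => /andP[s0 st].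
    rewrite /k s0 (le_trans st tT)/=; apply: heat_semigroup_moving_center => //.
    exact: lt_le_trans s0.
have J := heat_semigroup_jensen (ltW tau0)
  (heatable_bounded (jointly_measurable_section tau mut) (utM tau)) (hw tau) (fun y => lexx _) l0 lF.
rewrite {2}/k t0t tT/= -/x0.
apply: (@le_trans _ _ (tau `^ (n%:R / 2) * lam_ `^ p)); last first.
  by apply: ler_wpM2l => //; exact: powR_ge0.
rewrite /lam_ powRM ?powR_ge0// mulrA -powRrM -powRD; last first.
  by apply/implyP => _; rewrite gt_eqF.
by rewrite le_eqVlt; apply/orP; left; apply/eqP; congr (_ `^ _ * _); field.
Qed.

End solution_source.

(** * Upper bound for the lifespan *)

Section primitive.
Context (R : realType).
Local Notation lam := (@lebesgue_measure R).

Lemma continuous_primitive (k : R -> R) (a M : R) : measurable_fun [set: measurableTypeR R] k ->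
  (forall s, `|k s| <= M) -> continuous (fun t => \int[lam]_(s in `[a, t]) k s).
Proof.
move=> mk kM; pose K t := \int[lam]_(s in `[a, t]) k s.
have M0 : 0 <= M by apply: le_trans (kM 0).
have ik x y : lam.-integrable `[x, y] (EFin \o k) by exact: (@integrable_itv_bounded _ _ M).
have bound x y : x <= y -> `|\int[lam]_(s in `[x, y]) k s| <= M * (y - x).
  move=> xy; apply: le_trans (le_normr_Rintegral _ (ik x y)) _ => //.
  rewrite -(Rintegral_itv_cst M xy); apply: le_Rintegral => //.
  - exact: integrable_norm.
  - by apply: (@integrable_itv_bounded _ _ `|M|).
have K0 t : t < a -> K t = 0.
  by move=> ta; rewrite /K set_itv_ge ?Rintegral_set0// bnd_simp -ltNge.
have lip x y : `|K x - K y| <= M * `|x - y|.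
  wlog xy : x y / x <= y.
    move=> wl; have [xy|/ltW yx] := leP x y; first exact: wl.
    by rewrite distrC (distrC x); exact: wl.
  rewrite distrC (distrC x) [in leRHS]ger0_norm ?subr_ge0//.
  have [ax|xa] := leP a x.
    by rewrite /K (Rintegral_itv_split ax xy)// addrC addKr bound.
  rewrite (K0 x xa) subr0; have [ay|ya] := leP a y.
    by apply: le_trans (bound _ _ ay) _; rewrite ler_wpM2l// lerD2l lerN2 ltW.
  by rewrite K0// normr0 mulr_ge0// subr_ge0.
move=> x; apply/cvgrPdist_le => e e0.
have M1 : 0 < M + 1 by rewrite ltr_wpDl.
near=> y; apply: le_trans (lip x y) _.
have : `|x - y| <= e / (M + 1).
  by near: y; apply: cvgr_dist_le; [exact: cvg_id | rewrite divr_gt0].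
rewrite ler_pdivlMr// => h; apply: le_trans h; rewrite mulrC ler_wpM2l// lerDl//.
Unshelve. all: by end_near. Qed.

End primitive.

Section upper_bound.
Context (R : realType) (n : nat).
Local Notation mu := (lebesgue_Rn R n).
Local Notation lam := (@lebesgue_measure R).
Implicit Types (x y z : Rn R n) (s t r tau : R).
Variables (v0 u0 : Rn R n -> R) (p : R) (i : 'I_n).
Hypothesis p1 : 1 < p.
Hypothesis iv0 : mu.-integrable setT (EFin \o v0).
Hypothesis ipsi : mu.-integrable setT (EFin \o (fun y => enorm y * `|v0 y|)).
Hypothesis v0_mean : \int[mu]_y v0 y = 0.
Hypothesis m_neq0 : \int[mu]_y (tnth y i * v0 y) != 0.
Hypothesis mu0 : measurable_fun setT u0.
Hypothesis vu : {ae mu, forall y, v0 y = u0 y}.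

(** From [t0] to [t1] only the linear part of [source_inequality] is kept: it creates a
    mass of order [eps `^ p] times the first integral. From [t1] on only the mass itself
    is kept, which gives the hypothesis of [blow_up_bound]. *)
Lemma mild_solution_bound : exists t0 C : R, [/\ 1 <= t0, 0 < C &
  forall eps T u t1 t2, 0 < eps -> bounded_mild_solution p eps u0 T u ->
  t0 < t1 -> t1 <= t2 -> (t2%:E < T)%E ->
  (eps `^ p * \int[lam]_(s in `[t0, t1]) s `^ (- (p / 2 + n%:R * (p - 1) / 2))) `^ (p - 1) *
    \int[lam]_(s in `[t1, t2]) s `^ (- (n%:R * (p - 1) / 2)) <= C].
Proof.
have p0 : 0 < p by exact: lt_trans p1.
have q0 : 0 < p - 1 by rewrite subr_gt0.
have [t0 [c0 [t0_ge1 c0_gt0 lin]]] := linear_lower_bound iv0 ipsi v0_mean m_neq0.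
set xi := moment_direction v0 i in lin.
pose kap := moving_constant xi; have kap0 : 0 < kap by exact: moving_constant_gt0.
pose a := n%:R * (p - 1) / 2; pose b := p / 2 + n%:R * (p - 1) / 2.
have a0 : 0 <= a by rewrite divr_ge0// mulr_ge0// ltW.
have b0 : 0 <= b by rewrite addr_ge0// divr_ge0// ltW.
have cp0 : 0 < c0 `^ p by rewrite powR_gt0.
exists t0, ((c0 `^ p) `^ (p - 1) * (kap `^ p * (p - 1)))^-1; split => //.
  by rewrite invr_gt0 !mulr_gt0// powR_gt0.
move=> eps T u t1 t2 e0 su t01 t12 t2T.
have [k [mk [M kM] k0 Hk]] := source_inequality p1 iv0 mu0 vu t0_ge1 c0_gt0 lin e0 su t2T.
have t00 : 0 < t0 by exact: lt_le_trans t0_ge1.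
pose K t := \int[lam]_(s in `[t0, t]) k s.
have cK : continuous K by exact: (continuous_primitive mk kM).
have K0 t : 0 <= K t by apply: Rintegral_ge0 => s _.
have ik r1 r2 : lam.-integrable `[r1, r2] (EFin \o k) by exact: (@integrable_itv_bounded _ _ M).
pose I := \int[lam]_(s in `[t0, t1]) s `^ (- b).
pose J := \int[lam]_(s in `[t1, t2]) s `^ (- a).
have I0 : 0 < I.
  apply: (@lt_le_trans _ _ (t1 `^ (- b) * (t1 - t0))).
    by rewrite mulr_gt0 ?powR_gt0 ?subr_gt0// (lt_trans _ t01).
  rewrite -(Rintegral_itv_cst _ (ltW t01)); apply: le_Rintegral => //.
  - by apply: (@integrable_itv_bounded _ _ `|t1 `^ (- b)|).
  - exact: integrable_powRN.
  - move=> s /=; rewrite in_itv/= => /andP[s0 s1].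
    have ss : 0 < s by exact: lt_le_trans s0.
    rewrite !powRN lef_pV2 ?posrE ?powR_gt0 ?(lt_le_trans ss)//.
    by rewrite ge0_ler_powR ?nnegrE ?(ltW ss)// (le_trans (ltW ss)).
pose A := (c0 * eps) `^ p * I.
have A0 : 0 < A by rewrite mulr_gt0// powR_gt0// mulr_gt0.
(* This is the power of [s] on the range of interest, made continuous and positive
   everywhere. *)
pose g s : R := Num.max s t0 `^ (- a).
have g0 s : 0 <= g s by exact: powR_ge0.
have cg : continuous g.
  apply: (@continuous_powR_pos _ (fun s => Num.max s t0)).
    by move=> x; apply: continuous_max; [exact: cvg_id | exact: cvg_cst].
  by move=> x; rewrite lt_max t00 orbT.
have gE s : t0 <= s -> g s = s `^ (- a) by move=> s0; rewrite /g max_l.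
have HK t : t1 <= t <= t2 -> A + kap `^ p * \int[lam]_(s in `[t1, t]) (g s * K s `^ p) <= K t.
  move=> /andP[t1t tt2].
  have KM s : s <= t2 -> K s <= `|M * (t2 - t0)|.
    move=> st; have [ts|st0] := leP t0 s; last first.
      by rewrite /K set_itv_ge ?Rintegral_set0// bnd_simp -ltNge.
    apply: (@le_trans _ _ (M * (s - t0))).
      rewrite -(Rintegral_itv_cst M ts); apply: le_Rintegral => //.
        by apply: (@integrable_itv_bounded _ _ `|M|).
      by move=> r _; apply: le_trans (ler_norm _) _.
    apply: le_trans (ler_norm _).
    by apply: ler_wpM2l; [exact: le_trans (kM 0) | rewrite lerD2r].
  rewrite {2}/K (Rintegral_itv_split (ltW t01) t1t)//; apply: lerD.
    rewrite /A /I -RintegralZl//; last exact: integrable_powRN.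
    apply: le_Rintegral => //.
      by apply: integrable_scale => //; exact: integrable_powRN.
    move=> s /=; rewrite in_itv/= => /andP[s0 s1].
    have ss : 0 < s by exact: lt_le_trans s0.
    apply: le_trans (Hk s _); last by rewrite s0 (le_trans s1)// (le_trans t1t).
    rewrite -/a (_ : - b = - a + - (1 / 2) * p); last by rewrite /b /a; field.
    rewrite powRD; last by apply/implyP => _; rewrite gt_eqF.
    rewrite powRrM mulrCA; apply: ler_wpM2l; first exact: powR_ge0.
    rewrite -powRM ?powR_ge0//; last by rewrite mulr_ge0// ltW.
    have u0_ : 0 <= c0 * eps * s `^ (- (1 / 2)) by rewrite !mulr_ge0 ?powR_ge0// ltW.
    have u1_ : 0 <= kap * K s by rewrite mulr_ge0// ltW.
    by rewrite ge0_ler_powR ?nnegrE ?(ltW p0) ?addr_ge0// lerDl.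
  have iK : lam.-integrable `[t1, t] (EFin \o (fun s => g s * K s `^ p)).
    apply: (@integrable_itv_bounded _ _ (1 * `|M * (t2 - t0)| `^ p)).
      apply: measurable_funM; first exact: continuous_measurable_fun.
      apply: (@measurableT_comp _ _ _ _ _ _ (@powR R ^~ p)) => //.
      exact: continuous_measurable_fun.
    move=> s /andP[s1 s2]; rewrite ger0_norm ?mulr_ge0 ?powR_ge0//.
    have ts : t0 <= s by rewrite (le_trans (ltW t01)).
    have ss : 1 <= s by exact: le_trans ts.
    apply: ler_pM; rewrite ?powR_ge0//.
      rewrite gE// powRN invf_le1 ?powR_gt0 ?(lt_le_trans _ ss)//.
      by rewrite -[leLHS](powRr0 s) ler_powR.
    rewrite ge0_ler_powR ?nnegrE ?(ltW p0) ?K0//.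
    by apply: KM; exact: le_trans tt2.
  rewrite -RintegralZl//; apply: le_Rintegral => //.
    exact: integrable_scale.
  move=> s /=; rewrite in_itv/= => /andP[s1 s2].
  have ts : t0 <= s by rewrite (le_trans (ltW t01)).
  apply: le_trans (Hk s _); last by rewrite ts (le_trans s2).
  rewrite gE// -/a mulrCA; apply: ler_wpM2l; first exact: powR_ge0.
  rewrite -powRM ?K0 ?(ltW kap0)//.
  have u0_ : 0 <= c0 * eps * s `^ (- (1 / 2)) by rewrite !mulr_ge0 ?powR_ge0// ltW.
  have u1_ : 0 <= kap * K s by rewrite mulr_ge0// ltW.
  by rewrite ge0_ler_powR ?nnegrE ?(ltW p0) ?addr_ge0// lerDr.
have := blow_up_bound p1 A0 (powR_gt0 p kap0) t12 cK cg g0 HK.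
have -> : \int[lam]_(s in `[t1, t2]) g s = J.
  apply: eq_Rintegral => s; rewrite inE/= in_itv/= => /andP[s1 _].
  by apply: gE; rewrite (le_trans (ltW t01)).
have -> : A `^ (p - 1) = (c0 `^ p) `^ (p - 1) * (eps `^ p * I) `^ (p - 1).
  rewrite /A (powRM p (ltW c0_gt0) (ltW e0)) -mulrA powRM ?powR_ge0//.
  by rewrite mulr_ge0 ?powR_ge0// ltW.
rewrite -/a -/b -/I -/J => h.
rewrite -[leRHS]mul1r ler_pdivlMr; last by rewrite !mulr_gt0 ?powR_gt0.
by apply: le_trans h; rewrite le_eqVlt; apply/orP; left; apply/eqP; ring.
Qed.

End upper_bound.

(** * From the two integral conditions to the rates *)

Section asymptotics.
Context (R : realType) (p a b : R) (life : R -> \bar R).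
Local Notation lam := (@lebesgue_measure R).
Implicit Types (eps t T I J : R).
Local Notation q := (p - 1).
Hypothesis p1 : 1 < p.
Hypothesis a0 : 0 < a.
Hypothesis b0 : 0 < b.
(** Inverting the two integral conditions is a question about powers and logarithms only,
    so the lifespan is an arbitrary function here. It is the lifespan of the initial
    datum that satisfies [lower] by [lifespan_ge] and [upper] by
    [mild_solution_bound]. *)
Hypothesis lower : exists delta : R, 0 < delta /\
  forall eps T I J : R, 0 < eps -> 0 < T -> 0 < I -> 0 < J ->
  \int[lam]_(s in `[0, T]) (1 + s) `^ (- b) <= I ->
  \int[lam]_(s in `[0, T]) (1 + s) `^ (- a) <= J ->
  (eps `^ p * I) `^ q * J <= delta -> (T%:E <= life eps)%E.
Hypothesis upper : exists t0 C : R, [/\ 1 <= t0, 0 < C &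
  forall eps t1 t2, 0 < eps -> t0 < t1 -> t1 <= t2 -> (t2%:E < life eps)%E ->
  (eps `^ p * \int[lam]_(s in `[t0, t1]) s `^ (- b)) `^ q *
    \int[lam]_(s in `[t1, t2]) s `^ (- a) <= C].

Let q0 : 0 < q. Proof. by rewrite subr_gt0. Qed.
Let p0 : 0 < p. Proof. exact: lt_trans p1. Qed.

Definition lower_rate (r : R -> R) := exists e1 c : R, [/\ 0 < e1 <= 1, 0 < c &
  forall eps, 0 < eps < e1 -> ((c * r eps)%:E <= life eps)%E].

Definition upper_rate (r : R -> R) := exists e1 C : R, [/\ 0 < e1 <= 1, 0 < C &
  forall eps, 0 < eps < e1 -> (life eps <= (C * r eps)%:E)%E].

Lemma one_le_life : exists e1 : R, [/\ 0 < e1 <= 1 &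
  forall eps T, 0 < eps < e1 -> 0 < T <= 1 -> (T%:E <= life eps)%E].
Proof.
have [d [d0 H]] := lower.
have pq0 : 0 < p * q by rewrite mulr_gt0.
have [r r0 Hr] := powR_small d0 pq0.
exists (Num.min r 1); split; first by rewrite lt_min r0 ltr01 ge_min lexx orbT.
move=> eps T /andP[e0]; rewrite lt_min => /andP[er _] /andP[T0 T1].
apply: (H eps T 1 1) => //.
- by apply: le_trans T1; apply: Rintegral_shift_powR_le => //; exact: ltW.
- by apply: le_trans T1; apply: Rintegral_shift_powR_le => //; exact: ltW.
- by rewrite !mulr1 -powRrM; exact: Hr.
Qed.

(** The estimates of the integrals by powers of [T] hold for [T >= 1]; for shorter times
    both integrals are at most one, and every small [eps] will do. *)
Lemma lower_rate_of (r : R -> R) :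
  (forall eps, 0 < eps < 1 -> 0 < r eps) ->
  (exists e1 c : R, [/\ 0 < e1 <= 1, 0 < c & forall eps, 0 < eps < e1 -> 1 <= c * r eps ->
    ((c * r eps)%:E <= life eps)%E]) -> lower_rate r.
Proof.
move=> r0 [e1 [c [/andP[e10 e11] c0 H]]].
have [e2 [/andP[e20 e21] H2]] := one_le_life.
exists (Num.min e1 e2), c; split => //; first by rewrite lt_min e10 e20 ge_min e11.
move=> eps /andP[e0]; rewrite lt_min => /andP[ee1 ee2].
have [h|h] := leP 1 (c * r eps); first by apply: H; rewrite ?e0.
apply: H2; first by rewrite e0.
by rewrite mulr_gt0 ?r0 ?(ltW h)// e0 (lt_le_trans ee1).
Qed.

Lemma two_shift T : 1 <= T -> 1 + T <= 2 * T.
Proof. by move=> T1; lra. Qed.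

Section subcritical.
Hypothesis a1 : a < 1.
Let a1' : 0 < 1 - a. Proof. by rewrite subr_gt0. Qed.

Lemma shift_integral_a T : 1 <= T ->
  \int[lam]_(s in `[0, T]) (1 + s) `^ (- a) <= (2 * T) `^ (1 - a) / (1 - a).
Proof.
move=> T1; have T0 : 0 <= T by exact: le_trans T1.
apply: le_trans (Rintegral_shift_powR_lt1 T0 a1) _.
apply: ler_wpM2r; first by rewrite invr_ge0 ltW.
by rewrite ge0_ler_powR ?nnegrE ?(ltW a1') ?two_shift ?addr_ge0 ?mulr_ge0.
Qed.

Lemma integral_a_ge t t0 : 1 <= t0 -> 4 * t0 <= t ->
  t `^ (1 - a) / 2 <= \int[lam]_(s in `[t / 2, t]) s `^ (- a).
Proof.
move=> t01 tt; have t0' : 0 < t by lra.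
have h1 : 1 <= t / 2 by lra.
have h2 : t / 2 <= t by lra.
apply: le_trans (ge_Rintegral_powRN (ltW a0) h1 h2).
rewrite powRD; last by apply/implyP => _; rewrite gt_eqF.
by rewrite powRr1 ?(ltW t0')// le_eqVlt; apply/orP; left; apply/eqP; field.
Qed.

(** Both integrals grow like powers of [T], and the time [T] is chosen so that the
    smallness condition is an equality. The factor two in [c] comes from
    [1 + T <= 2 * T]. *)
Lemma lower_rate_small : b < 1 ->
  lower_rate (fun eps => eps `^ (- (p * q / ((1 - b) * q + (1 - a))))).
Proof.
move=> b1; have b1' : 0 < 1 - b by rewrite subr_gt0.
set th := (1 - b) * q + (1 - a); have th0 : 0 < th by rewrite addr_gt0// mulr_gt0.
apply: lower_rate_of; first by move=> eps /andP[e0 _]; exact: powR_gt0.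
have [d [d0 H]] := lower.
pose K := (1 - b) `^ (- q) / (1 - a); have K0 : 0 < K by rewrite divr_gt0// powR_gt0.
pose c := (d / K) `^ (th^-1) / 2; have c0 : 0 < c by rewrite divr_gt0// powR_gt0// divr_gt0.
exists 1, c; split; rewrite ?ltr01 ?lexx//.
move=> eps /andP[e0 _]; set T := c * _ => T1.
have T0 : 0 < T by exact: lt_le_trans T1.
have T20 : 0 < 2 * T by rewrite mulr_gt0.
apply: (H eps T ((2 * T) `^ (1 - b) / (1 - b)) ((2 * T) `^ (1 - a) / (1 - a))) => //.
- exact: (divr_gt0 (powR_gt0 _ T20) b1').
- exact: (divr_gt0 (powR_gt0 _ T20) a1').
- apply: le_trans (Rintegral_shift_powR_lt1 (ltW T0) b1) _.
  apply: ler_wpM2r; first by rewrite invr_ge0 ltW.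
  by rewrite ge0_ler_powR ?nnegrE ?(ltW b1') ?(ltW T20) ?two_shift// addr_ge0// ltW.
- exact: shift_integral_a.
rewrite le_eqVlt; apply/orP; left; apply/eqP.
transitivity (eps `^ (p * q) * (2 * T) `^ th * K).
  rewrite powRM ?powR_ge0//; last by rewrite divr_ge0 ?powR_ge0// ltW.
  rewrite powRM ?powR_ge0 ?invr_ge0 ?(ltW b1')// -!powRrM /th (@powRD _ (2 * T) ((1 - b) * q)); last first.
    by apply/implyP => _; rewrite gt_eqF.
  rewrite /K powRN -(powR_inv1 (ltW b1')) -powRrM mulN1r powRN; field.
  by rewrite ?gt_eqF ?powR_gt0.
have -> : 2 * T = (d / K) `^ (th^-1) * eps `^ (- (p * q / th)) by rewrite /T /c; field.
rewrite powRM ?powR_ge0// -!powRrM mulVf ?gt_eqF// (powRr1 (ltW (divr_gt0 d0 K0))).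
rewrite mulNr divfK ?gt_eqF// [eps `^ (p * q) * _]mulrCA -powRD; last by apply/implyP => _; rewrite gt_eqF.
by rewrite subrr powRr0 mulr1 divfK// gt_eqF.
Qed.

(** The condition at [t2 = t] and [t1 = t / 2] bounds a power of [t]. Times below
    [4 * t0], where [t1] would be too close to [t0], are absorbed by the constant since
    the rate is at least one. *)
Lemma upper_rate_small : 0 < (1 - b) * q + (1 - a) ->
  upper_rate (fun eps => eps `^ (- (p * q / ((1 - b) * q + (1 - a))))).
Proof.
set th := (1 - b) * q + (1 - a) => th0.
have [t0 [C [t01 C0 H]]] := upper.
pose K := 2 * C * 4 `^ q; have K0 : 0 < K by rewrite !mulr_gt0 ?powR_gt0.
pose K' := K `^ (th^-1) + 4 * t0.
have K'0 : 0 < K' by rewrite ltr_wpDl ?powR_ge0// mulr_gt0// (lt_le_trans _ t01).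
exists 1, K'; split; rewrite ?ltr01 ?lexx//.
move=> eps /andP[e0 e1]; apply: lee_real_lt => t tl.
have r1 : 1 <= eps `^ (- (p * q / th)).
  rewrite powRN invf_ge1 ?powR_gt0//.
  rewrite -[leRHS](powRr0 eps) ger_powR ?e0 ?(ltW e1)//.
  by rewrite divr_ge0 ?mulr_ge0// ltW.
rewrite mulrDl; have [tt|tt] := leP t (4 * t0).
  rewrite -[leLHS]add0r; apply: lerD; first by rewrite mulr_ge0 ?powR_ge0.
  by apply: (le_trans tt); rewrite ler_peMr// mulr_ge0// (le_trans _ t01).
rewrite -[leLHS]addr0; apply: lerD; last first.
  by rewrite !mulr_ge0 ?powR_ge0// (le_trans _ t01).
have tp : 0 < t by lra.
have := powR_solve_le (powR_gt0 (p * q) e0) tp th0 (ltW K0).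
rewrite -powRrM mulrN => S; apply: S.
have h12 : t0 < t / 2 by lra.
have h22 : t / 2 <= t by lra.
have := H eps (t / 2) t e0 h12 h22 tl.
have Ib : t `^ (1 - b) / 4 <= \int[lam]_(s in `[t0, t / 2]) s `^ (- b).
  apply: le_trans (ge_Rintegral_powRN (ltW b0) t01 (ltW h12)).
  rewrite powRD; last by apply/implyP => _; rewrite gt_eqF.
  rewrite powRr1 ?(ltW tp)// mulrAC; apply: ler_pM; rewrite ?powR_ge0//.
  - by rewrite divr_ge0// ltW.
  - lra.
  - rewrite !powRN lef_pV2 ?posrE ?powR_gt0 ?divr_gt0//.
    by rewrite ge0_ler_powR ?nnegrE ?divr_ge0 ?(ltW b0) ?(ltW tp).
have Ja := integral_a_ge t01 (ltW tt).
move=> h; have h3 : (eps `^ p * (t `^ (1 - b) / 4)) `^ q * (t `^ (1 - a) / 2) <= C.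
  apply: le_trans h; apply: ler_pM; rewrite ?powR_ge0 ?divr_ge0 ?powR_ge0//.
  have z1 : 0 <= eps `^ p * (t `^ (1 - b) / 4) by rewrite mulr_ge0 ?divr_ge0 ?powR_ge0.
  have z2 : eps `^ p * (t `^ (1 - b) / 4) <= eps `^ p * \int[lam]_(s in `[t0, t / 2]) s `^ (- b).
    by apply: ler_wpM2l => //; exact: powR_ge0.
  by rewrite ge0_ler_powR ?nnegrE ?(ltW q0)// (le_trans z1).
have fq : 0 < 4 `^ q :> R by rewrite powR_gt0.
have := ler_wpM2l (ltW (mulr_gt0 (ltr0Sn R 1) fq)) h3; rewrite /K.
rewrite (_ : 2 * 4 `^ q * C = 2 * C * 4 `^ q); last by ring.
apply: le_trans; rewrite le_eqVlt; apply/orP; left; apply/eqP.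
rewrite powRM ?powR_ge0 ?divr_ge0 ?powR_ge0// [(_ / 4) `^ q]powRM ?powR_ge0//.
rewrite -!powRrM /th (@powRD _ t); last by apply/implyP => _; rewrite gt_eqF.
have -> : 4^-1 `^ q = (4 `^ q)^-1 :> R.
  by rewrite -powRN -(powR_inv1 (ler0n R 4)) -powRrM mulN1r.
by field; rewrite gt_eqF.
Qed.

(** The first integral is now bounded, and only the second one grows. *)
Lemma lower_rate_intermediate : 1 < b ->
  lower_rate (fun eps => eps `^ (- (p * q / (1 - a)))).
Proof.
move=> b1; have b1' : 0 < b - 1 by rewrite subr_gt0.
apply: lower_rate_of; first by move=> eps /andP[e0 _]; exact: powR_gt0.
have [d [d0 H]] := lower.
pose K := (b - 1)^-1 `^ q / (1 - a).
have K0 : 0 < K by rewrite divr_gt0// powR_gt0// invr_gt0.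
pose c := (d / K) `^ ((1 - a)^-1) / 2; have c0 : 0 < c by rewrite divr_gt0// powR_gt0// divr_gt0.
exists 1, c; split; rewrite ?ltr01 ?lexx//.
move=> eps /andP[e0 _]; set T := c * _ => T1.
have T0 : 0 < T by exact: lt_le_trans T1.
have T20 : 0 < 2 * T by rewrite mulr_gt0.
apply: (H eps T (b - 1)^-1 ((2 * T) `^ (1 - a) / (1 - a))) => //.
- by rewrite invr_gt0.
- exact: (divr_gt0 (powR_gt0 _ T20) a1').
- exact: Rintegral_shift_powR_gt1 (ltW T0) b1.
- exact: shift_integral_a.
rewrite le_eqVlt; apply/orP; left; apply/eqP.
transitivity (eps `^ (p * q) * (2 * T) `^ (1 - a) * K).
  by rewrite powRM ?powR_ge0 ?invr_ge0 ?(ltW b1')// -powRrM /K; ring.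
have -> : 2 * T = (d / K) `^ ((1 - a)^-1) * eps `^ (- (p * q / (1 - a))) by rewrite /T /c; field.
rewrite powRM ?powR_ge0// -!powRrM mulVf ?gt_eqF// (powRr1 (ltW (divr_gt0 d0 K0))).
rewrite mulNr divfK ?gt_eqF// [eps `^ (p * q) * _]mulrCA -powRD; last by apply/implyP => _; rewrite gt_eqF.
by rewrite subrr powRr0 mulr1 divfK// gt_eqF.
Qed.

Lemma upper_rate_intermediate : upper_rate (fun eps => eps `^ (- (p * q / (1 - a)))).
Proof.
have [t0 [C [t01 C0 H]]] := upper.
have t00 : 0 < t0 by exact: lt_le_trans t01.
pose i0 := t0 * (2 * t0) `^ (- b); have i00 : 0 < i0 by rewrite mulr_gt0 ?powR_gt0 ?mulr_gt0.
pose K := 2 * C / i0 `^ q; have K0 : 0 < K by rewrite divr_gt0 ?mulr_gt0 ?powR_gt0.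
pose K' := K `^ ((1 - a)^-1) + 4 * t0.
have K'0 : 0 < K' by rewrite ltr_wpDl ?powR_ge0// mulr_gt0.
exists 1, K'; split; rewrite ?ltr01 ?lexx//.
move=> eps /andP[e0 e1]; apply: lee_real_lt => t tl.
have r1 : 1 <= eps `^ (- (p * q / (1 - a))).
  rewrite powRN invf_ge1 ?powR_gt0//.
  rewrite -[leRHS](powRr0 eps) ger_powR ?e0 ?(ltW e1)//.
  by rewrite divr_ge0 ?mulr_ge0// ltW.
rewrite mulrDl; have [tt|tt] := leP t (4 * t0).
  rewrite -[leLHS]add0r; apply: lerD; first by rewrite mulr_ge0 ?powR_ge0.
  by apply: (le_trans tt); rewrite ler_peMr// mulr_ge0// ltW.
rewrite -[leLHS]addr0; apply: lerD; last by rewrite !mulr_ge0 ?powR_ge0// ltW.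
have tp : 0 < t by lra.
have := powR_solve_le (powR_gt0 (p * q) e0) tp a1' (ltW K0).
rewrite -powRrM mulrN => S; apply: S.
have h12 : t0 < t / 2 by lra.
have h22 : t / 2 <= t by lra.
have := H eps (t / 2) t e0 h12 h22 tl.
have hs1 : t0 <= 2 * t0 by lra.
have hs2 : 2 * t0 <= t / 2 by lra.
have Ib : i0 <= \int[lam]_(s in `[t0, t / 2]) s `^ (- b).
  rewrite (Rintegral_itv_split hs1 hs2); last exact: integrable_powRN (ltW b0) t01.
  rewrite -[leLHS]addr0; apply: lerD; last by apply: Rintegral_ge0 => s _; exact: powR_ge0.
  apply: le_trans (ge_Rintegral_powRN (ltW b0) t01 hs1).
  by rewrite /i0 (_ : 2 * t0 - t0 = t0)//; ring.
have Ja := integral_a_ge t01 (ltW tt).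
move=> h; have h3 : (eps `^ p * i0) `^ q * (t `^ (1 - a) / 2) <= C.
  apply: le_trans h; apply: ler_pM; rewrite ?powR_ge0 ?divr_ge0 ?powR_ge0//.
  have z1 : 0 <= eps `^ p * i0 by rewrite mulr_ge0 ?powR_ge0// ltW.
  have z2 : eps `^ p * i0 <= eps `^ p * \int[lam]_(s in `[t0, t / 2]) s `^ (- b).
    by apply: ler_wpM2l => //; exact: powR_ge0.
  by rewrite ge0_ler_powR ?nnegrE ?(ltW q0)// (le_trans z1).
have iq : 0 < i0 `^ q by rewrite powR_gt0.
rewrite /K ler_pdivlMr//.
have := ler_wpM2l (ler0n R 2) h3; apply: le_trans.
rewrite le_eqVlt; apply/orP; left; apply/eqP.
by rewrite powRM ?powR_ge0 ?(ltW i00)// -powRrM; field.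
Qed.

Let kap := q / (1 - a).
Let kap0 : 0 < kap. Proof. by rewrite divr_gt0. Qed.

Let ln_inv_gt0 eps : 0 < eps < 1 -> 0 < ln (1 / eps).
Proof. by move=> /andP[e0 e1]; rewrite ln_gt0// ltr_pdivlMr// mul1r. Qed.

Let lnVE eps : 0 < eps -> ln (1 / eps) = - ln eps.
Proof. by move=> e0; rewrite div1r lnV// posrE. Qed.

(** The first integral is [ln (1 + T)], and [1 + T] is at most a fixed power of
    [1 / eps]; this bounds the integral by a multiple of [ln (1 / eps)]. *)
Lemma lower_rate_log : b = 1 ->
  lower_rate (fun eps => (eps `^ p * ln (1 / eps)) `^ (- kap)).
Proof.
move=> b1.
apply: lower_rate_of.
  by move=> eps e01; rewrite powR_gt0// mulr_gt0 ?ln_inv_gt0// powR_gt0//; case/andP: e01.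
have [d [d0 H]] := lower.
pose K := (p * kap) `^ q / (1 - a); have K0 : 0 < K by rewrite divr_gt0// powR_gt0// mulr_gt0.
pose c := Num.min 1 ((d / K) `^ ((1 - a)^-1)) / 2.
have c0 : 0 < c by rewrite divr_gt0// lt_min ltr01 powR_gt0// divr_gt0.
have c1 : 2 * c <= 1 by rewrite /c mulrC divfK// ge_min lexx.
have c2 : 2 * c <= (d / K) `^ ((1 - a)^-1) by rewrite /c mulrC divfK// ge_min lexx orbT.
exists (expR (-1)), c; split => //; first by rewrite expR_gt0 -[leRHS]expR0 ler_expR lerN10.
move=> eps /andP[e0 e1].
have e1' : eps < 1 by apply: (lt_trans e1); rewrite -[ltRHS]expR0 ltr_expR ltrN10.
set l := ln (1 / eps).
have l1 : 1 <= l.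
  by rewrite /l lnVE// lerNr; rewrite -(ler_expR (ln eps)) lnK ?posrE// ltW.
have l0 : 0 < l by exact: lt_le_trans l1.
have el0 : 0 < eps `^ p * l by rewrite mulr_gt0// powR_gt0.
set L := (eps `^ p * l) `^ (- kap); set T := c * L => T1.
have L0 : 0 < L by exact: powR_gt0.
have T0 : 0 < T by exact: lt_le_trans T1.
have T20 : 0 < 2 * T by rewrite mulr_gt0.
have I0 : 0 < p * kap * l by exact: mulr_gt0 (mulr_gt0 p0 kap0) l0.
apply: (H eps T (p * kap * l) ((2 * T) `^ (1 - a) / (1 - a))) => //.
- exact: (divr_gt0 (powR_gt0 _ T20) a1').
- rewrite b1 Rintegral_shift_powR_eq1 ?(ltW T0)//.
  apply: (@le_trans _ _ (ln (eps `^ (- (p * kap))))); last first.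
    by rewrite ln_powR /l lnVE// mulNr mulrN.
  rewrite ler_ln ?posrE ?powR_gt0 ?addr_gt0//.
  apply: (le_trans (two_shift T1)); apply: (@le_trans _ _ L).
    by rewrite /T mulrA ler_piMl// ltW.
  rewrite /L !powRN lef_pV2 ?posrE ?powR_gt0// powRrM.
  by rewrite ge0_ler_powR ?nnegrE ?(ltW kap0) ?(ltW el0) ?powR_ge0// ler_peMr ?powR_ge0.
- exact: shift_integral_a.
apply: (@le_trans _ _ (K * (2 * c) `^ (1 - a))).
  rewrite le_eqVlt; apply/orP; left; apply/eqP.
  rewrite (_ : eps `^ p * (p * kap * l) = p * kap * (eps `^ p * l)); last by ring.
  rewrite (powRM q (ltW (mulr_gt0 p0 kap0)) (ltW el0)).
  have c20 : 0 <= 2 * c by rewrite mulr_ge0// ltW.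
  rewrite (_ : 2 * T = 2 * c * L); last by rewrite /T; ring.
  rewrite (powRM (1 - a) c20 (ltW L0)).
  have -> : L `^ (1 - a) = ((eps `^ p * l) `^ q)^-1.
    by rewrite /L -powRrM mulNr powRN /kap divfK// gt_eqF.
  by rewrite /K; field; rewrite !gt_eqF ?powR_gt0.
apply: (@le_trans _ _ (K * ((d / K) `^ ((1 - a)^-1)) `^ (1 - a))).
  apply: ler_wpM2l; first exact: ltW.
  have c20 : 0 <= 2 * c by rewrite mulr_ge0// ltW.
  by apply: ge0_ler_powR; rewrite ?nnegrE ?powR_ge0// ltW.
rewrite -powRrM mulVf ?gt_eqF// (powRr1 (ltW (divr_gt0 d0 K0))).
by rewrite mulrC divfK// gt_eqF.
Qed.

(** Either [t] is below a power of [1 / eps] smaller than the claimed rate, or the first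
    integral is at least a multiple of [ln (1 / eps)]. *)
Lemma upper_rate_log : b = 1 ->
  upper_rate (fun eps => (eps `^ p * ln (1 / eps)) `^ (- kap)).
Proof.
move=> b1; have [t0 [C [t01 C0 H]]] := upper.
have t00 : 0 < t0 by exact: lt_le_trans t01.
(* Half the exponent of the rate, so that the other half controls the logarithm in the
   rate. *)
pose al := p * kap / 2; have al0 : 0 < al by rewrite divr_gt0// mulr_gt0.
pose K := 2 * C / al `^ q; have K0 : 0 < K by rewrite divr_gt0 ?mulr_gt0 ?powR_gt0.
pose K' := K `^ ((1 - a)^-1) + 4 * t0 * (kap / al) `^ kap.
have kal : 0 < kap / al by rewrite divr_gt0.
have K'0 : 0 < K' by rewrite ltr_wpDl ?powR_ge0// !mulr_gt0// powR_gt0.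
exists 1, K'; split; rewrite ?ltr01 ?lexx//.
move=> eps e01; have /andP[e0 e1] := e01; apply: lee_real_lt => t tl.
have l0 := ln_inv_gt0 e01; set l := ln (1 / eps) in l0 *.
have el0 : 0 < eps `^ p * l by rewrite mulr_gt0// powR_gt0.
have ea1 : 1 <= eps `^ (- al).
  rewrite powRN invf_ge1 ?powR_gt0//.
  by rewrite -[leRHS](powRr0 eps) ger_powR ?e0 ?(ltW e1)// ltW.
have lk : l <= kap / al * eps `^ (- (al / kap)).
  have : ln (eps `^ (- (al / kap))) <= eps `^ (- (al / kap)).
    have := @le_ln1Dx R (eps `^ (- (al / kap)) - 1); rewrite [1 + _]addrC subrK => h.
    by apply: le_trans (h _) _; rewrite ?gerBl// ltrBDl subrr powR_gt0.
  rewrite ln_powR mulNr -mulrN -lnVE// -/l => /(ler_wpM2l (ltW kal)); apply: le_trans.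
  by rewrite le_eqVlt; apply/orP; left; apply/eqP; field; rewrite !gt_eqF.
rewrite mulrDl; have [tt|tt] := leP t (4 * t0 * eps `^ (- al)).
  rewrite -[leLHS]add0r; apply: lerD; first by rewrite mulr_ge0 ?powR_ge0.
  apply: (le_trans tt); rewrite -[leRHS]mulrA; apply: ler_wpM2l; first by rewrite mulr_ge0// ltW.
  have lk2 : l `^ kap <= (kap / al) `^ kap * eps `^ (- al).
    apply: (@le_trans _ _ ((kap / al * eps `^ (- (al / kap))) `^ kap)).
      have r0 : 0 <= kap / al * eps `^ (- (al / kap)) := mulr_ge0 (ltW kal) (powR_ge0 _ _).
      by rewrite ge0_ler_powR ?nnegrE ?(ltW kap0) ?(ltW l0).
    by rewrite powRM ?powR_ge0 ?(ltW kal)// -powRrM mulNr divfK// gt_eqF.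
  rewrite (powRM (- kap) (powR_ge0 eps p) (ltW l0)) -powRrM.
  have -> : eps `^ (p * - kap) = eps `^ (- al) * eps `^ (- al).
    rewrite -powRD; last by apply/implyP => _; rewrite gt_eqF.
    by congr (_ `^ _); rewrite /al; field.
  rewrite (powRN l) mulrA ler_pdivlMr ?powR_gt0//.
  rewrite (mulrCA _ (eps `^ (- al))); apply: ler_wpM2l; first exact: powR_ge0.
  by [].
rewrite -[leLHS]addr0; apply: lerD; last by rewrite !mulr_ge0 ?powR_ge0// ltW.
have tt' : 4 * t0 < t.
  by apply: le_lt_trans tt; apply: ler_peMr => //; rewrite mulr_ge0// ltW.
have tp : 0 < t by lra.
have := powR_solve_le (powR_gt0 q el0) tp a1' (ltW K0).
rewrite -powRrM mulrN => S; apply: S.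
have h12 : t0 < t / 2 by lra.
have h22 : t / 2 <= t by lra.
have := H eps (t / 2) t e0 h12 h22 tl.
have Ib : al * l <= \int[lam]_(s in `[t0, t / 2]) s `^ (- b).
  rewrite b1 Rintegral_powRN1// ?(ltW h12)//.
  rewrite -ln_div ?posrE ?divr_gt0//.
  have -> : al * l = ln (eps `^ (- al)) by rewrite ln_powR /l lnVE// mulNr mulrN.
  rewrite ler_ln ?posrE ?powR_gt0 ?divr_gt0//.
  rewrite ler_pdivlMr// ler_pdivlMr//.
  by apply: le_trans (ltW tt); have := mulr_ge0 (ltW t00) (powR_ge0 eps (- al)); lra.
have Ja := integral_a_ge t01 (ltW tt').
move=> h; have h3 : (eps `^ p * (al * l)) `^ q * (t `^ (1 - a) / 2) <= C.
  apply: le_trans h; apply: ler_pM; rewrite ?powR_ge0 ?divr_ge0 ?powR_ge0//.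
  have z1 : 0 <= eps `^ p * (al * l) := mulr_ge0 (powR_ge0 _ _) (ltW (mulr_gt0 al0 l0)).
  have z2 : eps `^ p * (al * l) <= eps `^ p * \int[lam]_(s in `[t0, t / 2]) s `^ (- b).
    by apply: ler_wpM2l => //; exact: powR_ge0.
  by rewrite ge0_ler_powR ?nnegrE ?(ltW q0)// (le_trans z1).
have aq : 0 < al `^ q by rewrite powR_gt0.
rewrite /K ler_pdivlMr//.
have := ler_wpM2l (ler0n R 2) h3; apply: le_trans.
rewrite le_eqVlt; apply/orP; left; apply/eqP.
rewrite (_ : eps `^ p * (al * l) = al * (eps `^ p * l)); last by ring.
by rewrite (powRM q (ltW al0) (ltW el0)); field.
Qed.

End subcritical.

(** The second integral is now the logarithm of the time, and the smallness condition
    bounds that logarithm. *)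
Lemma lower_rate_critical : a = 1 -> 1 < b -> exists e1 c : R, [/\ 0 < e1 <= 1, 0 < c &
  forall eps, 0 < eps < e1 -> ((expR (c * eps `^ (- (p * q))))%:E <= life eps)%E].
Proof.
move=> a1 b1; have b1' : 0 < b - 1 by rewrite subr_gt0.
have [d [d0 H]] := lower.
pose K := (b - 1)^-1 `^ q; have K0 : 0 < K by rewrite powR_gt0// invr_gt0.
pose c := d / (2 * K); have c0 : 0 < c by rewrite divr_gt0 ?mulr_gt0.
have [r r0 Hr] := powR_small c0 (mulr_gt0 p0 q0).
exists (Num.min r 1), c; split => //; first by rewrite lt_min r0 ltr01 ge_min lexx orbT.
move=> eps /andP[e0]; rewrite lt_min => /andP[er e1].
set X := eps `^ (- (p * q)); have X0 : 0 < X by exact: powR_gt0.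
have Xc : eps `^ (p * q) <= c by exact: Hr.
have XE : eps `^ (p * q) * X = 1.
  by rewrite -powRD ?subrr ?powRr0//; apply/implyP => _; rewrite gt_eqF.
set T := expR (c * X).
have T1 : 1 <= T by rewrite -[leLHS]expR0 ler_expR mulr_ge0// ltW.
have T0 : 0 < T by exact: expR_gt0.
have l2 : ln 2 <= 1 :> R.
  by have := @le_ln1Dx R 1; rewrite (_ : 1 + 1 = 2) => [|//]; apply; lra.
have J0 : 0 < 1 + c * X by rewrite ltr_pwDl// mulr_ge0// ltW.
apply: (H eps T (b - 1)^-1 (1 + c * X)) => //.
- by rewrite invr_gt0.
- exact: Rintegral_shift_powR_gt1 (ltW T0) b1.
- rewrite a1 Rintegral_shift_powR_eq1 ?(ltW T0)//.
  apply: (@le_trans _ _ (ln (2 * T))).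
    by rewrite ler_ln ?posrE ?addr_gt0 ?mulr_gt0// two_shift.
  by rewrite lnM ?posrE// /T expRK lerD2r.
rewrite powRM ?powR_ge0 ?invr_ge0 ?(ltW b1')// -powRrM -/K.
rewrite (_ : _ * K * _ = K * (eps `^ (p * q) + c * (eps `^ (p * q) * X))); last by ring.
rewrite XE mulr1; apply: (@le_trans _ _ (K * (c + c))).
  by apply: ler_wpM2l; [exact: ltW | rewrite lerD2r].
by rewrite le_eqVlt; apply/orP; left; apply/eqP; rewrite /c; field; rewrite gt_eqF.
Qed.

(** With [t1 = 2 * t0] fixed, the condition bounds the logarithm of [t]. *)
Lemma upper_rate_critical : a = 1 -> exists e1 C : R, [/\ 0 < e1 <= 1, 0 < C &
  forall eps, 0 < eps < e1 -> (life eps <= (expR (C * eps `^ (- (p * q))))%:E)%E].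
Proof.
move=> a1; have [t0 [C [t01 C0 H]]] := upper.
have t00 : 0 < t0 by exact: lt_le_trans t01.
pose i0 := t0 * (2 * t0) `^ (- b); have i00 : 0 < i0 by rewrite mulr_gt0 ?powR_gt0 ?mulr_gt0.
pose K := C / i0 `^ q; have K0 : 0 < K by rewrite divr_gt0 ?powR_gt0.
have t20 : 0 < 2 * t0 by rewrite mulr_gt0.
have lt0 : 0 <= ln (2 * t0) by rewrite ln_ge0//; lra.
exists 1, (K + ln (2 * t0)); split; rewrite ?ltr01 ?lexx ?ltr_wpDr//.
move=> eps /andP[e0 e1]; apply: lee_real_lt => t tl.
set X := eps `^ (- (p * q)).
have X1 : 1 <= X.
  rewrite /X powRN invf_ge1 ?powR_gt0//.
  by rewrite -[leRHS](powRr0 eps) ger_powR ?e0 ?(ltW e1)// mulr_ge0// ltW.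
have X0 : 0 <= X by exact: le_trans X1.
have lX : ln (2 * t0) <= ln (2 * t0) * X by rewrite ler_peMr.
have [tt|tt] := leP t (2 * t0).
  apply: (le_trans tt); rewrite -[leLHS]lnK ?posrE// ler_expR [leRHS]mulrDl.
  by apply: (le_trans lX); rewrite lerDr mulr_ge0// ltW.
have tp : 0 < t by lra.
rewrite -[leLHS]lnK ?posrE// ler_expR [leRHS]mulrDl -lerBlDr.
have h12 : t0 < 2 * t0 by lra.
have := H eps (2 * t0) t e0 h12 (ltW tt) tl.
rewrite a1 Rintegral_powRN1 ?(ltW tt)//.
have Ib : i0 <= \int[lam]_(s in `[t0, 2 * t0]) s `^ (- b).
  apply: le_trans (ge_Rintegral_powRN (ltW b0) t01 (ltW h12)).
  by rewrite /i0 (_ : 2 * t0 - t0 = t0)//; ring.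
have Jp : 0 <= ln t - ln (2 * t0) by rewrite subr_ge0 ler_ln ?posrE// ltW.
move=> h; have h3 : (eps `^ p * i0) `^ q * (ln t - ln (2 * t0)) <= C.
  apply: le_trans h; apply: ler_wpM2r => //.
  have z1 : 0 <= eps `^ p * i0 by rewrite mulr_ge0 ?powR_ge0// ltW.
  have z2 : eps `^ p * i0 <= eps `^ p * \int[lam]_(s in `[t0, 2 * t0]) s `^ (- b).
    by apply: ler_wpM2l => //; exact: powR_ge0.
  by rewrite ge0_ler_powR ?nnegrE ?(ltW q0)// (le_trans z1).
apply: (@le_trans _ _ (ln t - ln (2 * t0))); first by rewrite lerD2l lerN2.
have iq : 0 < i0 `^ q by rewrite powR_gt0.
have eq0 : 0 < eps `^ (p * q) by rewrite powR_gt0.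
rewrite /K /X powRN ler_pdivlMr// ler_pdivlMr//.
apply: le_trans h3; rewrite le_eqVlt; apply/orP; left; apply/eqP.
by rewrite powRM ?powR_ge0 ?(ltW i00)// -powRrM; ring.
Qed.

End asymptotics.

(** * Initial data *)

Lemma ess_bounded_representative d (T : measurableType d) (R : realType)
    (m : {measure set T -> \bar R}) (f : T -> R) : f \in Lfun m +oo%E ->
  exists (M : R) (g : T -> R), [/\ measurable_fun setT g, forall x, `|g x| <= M,
    forall x, `|g x| <= `|f x| & {ae m, forall x, g x = f x}].
Proof.
move=> fL; have mf : measurable_fun setT f by exact: (set_mem (sub_Lfun_mfun fL)).
have ffin : finite_norm m +oo%E f by exact: (set_mem (sub_Lfun_finLfun fL)).
have [M M0 fM] : exists2 M : R, 0 <= M & {ae m, forall x, `|f x| <= M}.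
  move: ffin; rewrite /finite_norm unlock /Lnorm; case: ifPn => [_|].
    move=> /(@ess_sup_inf.ess_supr_bounded _ _ _ m (fun x => `|f x|))[M fM].
    exists `|M|; rewrite ?normr_ge0//.
    by apply: filterS fM => x fx; exact: le_trans fx (ler_norm M).
  rewrite -leNgt measure_le0 => /eqP m0 _; exists 0 => //; exists setT; split => //.
exists M, (fun x => if `|f x| <= M then f x else 0); split.
- apply: measurable_fun_ifT => //; apply: measurable_fun_ler => //.
  exact: measurableT_comp.
- by move=> x; case: ifP => //; rewrite normr0.
- by move=> x; case: ifP => // _; rewrite normr0.
- by apply: filterS fM => x ->.
Qed.

(** The conditions of the preceding parts ask for a datum that is bounded everywhere. A
    bounded representative has the same mean and the same first moment, and it is below
    the original datum in absolute value, so that it inherits the integrability of that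
    datum. *)
Section lifespan_bounds.
Context (R : realType) (n : nat) (p : R) (u0 : Rn R n -> R).
Local Notation mu := (lebesgue_Rn R n).
Local Notation lam := (@lebesgue_measure R).
Hypothesis p1 : 1 < p.
Hypothesis u0_L1 : u0 \in Lfun mu 1%E.
Hypothesis u0_Loo : u0 \in Lfun mu +oo%E.
Hypothesis xu0_L1 : (fun x => enorm x * u0 x) \in Lfun mu 1%E.
Hypothesis u0_mean : \int[mu]_x u0 x = 0.
Local Notation a := (n%:R * (p - 1) / 2).
Local Notation b := (p / 2 + n%:R * (p - 1) / 2).

Let mu0 : measurable_fun setT u0. Proof. exact: (set_mem (sub_Lfun_mfun u0_L1)). Qed.

Let iu0 : mu.-integrable setT (EFin \o u0). Proof. exact/Lfun1_integrable. Qed.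

Let ixu0 : mu.-integrable setT (EFin \o (fun x => enorm x * u0 x)).
Proof. exact/Lfun1_integrable. Qed.

Let Rintegral_ae (f g : Rn R n -> R) : measurable_fun setT f -> measurable_fun setT g ->
  {ae mu, forall x, f x = g x} -> \int[mu]_x f x = \int[mu]_x g x.
Proof.
move=> mf mg fg; congr fine; apply: ae_eq_integral => //; try exact/measurable_EFinP.
by apply: filterS fg => x /= ->.
Qed.

Let representative_mean (v0 : Rn R n -> R) : measurable_fun setT v0 -> {ae mu, forall y, v0 y = u0 y} ->
  \int[mu]_y v0 y = 0.
Proof. by move=> mv0 vu; rewrite -u0_mean; exact: Rintegral_ae. Qed.

Let representative_integrable (v0 : Rn R n -> R) : measurable_fun setT v0 -> (forall y, `|v0 y| <= `|u0 y|) ->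
  mu.-integrable setT (EFin \o v0).
Proof.
move=> mv0 v0u0; apply: le_integrable iu0 => //; first exact/measurable_EFinP.
by move=> x _ /=; rewrite lee_fin.
Qed.

Let representative_moment (v0 : Rn R n -> R) : measurable_fun setT v0 -> (forall y, `|v0 y| <= `|u0 y|) ->
  mu.-integrable setT (EFin \o (fun y => enorm y * `|v0 y|)).
Proof.
move=> mv0 v0u0; apply: le_integrable ixu0 => //.
  apply/measurable_EFinP; apply: measurable_funM; last exact: measurableT_comp.
  exact: (@measurable_enorm _ _ _ _ id).
move=> x _ /=; rewrite lee_fin !normrM normr_id; apply: ler_wpM2l => //.
Qed.

Lemma lifespan_lower : exists delta : R, 0 < delta /\
  forall eps T I J : R, 0 < eps -> 0 < T -> 0 < I -> 0 < J ->
  \int[lam]_(s in `[0, T]) (1 + s) `^ (- b) <= I ->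
  \int[lam]_(s in `[0, T]) (1 + s) `^ (- a) <= J ->
  (eps `^ p * I) `^ (p - 1) * J <= delta -> (T%:E <= lifespan p eps u0)%E.
Proof.
have [M0 [v0 [mv0 v0M v0u0 vu]]] := ess_bounded_representative u0_Loo.
exact: (lifespan_ge mv0 v0M (representative_integrable mv0 v0u0)
  (representative_moment mv0 v0u0) (representative_mean mv0 vu) mu0 vu p1).
Qed.

(** A time below the supremum that defines the lifespan is below the existence time of
    some solution. *)
Lemma lifespan_upper :
  \row_(i < n) (\int[mu]_x (coordinate i x * u0 x)) != 0 ->
  exists t0 C : R, [/\ 1 <= t0, 0 < C &
  forall eps t1 t2, 0 < eps -> t0 < t1 -> t1 <= t2 -> (t2%:E < lifespan p eps u0)%E ->
  (eps `^ p * \int[lam]_(s in `[t0, t1]) s `^ (- b)) `^ (p - 1) *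
    \int[lam]_(s in `[t1, t2]) s `^ (- a) <= C].
Proof.
move=> moment.
have [M0 [v0 [mv0 v0M v0u0 vu]]] := ess_bounded_representative u0_Loo.
have [i mi] : exists i : 'I_n, \int[mu]_y (tnth y i * v0 y) != 0.
  apply/existsP; apply: contraNT moment; rewrite negb_exists => /forallP h.
  apply/eqP/rowP => i; rewrite !mxE; have /negPn/eqP <- := h i.
  have mi (f : Rn R n -> R) : measurable_fun setT f ->
      measurable_fun setT (fun y => (tnth y i : R) * f y).
    by move=> mf; apply: measurable_funM => //; exact: measurable_tnth.
  apply: Rintegral_ae; [exact: mi|exact: mi|].
  by apply: filterS vu => x ->.
have [t0 [C [t01 C0 H]]] := mild_solution_bound p1 (representative_integrable mv0 v0u0)
  (representative_moment mv0 v0u0) (representative_mean mv0 vu) mi mu0 vu.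
exists t0, C; split => // eps t1 t2 e0 t01' t12 tl.
have [T [T0 [u Hu]] t2T] := ereal_sup_gt tl.
exact: H Hu _ _ _.
Qed.

End lifespan_bounds.

(** * The exponents and the theorem *)

Section rate_exponents.
Context (R : realType) (n : nat) (p : R).
Local Notation a := (n%:R * (p - 1) / 2).
Local Notation b := (p / 2 + n%:R * (p - 1) / 2).
Hypothesis n0 : (1 <= n)%N.

Let n0' : 0 < n%:R :> R. Proof. by rewrite ltr0n. Qed.

Lemma lt_p_F : (p < p_F R n) = (a < 1).
Proof.
by rewrite /p_F -ltrBlDl ltr_pdivlMr// ltr_pdivrMr// mul1r mulrC.
Qed.

Lemma eq_p_F : p = p_F R n -> a = 1.
Proof. by rewrite /p_F => ->; field; rewrite gt_eqF. Qed.

Lemma lt_p_m : (p < p_m R n) = (b < 1).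
Proof.
rewrite /p_m -ltrBlDl ltr_pdivlMr// -[n.+1]addn1 natrD.
by apply/idP/idP; lra.
Qed.

Lemma eq_p_m : p = p_m R n -> b = 1.
Proof.
by rewrite /p_m => ->; rewrite -[n.+1]addn1 natrD; field; rewrite lt0r_neq0//; have := n0'; lra.
Qed.

Lemma gt_p_m : p_m R n < p -> 1 < b.
Proof.
rewrite /p_m -ltrBrDl ltr_pdivrMr// -[n.+1]addn1 natrD; lra.
Qed.

Lemma lifespan_rate_small (eps : R) : p != 0 -> (1 - b) * (p - 1) + (1 - a) != 0 -> p < p_m R n ->
  lifespan_rate n p eps = eps `^ (- (p * (p - 1) / ((1 - b) * (p - 1) + (1 - a)))).
Proof.
move=> p0 h pm; rewrite /lifespan_rate pm; congr (_ `^ (- _)).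
have e : (1 - b) * (p - 1) + (1 - a) = p * (2 - n.+1%:R * (p - 1)) / 2.
  by rewrite -[n.+1]addn1 natrD; field.
rewrite e in h *; have h2 : 2 - (1 + n%:R) * (p - 1) != 0.
  by apply: contraNneq h => h'; rewrite -[n.+1]add1n natrD h' mulr0 mul0r.
by field; rewrite p0 h2.
Qed.

Lemma lifespan_rate_intermediate (eps : R) : 1 - a != 0 -> p_m R n < p ->
  lifespan_rate n p eps = eps `^ (- (p * (p - 1) / (1 - a))).
Proof.
move=> h pm; rewrite /lifespan_rate ltNge (ltW pm)/= gt_eqF//; congr (_ `^ (- _)).
have h2 : 2 - n%:R * (p - 1) != 0 by apply: contraNneq h => e; apply/eqP; lra.
by field; rewrite h2.
Qed.

(** At the exponent [p_m], the powers of [eps] and of the logarithm combine into one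
    power of their product [eps `^ p * ln (1 / eps)]. *)
Lemma lifespan_rate_log (eps : R) : 0 < eps < 1 -> p = p_m R n ->
  lifespan_rate n p eps = (eps `^ p * ln (1 / eps)) `^ (- ((p - 1) / (1 - a))).
Proof.
move=> /andP[e0 e1] pm; rewrite /lifespan_rate -pm ltxx eqxx.
have l0 : 0 <= ln (1 / eps) by rewrite ln_ge0// ler_pdivlMr// mul1r ltW.
have k : (p - 1) / (1 - a) = 2 / n.+2%:R.
  rewrite pm /p_m -[n.+2]addn2 -[n.+1]addn1 !natrD; field.
  by have := n0'; rewrite !lt0r_neq0//; lra.
rewrite powRM ?powR_ge0// -powRrM k; congr (_ `^ _ * _).
rewrite pm /p_m -[n.+2]addn2 -[n.+1]addn1 !natrD; field.
by have := n0'; rewrite !lt0r_neq0//; lra.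
Qed.

End rate_exponents.

Section two_sided.
Context (R : realType) (life : R -> \bar R).

Lemma two_sided_rate (r r' : R -> R) : (forall eps, 0 < eps < 1 -> r eps = r' eps) ->
  lower_rate life r' -> upper_rate life r' ->
  exists eps0 c C : R, [/\ 0 < eps0 <= 1, 0 < c, 0 < C & forall eps, 0 < eps < eps0 ->
    ((c * r eps)%:E <= life eps <= (C * r eps)%:E)%E].
Proof.
move=> rr' [e1 [c [/andP[e10 e11] c0 lo]]] [e2 [C [/andP[e20 e21] C0 up]]].
exists (Num.min e1 e2), c, C; split => //; first by rewrite lt_min e10 e20 ge_min e11.
move=> eps /andP[e0]; rewrite lt_min => /andP[ee1 ee2].
have e01 : 0 < eps < 1 by rewrite e0 (lt_le_trans ee1).
by rewrite rr'// lo ?e0// up ?e0.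
Qed.

End two_sided.

Theorem theorem1p1 (R : realType) (n : nat) (p : R) (u0 : Rn R n -> R)
    (hn : (1 <= n)%N) (hp : 1 < p <= p_F R n)
    (u0_L1 : u0 \in Lfun (lebesgue_Rn R n) 1%E)
    (u0_Loo : u0 \in Lfun (lebesgue_Rn R n) +oo%E)
    (xu0_L1 : (fun x => enorm x * u0 x) \in Lfun (lebesgue_Rn R n) 1%E)
    (u0_mean : \int[lebesgue_Rn R n]_x u0 x = 0)
    (u0_moment :
      \row_(i < n) (\int[lebesgue_Rn R n]_x (coordinate i x * u0 x)) != 0) :
  (exists eps0 c C : R, [/\ 0 < eps0 <= 1, 0 < c, 0 < C &
    forall eps : R, 0 < eps < eps0 ->
      (p < p_F R n ->
        ((c * lifespan_rate n p eps)%:E <= lifespan p eps u0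
           <= (C * lifespan_rate n p eps)%:E)%E) /\
      (p = p_F R n ->
        ((expR (c * eps `^ (- (p * (p - 1)))))%:E <= lifespan p eps u0
           <= (expR (C * eps `^ (- (p * (p - 1)))))%:E)%E)])
  /\ (\forall eps \near 0^'+, (lifespan p eps u0 < +oo)%E).
Proof.
have /andP[p1 pF] := hp.
pose a := n%:R * (p - 1) / 2; pose b := p / 2 + a; pose q := p - 1.
pose life eps := lifespan p eps u0.
have q0 : 0 < q by rewrite subr_gt0.
have p0 : 0 < p by exact: lt_trans p1.
have a0 : 0 < a by rewrite divr_gt0// mulr_gt0// ltr0n.
have b0 : 0 < b by rewrite addr_gt0// divr_gt0.
have lower := lifespan_lower p1 u0_L1 u0_Loo xu0_L1 u0_mean.
have upper := lifespan_upper p1 u0_L1 u0_Loo xu0_L1 u0_mean u0_moment.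
suff two_sided : exists eps0 c C : R, [/\ 0 < eps0 <= 1, 0 < c, 0 < C &
    forall eps : R, 0 < eps < eps0 ->
      (p < p_F R n ->
        ((c * lifespan_rate n p eps)%:E <= lifespan p eps u0
           <= (C * lifespan_rate n p eps)%:E)%E) /\
      (p = p_F R n ->
        ((expR (c * eps `^ (- (p * (p - 1)))))%:E <= lifespan p eps u0
           <= (expR (C * eps `^ (- (p * (p - 1)))))%:E)%E)].
  split => //; have [e1 [c [C [/andP[e10 _] c0 C0 H]]]] := two_sided.
  near=> eps.
  have e01 : 0 < eps < e1.
    by apply/andP; split; near: eps; [exact: nbhs_right_gt | exact: nbhs_right_lt].
  have [H1 H2] := H eps e01.
  move: pF; rewrite le_eqVlt => /orP[/eqP/H2/andP[_ h]|/H1/andP[_ h]];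
    exact: le_lt_trans h (ltry _).
move: pF; rewrite le_eqVlt => /orP[/eqP pF|pF].
  have a1 := eq_p_F hn pF; have b1 : 1 < b by rewrite /b /a a1 ltrDr divr_gt0.
  have [e1 [c [/andP[e10 e11] c0 lo]]] := lower_rate_critical p1 lower a1 b1.
  have [e2 [C [/andP[e20 e21] C0 up]]] := upper_rate_critical p1 b0 upper a1.
  exists (Num.min e1 e2), c, C; split => //; first by rewrite lt_min e10 e20 ge_min e11.
  move=> eps /andP[e0]; rewrite lt_min => /andP[ee1 ee2]; split.
    by rewrite pF ltxx.
  by rewrite lo ?e0// up ?e0.
have a1 : a < 1 by rewrite -lt_p_F.
suff [e1 [c [C [e1P c0 C0 H]]]] : exists eps0 c C : R, [/\ 0 < eps0 <= 1, 0 < c, 0 < C &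
    forall eps, 0 < eps < eps0 ->
    ((c * lifespan_rate n p eps)%:E <= lifespan p eps u0 <= (C * lifespan_rate n p eps)%:E)%E].
  exists e1, c, C; split => // eps /H h; split => // pF'.
  by move: pF; rewrite -pF' ltxx.
have [pm|pm|pm] := ltgtP p (p_m R n).
- have b1 : b < 1 by rewrite -lt_p_m.
  have th0 : 0 < (1 - b) * q + (1 - a) by rewrite addr_gt0 ?mulr_gt0 ?subr_gt0.
  apply: (@two_sided_rate _ life); last exact: (@upper_rate_small _ _ _ _ life) p1 a0 b0 upper th0.
    by move=> eps _; apply: lifespan_rate_small; rewrite ?gt_eqF.
  exact: (@lower_rate_small _ _ _ _ life) p1 a0 b0 lower a1 b1.
- have b1 : 1 < b by exact: gt_p_m.
  apply: (@two_sided_rate _ life); last exact: (@upper_rate_intermediate _ _ _ _ life) p1 a0 b0 upper a1.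
    by move=> eps _; apply: lifespan_rate_intermediate; rewrite ?gt_eqF ?subr_gt0.
  exact: (@lower_rate_intermediate _ _ _ _ life) p1 a0 b0 lower a1 b1.
- have b1 : b = 1 by exact: eq_p_m.
  apply: (@two_sided_rate _ life); last exact: (@upper_rate_log _ _ _ _ life) p1 a0 upper a1 b1.
    by move=> eps e01; exact: lifespan_rate_log.
  exact: (@lower_rate_log _ _ _ _ life) p1 a0 b0 lower a1 b1.
Unshelve. all: by end_near. Qed.
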